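(* Let $G$ be any group and let $x\in G$ be a left $3$-Engel element of $G$ whose order divides $60$. Suppose furthermore that the normal closure $\langle x\rangle^{G}$ has no elements of order $8$, $9$ or $25$. Then $x\in HP(G)$.
   Context: Commutators are $[u,v]=u^{-1}v^{-1}uv$, and longer commutators are left-normed. An element $x$ of a group $G$ is a left $3$-Engel element of $G$ if $[[[g,x],x],x]=1$ for all $g\in G$. $\langle x\rangle^{G}$ denotes the normal closure of $\langle x\rangle$ in $G$. $HP(G)$ denotes the Hirsch-Plotkin radical of $G$ (also called the locally nilpotent radical), i.e. the unique largest normal locally nilpotent subgroup of $G$. *)

(* Defs.v *)
From mathcomp Require Import all_boot.
From mathcomp Require Import boolp classical_sets functions cardinality.

Set Implicit Arguments.
Unset Strict Implicit.
Unset Printing Implicit Defensive.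

Local Open Scope classical_set_scope.
Local Open Scope group_scope.

(* [groupType] is the type of arbitrary, possibly infinite, groups. The choice
   operator it carries is no restriction in classical logic. Its commutators
   [~ u, v] = u^-1 * (v^-1 * (u * v)) are left-normed. *)
Section GroupTheory.
Variable G : groupType.
Implicit Types (A H K : set G) (x y g h : G) (n : nat).

Definition subgroup H : Prop := group_closed (mem H).

Definition normal_subgroup H : Prop :=
  subgroup H /\ (forall g h, H h -> H (h ^ g)).

Definition generated A : set G := smallest subgroup A.

Definition normal_closure A : set G := smallest normal_subgroup A.

(* Indexed from 0: [lower_central H 0] is the first term H of the series. *)
Fixpoint lower_central H n : set G :=
  if n is m.+1 then
    generated [set [~ u, v] | u in lower_central H m & v in H]
  else H.

Definition nilpotent_subgroup H : Prop :=
  subgroup H /\ exists n, lower_central H n = [set 1].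

Definition locally_nilpotent_subgroup H : Prop :=
  subgroup H /\
  forall A, finite_set A -> A `<=` H -> nilpotent_subgroup (generated A).

Definition is_hirsch_plotkin_radical H : Prop :=
  [/\ normal_subgroup H, locally_nilpotent_subgroup H &
      forall K, normal_subgroup K -> locally_nilpotent_subgroup K -> K `<=` H].

(* The default set0 is not a subgroup, so x \in HP(G) also carries the
   existence of a largest normal locally nilpotent subgroup. *)
Definition hirsch_plotkin_radical : set G :=
  xget set0 is_hirsch_plotkin_radical.

Definition left_3_engel x : Prop := forall g, [~ g, x, x, x] = 1.

Definition has_order x n : Prop :=
  [/\ (0 < n)%N, x ^+ n = 1 & forall m, (0 < m < n)%N -> x ^+ m <> 1].

End GroupTheory.

Arguments hirsch_plotkin_radical G : clear implicits.

(* Main.v *)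
(* The radical is a subgroup and x = x^45 x^40 x^36, so x may be assumed to have
   order dividing p = 4, 3 or 5. The conjugates of x are then pairwise of
   nilpotency class at most 2, and by Hirsch-Plotkin it suffices that any r of
   them generate a nilpotent group. By induction on r, and after dividing by the
   p-part of the omega-hypercenter, one is reduced to a group without central
   p-elements generated by u and h_1, ..., h_(r-1), where the h_i generate a
   nilpotent group. If the h_i are not all trivial, iterated commutators of them
   yield c <> 1 commuting with every h_i, and it remains to produce from such a c
   a nontrivial central element of order p, a contradiction.

   The relations among conjugates come from one source: if j^q = 1 and the
   conjugates of m under the powers of j commute and have order p, the absence
   of elements of order qp forces (j m)^q = 1, that is, the product of
   m^(j^t), t < q, is trivial. For p = 3 and j = u h_i this gives [c, u, h_i] = 1.
   For p = 5 the commutators [c, w] span an F_5-space on which the h_i act, and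
   the norm relations show that words with a repeated letter vanish. A longest
   nontrivial word [c, u, h_i1, ..., h_ik] is then central. For involutions one
   compares lexicographically maximal nontrivial words; p = 4 is reduced to
   involutions modulo the elementary abelian normal subgroup generated by the
   squares. *)
From HB Require Import structures.
Require Import Defs.
From mathcomp Require Import all_boot.
From mathcomp Require Import boolp classical_sets functions cardinality.
From mathcomp Require Import zify.

Set Implicit Arguments.
Unset Strict Implicit.
Unset Printing Implicit Defensive.

Local Open Scope classical_set_scope.
Local Open Scope group_scope.

(** * Subgroups, central series and torsion *)

(** In characteristic p the product of the conjugates of m under j^t, t < q, is (j - 1)^(q - 1)
    applied to m, q being a power of p. A norm relation thus has degree at least q - 1 and is most
    useful when j has q - 1 letters: two for p = 3, three for involutions (q = 4), four for p = 5.
    Which words survive modulo p is left to a computation on lists of words. The relation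
    presupposes j^q = 1, which is known once the letters generate a nilpotent group. For three
    letters this is a direct calculation; four letters require all of rank 4 for p = 5, obtained
    from three-letter relations alone. Commutators have to serve as letters again, so X is enlarged
    to a set Y of elements of order dividing p, still pairwise of class at most 2 and closed under
    commutators: iterated commutators of X for odd p, and for p = 2 the involutions whose product
    with any involution of the group generated by X has order dividing 4. *)

Section Subgroups.
Variable G : groupType.
Implicit Types (A B H K N : set G) (x y z g h : G) (n i : nat).

Lemma subgroupP H :
  subgroup H <->
  [/\ H 1, forall x y, H x -> H y -> H (x * y) & forall x, H x -> H x^-1].
Proof.
split=> [[H1 HD]|[H1 HM HV]].
  have {}H1 : H 1 by move: H1; rewrite inE.
  have {}HD x y : H x -> H y -> H (x / y).
    by move=> Hx Hy; have := HD x y; rewrite !inE; apply.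
  have HV x : H x -> H x^-1 by move=> Hx; rewrite -[x^-1]mul1g; exact: HD.
  by split=> // x y Hx /HV Hy; rewrite -[y]invgK; exact: HD.
split=> [|x y]; rewrite !inE// => Hx Hy.
by apply: HM => //; exact: HV.
Qed.

Lemma subgroup1 H : subgroup H -> H 1. Proof. by case/subgroupP. Qed.
Lemma subgroupM H x y : subgroup H -> H x -> H y -> H (x * y).
Proof. by case/subgroupP => _ HM _; exact: HM. Qed.
Lemma subgroupV H x : subgroup H -> H x -> H x^-1.
Proof. by case/subgroupP => _ _; exact. Qed.
Lemma subgroupJ H x y : subgroup H -> H x -> H y -> H (x ^ y).
Proof.
move=> sH Hx Hy; apply: subgroupM => //; first exact: subgroupV.
exact: subgroupM.
Qed.
Lemma subgroupR H x y : subgroup H -> H x -> H y -> H [~ x, y].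
Proof. by move=> sH Hx Hy; apply: subgroupM; [|exact: subgroupV|exact: subgroupJ]. Qed.
Lemma subgroupX H x n : subgroup H -> H x -> H (x ^+ n).
Proof.
move=> sH Hx; elim: n => [|n IH]; first by rewrite expg0; exact: subgroup1.
by rewrite expgS; exact: subgroupM.
Qed.

Lemma generatedE A x :
  generated A x <-> forall M, subgroup M -> A `<=` M -> M x.
Proof. by split=> [Ax M sM AM|Ax M [sM AM]]; apply: Ax. Qed.

Lemma generated_subgroup A : subgroup (generated A).
Proof.
apply/subgroupP; split=> [|x y|x].
- by apply/generatedE => M sM _; exact: subgroup1.
- move=> /generatedE Ax /generatedE Ay; apply/generatedE => M sM AM.
  by apply: subgroupM => //; [exact: Ax|exact: Ay].
- move=> /generatedE Ax; apply/generatedE => M sM AM.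
  by apply: subgroupV => //; exact: Ax.
Qed.

Lemma sub_generated A : A `<=` generated A.
Proof. by move=> x Ax; apply/generatedE => M _; apply. Qed.

Lemma generated_min A M : subgroup M -> A `<=` M -> generated A `<=` M.
Proof. by move=> sM AM x /generatedE; apply. Qed.

Lemma generated_sub A B : A `<=` generated B -> generated A `<=` generated B.
Proof. by move=> AB; apply: generated_min => //; exact: generated_subgroup. Qed.

Lemma generatedS A B : A `<=` B -> generated A `<=` generated B.
Proof. by move=> AB; apply: generated_sub => x /AB; exact: sub_generated. Qed.

Lemma centralizer_subgroup A : subgroup [set g | forall a, A a -> commute g a].
Proof.
apply/subgroupP; split=> [a _|x y xA yA a Aa|x xA a Aa] /=.
- by apply: commute_sym; exact: commute1.
- by apply/commute_sym/commuteM; apply/commute_sym; [exact: xA|exact: yA].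
- by apply/commute_sym/commuteV/commute_sym; exact: xA.
Qed.

Lemma commute_generated A g :
  (forall a, A a -> commute g a) -> forall x, generated A x -> commute g x.
Proof.
move=> gA x Ax; apply/commute_sym.
suff: generated A `<=` [set y | forall a, [set g] a -> commute y a].
  by move=> /(_ x Ax) /(_ g erefl).
apply: generated_min; first exact: centralizer_subgroup.
by move=> a Aa _ ->; apply/commute_sym; exact: gA.
Qed.

Lemma commgM x y z : [~ x * y, z] = [~ x, z] ^ y * [~ y, z].
Proof. by rewrite /commg /conjg !gnorm. Qed.
Lemma commgMr x y z : [~ x, y * z] = [~ x, z] * [~ x, y] ^ z.
Proof. by rewrite /commg /conjg !gnorm. Qed.
Lemma commVg x y : [~ x^-1, y] = ([~ x, y]^-1) ^ x^-1.
Proof. by rewrite /commg /conjg !gnorm. Qed.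
Lemma commgV x y : [~ x, y^-1] = ([~ x, y]^-1) ^ y^-1.
Proof. by rewrite /commg /conjg !gnorm. Qed.
Lemma conjgR x y : x ^ y = x * [~ x, y].
Proof. by rewrite /commg mulVKg. Qed.

End Subgroups.

Section UpperCentral.
Variable G : groupType.
Implicit Types (A B H K N : set G) (x y z g h : G) (n i : nat).

Fixpoint upper_central K n : set G :=
  if n is m.+1 then [set g | K g /\ forall k, K k -> upper_central K m [~ g, k]]
  else [set 1].

Lemma upper_centralJ K n x k :
  subgroup K -> upper_central K n x -> K k -> upper_central K n (x ^ k).
Proof.
move=> sK; elim: n x k => [x k -> _|n IH x k [Kx xK] Kk] /=.
  by rewrite conj1g.
split=> [|l Kl]; first exact: subgroupJ.
have -> : [~ x ^ k, l] = [~ x, l ^ k^-1] ^ k by rewrite conjRg conjgKV.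
by apply: IH => //; apply: xK; apply: subgroupJ => //; exact: subgroupV.
Qed.

Lemma upper_central_subgroup K n : subgroup K -> subgroup (upper_central K n).
Proof.
move=> sK; elim: n => [|n IH].
  apply/subgroupP; split=> [//|x y -> ->|x ->] /=; first by rewrite mulg1.
  by rewrite invg1.
apply/subgroupP; split=> [|x y [Kx xK] [Ky yK]|x [Kx xK]] /=.
- split=> [|k Kk]; first exact: subgroup1.
  by rewrite comm1g; exact: subgroup1.
- split=> [|k Kk]; first exact: subgroupM.
  rewrite commgM; apply: subgroupM => //; last exact: yK.
  by apply: upper_centralJ => //; exact: xK.
- split=> [|k Kk]; first exact: subgroupV.
  rewrite commVg; apply: upper_centralJ => //; last exact: subgroupV.
  by apply: subgroupV => //; exact: xK.
Qed.

Lemma upper_centralS K n : subgroup K -> upper_central K n `<=` upper_central K n.+1.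
Proof.
move=> sK; elim: n => [x -> /=|n IH x [Kx xK]].
  by split=> [|k _]; [exact: subgroup1|rewrite comm1g].
by split=> // k Kk; apply: IH; exact: xK.
Qed.

Lemma upper_central_leq K m n :
  subgroup K -> (m <= n)%N -> upper_central K m `<=` upper_central K n.
Proof.
move=> sK /subnK <-; elim: (n - m)%N => [//|k IH] x /IH.
exact: upper_centralS.
Qed.

(** The [k] with [[~ g, k]] in a given upper central term form a subgroup, because that term is
    stable under conjugation. Nilpotency can therefore be proved by listing commutators of
    generators. *)
Lemma upper_central_generated A n g :
  generated A g -> (forall a, A a -> upper_central (generated A) n [~ g, a]) ->
  upper_central (generated A) n.+1 g.
Proof.
move=> Ag gA; have sA := generated_subgroup A; split=> // k.
suff: generated A `<=` [set k | generated A k /\ upper_central (generated A) n [~ g, k]].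
  by move=> /[apply] -[].
have sZ := upper_central_subgroup n sA.
apply: generated_min => [|a Aa]; last by split; [exact: sub_generated|exact: gA].
apply/subgroupP; split=> [|x y [Ax gx] [Ay gy]|x [Ax gx]] /=.
- by split; [exact: subgroup1|rewrite commg1; exact: subgroup1].
- split; first exact: (subgroupM sA).
  by rewrite commgMr; apply: (subgroupM sZ) => //; exact: (upper_centralJ sA).
- split; first exact: (subgroupV sA).
  rewrite commgV; apply: (upper_centralJ sA); first exact: (subgroupV sZ).
  exact: (subgroupV sA).
Qed.

Definition nilpotent K := exists n, K `<=` upper_central K n.

Lemma upper_centralI H K n : subgroup H -> H `<=` K ->
  upper_central K n `&` H `<=` upper_central H n.
Proof.
move=> sH HK; elim: n => [x []//|n IH] h [[Kh hK] Hh] /=; split=> // k Hk.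
by apply: IH; split; [apply: hK; exact: HK|exact: (subgroupR sH)].
Qed.

Lemma nilpotentS H K : subgroup H -> H `<=` K -> nilpotent K -> nilpotent H.
Proof.
move=> sH HK [n Kn]; exists n => h Hh; apply: (upper_centralI sH HK).
by split=> //; exact/Kn/HK.
Qed.

Lemma nilpotent_upper H K n : subgroup H -> H `<=` K -> H `<=` upper_central K n -> nilpotent H.
Proof. by move=> sH HK Hn; exists n => h Hh; apply: (upper_centralI sH HK); split=> //; exact: Hn. Qed.

Lemma nilpotent_generated A n :
  (forall a, A a -> upper_central (generated A) n a) -> nilpotent (generated A).
Proof.
move=> An; exists n; apply: generated_min => //.
exact/upper_central_subgroup/generated_subgroup.
Qed.

Lemma lower_central_subgroup K n : subgroup K -> subgroup (lower_central K n).
Proof. by case: n => [//|n] _; exact: generated_subgroup. Qed.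

Lemma lower_central_sub K n : subgroup K -> lower_central K n `<=` K.
Proof.
move=> sK; elim: n => [//|n IH] /=; apply: generated_min => //.
by move=> _ [u /IH Ku [v Kv <-]]; exact: subgroupR.
Qed.

Lemma lower_centralR K n u v :
  lower_central K n u -> K v -> lower_central K n.+1 [~ u, v].
Proof. by move=> nu Kv; apply: sub_generated; exists u => //; exists v. Qed.

Lemma lower_centralS K n : subgroup K -> lower_central K n.+1 `<=` lower_central K n.
Proof.
move=> sK; elim: n => [|n IH]; first exact: (lower_central_sub (n := 1) sK).
apply: generated_min; first exact: generated_subgroup.
by move=> _ [u /IH nu [v Kv <-]]; exact: lower_centralR.
Qed.

Lemma lower_central_leq K m n :
  subgroup K -> (m <= n)%N -> lower_central K n `<=` lower_central K m.
Proof.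
move=> sK /subnK <-; elim: (n - m)%N => [//|k IH] x xk.
by apply: IH; exact: (lower_centralS sK).
Qed.

Lemma lower_centralJ K n x l :
  subgroup K -> (forall k, K k -> K (k ^ l)) ->
  lower_central K n x -> lower_central K n (x ^ l).
Proof.
move=> sK Kl; elim: n x => [x /Kl //|n IH] x /generatedE nx.
apply: (nx [set y | lower_central K n.+1 (y ^ l)]) => [|_ [u nu [v Kv <-]]] /=.
  have sL : subgroup (lower_central K n.+1) by exact: generated_subgroup.
  apply/subgroupP; split=> [|a b|a] /=; first by rewrite conj1g; exact: (subgroup1 sL).
    by rewrite conjMg => *; exact: (subgroupM sL).
  by rewrite conjVg => *; exact: (subgroupV sL).
by rewrite conjRg; apply: lower_centralR; [exact: IH|exact: Kl].
Qed.

Lemma lower_upper K n : subgroup K -> K `<=` upper_central K n ->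
  forall i, (i <= n)%N -> lower_central K i `<=` upper_central K (n - i).
Proof.
move=> sK Kn; elim=> [_|i IH lin]; first by rewrite subn0.
apply: generated_min; first exact: upper_central_subgroup.
move=> _ [u /(IH (ltnW lin)) + [v Kv <-]].
by rewrite -(subnSK lin) /= => -[_]; apply.
Qed.

Lemma nilpotentP K : subgroup K ->
  nilpotent K <-> exists n, lower_central K n = [set 1].
Proof.
move=> sK; split=> [[n Kn]|[n Kn]]; exists n.
  apply/seteqP; split=> [x /(lower_upper sK Kn (leqnn n))|_ ->].
    by rewrite subnn.
  exact: (subgroup1 (lower_central_subgroup n sK)).
suff H i : (i <= n)%N -> lower_central K (n - i) `<=` upper_central K i.
  by move: (H n (leqnn n)); rewrite subnn.
elim: i => [_|i IH lin]; first by rewrite subn0 Kn.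
move=> x nx; split=> [|k Kk]; first exact: lower_central_sub nx.
by apply: (IH (ltnW lin)); rewrite -(subnSK lin); exact: lower_centralR.
Qed.

Lemma nilpotent_subgroupP K : subgroup K -> nilpotent_subgroup K <-> nilpotent K.
Proof.
by move=> sK; split=> [[_ /(nilpotentP sK)]//|/(nilpotentP sK)].
Qed.

End UpperCentral.

(** * Torsion in nilpotent groups *)

Section Torsion.
Variables (G : groupType).
Implicit Types (A B H K N : set G) (x y z g h : G) (n i p q : nat).

Lemma expgM_mod N x y k : subgroup N ->
  (forall z, N z -> N (z ^ x)) -> (forall z, N z -> N (z ^ y)) ->
  (forall k, N [~ x ^+ k, y]) -> N ((y ^+ k * x ^+ k)^-1 * (y * x) ^+ k).
Proof.
move=> sN Nx Ny xyN; elim: k => [|k IH].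
  by rewrite !expg0 !gsimp; exact: (subgroup1 sN).
set c := _ * _ in IH.
have -> : (y ^+ k.+1 * x ^+ k.+1)^-1 * (y * x) ^+ k.+1 = ([~ x ^+ k, y] * c ^ y) ^ x.
  have e : (y * x) ^+ k = y ^+ k * x ^+ k * c by rewrite mulVKg.
  by rewrite !expgSr e /commg /conjg !gnorm.
by apply: Nx; apply: (subgroupM sN) => //; exact: Ny.
Qed.

(** Exponent [q] passes down the abelian factors of the lower central series: modulo the next term
    [[~ u, v] ^+ q] is [[~ u ^+ q, v]], and [u ^+ q] already lies one term deeper than [u]. *)
Lemma lower_central_exp A q n :
  (forall a, A a -> a ^+ q = 1) -> forall g, lower_central (generated A) n g ->
  lower_central (generated A) n.+1 (g ^+ q).
Proof.
set K := generated A => Aq.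
have sK : subgroup K := generated_subgroup A.
have sL i : subgroup (lower_central K i) := lower_central_subgroup i sK.
have LJ i x k : K k -> lower_central K i x -> lower_central K i (x ^ k).
  by move=> Kk ix; apply: lower_centralJ => // l Kl; exact: (subgroupJ sK).
have LX i x k : lower_central K i x -> lower_central K i (x ^+ k).
  exact: (subgroupX k (sL i)).
have LK i x : lower_central K i x -> K x := lower_central_sub (n := i) sK (t := x).
have powM i x y : lower_central K i x -> lower_central K i y ->
    lower_central K i.+1 (x ^+ q) -> lower_central K i.+1 (y ^+ q) ->
    lower_central K i.+1 ((y * x) ^+ q).
  move=> ix iy xq yq.
  have := @expgM_mod (lower_central K i.+1) x y q (sL _).
  move=> /(_ _ _ _)/(subgroupM (sL i.+1) (subgroupM (sL i.+1) yq xq)).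
  rewrite mulVKg; apply=> [z|z|k]; [apply: LJ|apply: LJ|].
  - exact: LK ix.
  - exact: LK iy.
  - by apply: lower_centralR; [exact: LX|exact: LK iy].
have powV i x : lower_central K i.+1 (x ^+ q) -> lower_central K i.+1 (x^-1 ^+ q).
  by rewrite expVgn; exact: (subgroupV (sL _)).
have step i (B : set G) : lower_central K i = generated B ->
    (forall b, B b -> lower_central K i.+1 (b ^+ q)) ->
    forall x, lower_central K i x -> lower_central K i.+1 (x ^+ q).
  move=> e Bq x; suff: generated B `<=`
     [set x | lower_central K i x /\ lower_central K i.+1 (x ^+ q)].
    by rewrite -e => /[apply] -[].
  apply: generated_min => [|b Bb] /=; last first.
    by split; [rewrite e; exact: sub_generated|exact: Bq].
  apply/subgroupP; split=> [|u v [iu uq] [iv vq]|u [iu uq]].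
  - by split; [exact: (subgroup1 (sL i))|rewrite expg1n; exact: (subgroup1 (sL i.+1))].
  - by split; [exact: (subgroupM (sL i))|exact: powM].
  - by split; [exact: (subgroupV (sL i))|exact: powV].
elim: n => [|n IH]; first by apply: (step 0 A) => // a /Aq ->; exact: (subgroup1 (sL 1%N)).
apply: (step n.+1 _ erefl) => _ [u nu [v Kv <-]].
have H k : lower_central K n.+2 (([~ u, v] ^+ k)^-1 * [~ u ^+ k, v]).
  elim: k => [|k IHk].
    by rewrite !expg0 comm1g !gsimp; exact: (subgroup1 (sL n.+2)).
  set c := _ * _ in IHk.
  have -> : ([~ u, v] ^+ k.+1)^-1 * [~ u ^+ k.+1, v] =
     (c ^ [~ u, v]) * [~ [~ u ^+ k, v], u] ^ [~ u, v].
    have e : [~ u ^+ k, v] = [~ u, v] ^+ k * c by rewrite mulVKg.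
    set d := [~ [~ u ^+ k, v], u]; set r := [~ u, v] in e *.
    rewrite !expgSr commgM (conjgR [~ u ^+ k, v]) -/d -/r -conjMg e.
    by rewrite conjgE invgM -!mulgA mulKg.
  have nR : lower_central K n.+1 [~ u, v] by exact: lower_centralR.
  apply: (subgroupM (sL _)); apply: LJ => //; try exact: LK nR.
  apply: lower_centralR; last exact: LK nu.
  by apply: lower_centralR => //; exact: LX.
have Huq : lower_central K n.+2 [~ u ^+ q, v] by apply: lower_centralR => //; exact: IH.
have := subgroupM (sL _) (H q) (subgroupV (sL _) Huq).
by rewrite mulgK => /(subgroupV (sL _)); rewrite invgK.
Qed.

Definition ptorsion p g := exists k, g ^+ (p ^ k) = 1.

(** Each of the [n] steps down the lower central series costs a factor [p ^ k] of the exponent. *)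
Lemma nilpotent_ptorsion A p k : nilpotent (generated A) ->
  (forall a, A a -> a ^+ (p ^ k) = 1) ->
  forall g, generated A g -> ptorsion p g.
Proof.
move=> nA Aq g Ag.
have [n nA0] := (nilpotentP (generated_subgroup A)).1 nA.
exists (k * n)%N; suff: lower_central (generated A) n (g ^+ (p ^ (k * n))) by rewrite nA0.
elim: {nA0} n => [|n IH]; first by rewrite muln0 expg1.
by rewrite mulnSr expnD expgnA; apply: lower_central_exp => //.
Qed.

Lemma ptorsionX p g m n : (m <= n)%N -> g ^+ (p ^ m) = 1 -> g ^+ (p ^ n) = 1.
Proof. by move=> /subnKC <- e; rewrite expnD expgnA e expg1n. Qed.

End Torsion.

(** * The Hirsch-Plotkin theorem *)

Section HirschPlotkin.
Variable G : groupType.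
Implicit Types (A B H J K M N : set G) (x y z g h : G) (n i : nat) (s t : seq G).

Definition normalized_by K A := forall x g, K x -> A g -> K (x ^ g).

Lemma normalized_generated K A : subgroup K -> normalized_by K A ->
  (forall a, A a -> A a^-1) -> normalized_by K (generated A).
Proof.
move=> sK nKA AV x g Kx Ag.
suff: generated A `<=` [set g | forall x, (K x -> K (x ^ g)) /\ (K x -> K (x ^ g^-1))].
  by move=> /(_ g Ag x)[+ _]; apply.
apply: generated_min => [|a Aa y]; last by split=> Ky; apply: nKA => //; exact: AV.
apply/subgroupP; split=> [y|a b aK bK y|a aK y]; last 1 first.
- by rewrite invgK; have [? ?] := aK y.
- by rewrite invg1 conjg1.
- split=> Ky; rewrite ?invgM conjgM.
    by apply: (bK _).1; exact: (aK _).1.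
  by apply: (aK _).2; exact: (bK _).2.
Qed.

Lemma normalized_generator A B : normalized_by (generated A) B <->
  forall a b, A a -> B b -> generated A (a ^ b).
Proof.
split=> [nAB a b Aa Bb|nAB x b Ax Bb].
  by apply: nAB => //; exact: sub_generated.
have sA := generated_subgroup A.
suff: generated A `<=` [set x | generated A (x ^ b)] by apply.
apply: generated_min => [|a Aa]; last exact: nAB.
apply/subgroupP; split=> [|u v|u] /=; first by rewrite conj1g; exact: (subgroup1 sA).
  by rewrite conjMg; exact: (subgroupM sA).
by rewrite conjVg; exact: (subgroupV sA).
Qed.

Lemma normal_normalized K A : normal_subgroup K -> normalized_by K A.
Proof. by case=> _ nK x g Kx _; exact: nK. Qed.

(** Weights in [M] and in [N] are counted separately. A letter of [A] raises the weight in [M] and,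
    [N] being normalized, does not lower that in [N]; a letter of [B] does the reverse. Once the
    weights add up to more than [a + b], one of them forces triviality. *)
Theorem Fitting M N A B :
  subgroup M -> subgroup N -> nilpotent M -> nilpotent N ->
  A `<=` M -> B `<=` N ->
  normalized_by M (generated (A `|` B)) -> normalized_by N (generated (A `|` B)) ->
  nilpotent (generated (A `|` B)).
Proof.
set J := generated _ => sM sN /(nilpotentP sM)[a Ma] /(nilpotentP sN)[b Nb] AM BN nM nN.
have sJ : subgroup J := generated_subgroup _.
(* The shift by one is needed since an element of [J] may lie outside [K]: weight 0 is no condition,
   weight 1 is membership in [K]. *)
pose F K i := [set g | if i is k.+1 then lower_central K k g else True].
have FR K i g x : subgroup K -> normalized_by K J -> F K i g -> K x -> J g -> F K i.+1 [~ g, x].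
  case: i => [|i] sK nK ig Kx Jg; last exact: lower_centralR.
  rewrite /F /= commgEr; apply: (subgroupM sK) => //.
  by apply: nK => //; exact: (subgroupV sK).
have FJ K i g x : subgroup K -> normalized_by K J -> F K i g -> J x -> F K i [~ g, x].
  case: i => [//|i] sK nK ig Jx; rewrite /F /= commgEl.
  have sL := lower_central_subgroup i sK.
  apply: (subgroupM sL); first exact: (subgroupV sL).
  by apply: lower_centralJ => // k Kk; exact: nK.
have F1 K c i g : subgroup K -> lower_central K c = [set 1] -> (c < i)%N -> F K i g -> g = 1.
  by case: i => [//|i] sK Kc ci ig; have := lower_central_leq sK (m := c) (n := i) ci ig; rewrite Kc.
suff H k i j : (a + b < i + j + k)%N ->
    forall g, J g -> F M i g -> F N j g -> upper_central J k g.
  by exists (a + b).+1 => g Jg; apply: (H _ 0%N 0%N) => //; rewrite ltnS.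
elim: k i j => [|k IH] i j ijk g Jg Mg Ng.
  have [ai|ia] := ltnP a i; first exact: (F1 M a i).
  apply: (F1 N b j) => //; rewrite ltnNge; apply/negP => jb.
  by move: ijk; rewrite addn0 ltnNge leq_add.
apply: upper_central_generated => // x [Ax|Bx].
  have Jx : J x by apply: sub_generated; left.
  apply: (IH i.+1 j); first by move: ijk; rewrite addnS !addSn.
  - exact: (subgroupR sJ).
  - by apply: FR => //; exact: AM.
  - exact: FJ.
have Jx : J x by apply: sub_generated; right.
apply: (IH i j.+1); first by move: ijk; rewrite !addnS addSn.
- exact: (subgroupR sJ).
- exact: FJ.
- by apply: FR => //; exact: BN.
Qed.

Fixpoint iter_comm s t n : seq G :=
  if n is m.+1 then [seq [~ d, x] | d <- iter_comm s t m, x <- t] else s.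

Definition iter_comm_upto s t n : set G := [set d | exists2 i, (i <= n)%N & d \in iter_comm s t i].

Lemma iter_comm_upto_finite s t n : finite_set (iter_comm_upto s t n).
Proof.
apply: (@sub_finite_set _ _ [set` flatten [seq iter_comm s t i | i <- iota 0 n.+1]]).
  move=> d [i lin di]; apply/flattenP; exists (iter_comm s t i) => //.
  by apply: map_f; rewrite mem_iota.
exact: finite_seq.
Qed.

Lemma sub_iter_comm_upto s t n : [set` s] `<=` iter_comm_upto s t n.
Proof. by move=> d ds; exists 0%N. Qed.

(* In a nilpotent group long iterated commutators vanish, so that finitely many
   of them generate a subgroup stable under [t]. *)
Lemma iter_comm_upto_normalized K s t : subgroup K -> nilpotent K ->
  [set` s] `<=` K -> [set` t] `<=` K ->
  exists n, normalized_by (generated (iter_comm_upto s t n)) [set` t].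
Proof.
move=> sK [n Kn] sub tK; exists n.
have H i : (i <= n)%N -> forall d, d \in iter_comm s t i -> upper_central K (n - i) d.
  elim: i => [_ d /sub/Kn|i IH lin _ /allpairsP[[d x] [/= di xt ->]]]; first by rewrite subn0.
  by have := IH (ltnW lin) d di; rewrite -(subnSK lin) => -[_]; apply; exact: tK.
apply/normalized_generator => d x [i lin di] xt; rewrite conjgR.
have sD := generated_subgroup (iter_comm_upto s t n).
apply: (subgroupM sD); first by apply: sub_generated; exists i.
have := lin; rewrite leq_eqVlt => /orP[/eqP e|lt_in].
  have := H i lin d di; rewrite e subnn => ->; rewrite comm1g; exact: (subgroup1 sD).
by apply: sub_generated; exists i.+1 => //; exact: allpairs_f.
Qed.

Lemma iter_comm_sub K s t i : [set` s] `<=` K -> subgroup K -> normalized_by K [set` t] ->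
  forall d, d \in iter_comm s t i -> K d.
Proof.
move=> sub sK nK; elim: i => [//|i IH] _ /allpairsP[[d x] [/= /IH Kd xt ->]].
rewrite commgEl; apply: (subgroupM sK); first exact: (subgroupV sK).
exact: nK.
Qed.

Definition inv_closure s := s ++ [seq x^-1 | x <- s].

Lemma inv_closureV s x : x \in inv_closure s -> x^-1 \in inv_closure s.
Proof.
rewrite !mem_cat => /orP[xs|/mapP[y ys ->]]; last by rewrite invgK ys.
by rewrite map_f ?orbT.
Qed.

Lemma inv_closure_sub K s : subgroup K -> [set` s] `<=` K -> [set` inv_closure s] `<=` K.
Proof.
move=> sK sub x; rewrite /= mem_cat => /orP[/sub //|/mapP[y /sub Ky ->]].
exact: (subgroupV sK).
Qed.

Lemma inv_closure_mem s x : x \in s -> x \in inv_closure s.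
Proof. by rewrite mem_cat => ->. Qed.

Lemma locally_nilpotentE K : locally_nilpotent_subgroup K <->
  subgroup K /\ forall A, finite_set A -> A `<=` K -> nilpotent (generated A).
Proof.
split=> -[sK H]; split=> // A fA AK; have := H A fA AK.
  by move/nilpotent_subgroupP; apply; exact: generated_subgroup.
by move=> ?; apply/nilpotent_subgroupP => //; exact: generated_subgroup.
Qed.

(** The commutators of [s'] with [t'] lie in both [M] and [N]. Saturating them under [s'] is a
    finite process, as it takes place in a nilpotent subgroup of [M], but the result [D1] also lies
    in [N]; together with [t'] it generates a nilpotent subgroup of [N] normalized by both lists.
    Symmetrically for [D2], and [Fitting] applies. *)
Lemma Hirsch_Plotkin_seq M N s t :
  normal_subgroup M -> normal_subgroup N ->
  locally_nilpotent_subgroup M -> locally_nilpotent_subgroup N ->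
  [set` s] `<=` M -> [set` t] `<=` N -> nilpotent (generated ([set` s] `|` [set` t])).
Proof.
move=> nM nN /locally_nilpotentE[sM lM] /locally_nilpotentE[sN lN].
pose s' := inv_closure s; pose t' := inv_closure t.
move=> /(inv_closure_sub sM) sub_s /(inv_closure_sub sN) sub_t.
suff: nilpotent (generated ([set` s'] `|` [set` t'])).
  apply: nilpotentS; first exact: generated_subgroup.
  by apply: generatedS => x [xs|xt]; [left|right]; exact: inv_closure_mem.
pose c := [seq [~ x, y] | x <- s', y <- t'].
have cM : [set` c] `<=` M.
  move=> _ /allpairsP[[x y] [/= xs yt ->]]; rewrite commgEl.
  by apply: (subgroupM sM); [exact/(subgroupV sM)/sub_s|apply: nM.2; exact: sub_s].
have cN : [set` c] `<=` N.
  move=> _ /allpairsP[[x y] [/= xs yt ->]]; rewrite commgEr.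
  by apply: (subgroupM sN); [apply: nN.2; exact/(subgroupV sN)/sub_t|exact: sub_t].
have fin (u v : seq G) : finite_set ([set` u] `|` [set` v]).
  by rewrite finite_setU; split; exact: finite_seq.
have [n1 n1P] : exists n, normalized_by (generated (iter_comm_upto c s' n)) [set` s'].
  apply: (@iter_comm_upto_normalized (generated ([set` s'] `|` [set` c]))).
  - exact: generated_subgroup.
  - by apply: lM => // x [/sub_s|/cM].
  - by move=> x xc; apply: sub_generated; right.
  - by move=> x xs; apply: sub_generated; left.
have [n2 n2P] : exists n, normalized_by (generated (iter_comm_upto c t' n)) [set` t'].
  apply: (@iter_comm_upto_normalized (generated ([set` t'] `|` [set` c]))).
  - exact: generated_subgroup.
  - by apply: lN => // x [/sub_t|/cN].
  - by move=> x xc; apply: sub_generated; right.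
  - by move=> x xs; apply: sub_generated; left.
set D1 := iter_comm_upto c s' n1 in n1P; set D2 := iter_comm_upto c t' n2 in n2P.
have D1N : D1 `<=` N.
  by move=> d [i _]; apply: iter_comm_sub => //; exact: normal_normalized.
have D2M : D2 `<=` M.
  by move=> d [i _]; apply: iter_comm_sub => //; exact: normal_normalized.
set J := generated _.
have VJ x : ([set` s'] `|` [set` t']) x -> ([set` s'] `|` [set` t']) x^-1.
  by case=> /inv_closureV; [left|right].
pose Ms := generated ([set` s'] `|` D2); pose Ns := generated ([set` t'] `|` D1).
have sMs : subgroup Ms := generated_subgroup _.
have sNs : subgroup Ns := generated_subgroup _.
apply: (@Fitting Ms Ns) => //.
- apply: lM => [|x [/sub_s|/D2M]//]; rewrite finite_setU; split; first exact: finite_seq.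
  exact: iter_comm_upto_finite.
- apply: lN => [|x [/sub_t|/D1N]//]; rewrite finite_setU; split; first exact: finite_seq.
  exact: iter_comm_upto_finite.
- by move=> x xs; apply: sub_generated; left.
- by move=> x xt; apply: sub_generated; left.
- apply: normalized_generated => //; apply/normalized_generator => x y xM [ys|yt].
    by apply: (subgroupJ sMs); apply: sub_generated => //; left.
  case: xM => [xs|xD]; last first.
    apply: (generatedS (A := D2)) => [z zD|]; first by right.
    by apply: n2P => //; exact: sub_generated.
  rewrite conjgR; apply: (subgroupM sMs); first by apply: sub_generated; left.
  apply: sub_generated; right; apply: sub_iter_comm_upto.
  exact: (allpairs_f (fun x y => [~ x, y])).
- apply: normalized_generated => //; apply/normalized_generator => x y xN [ys|yt]; last first.
    by apply: (subgroupJ sNs); apply: sub_generated => //; left.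
  case: xN => [xt|xD]; last first.
    apply: (generatedS (A := D1)) => [z zD|]; first by right.
    by apply: n1P => //; exact: sub_generated.
  rewrite conjgR; apply: (subgroupM sNs); first by apply: sub_generated; left.
  rewrite -invgR; apply: (subgroupV sNs).
  apply: sub_generated; right; apply: sub_iter_comm_upto.
  exact: (allpairs_f (fun x y => [~ x, y])).
Qed.
End HirschPlotkin.

(** * The radical as the union of the normal locally nilpotent subgroups *)

Section Radical.
Variable G : groupType.
Implicit Types (A B H J K M N : set G) (x y z g h : G) (n i : nat) (s t : seq G).

Definition normal_locally_nilpotent K := normal_subgroup K /\ locally_nilpotent_subgroup K.

Definition set_prod M N : set G := [set g | exists a b, [/\ M a, N b & g = a * b]].

Lemma normal_locally_nilpotent1 : normal_locally_nilpotent [set 1].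
Proof.
have s1 : subgroup [set (1 : G)].
  by apply/subgroupP; split=> [//|x y -> ->|x ->] /=; rewrite ?mulg1 ?invg1.
split; first by split=> // g h ->; rewrite /= conj1g.
apply/locally_nilpotentE; split=> // A _ A1.
by exists 0%N; apply: generated_min.
Qed.

Lemma normal_locally_nilpotentM M N :
  normal_locally_nilpotent M -> normal_locally_nilpotent N ->
  normal_locally_nilpotent (set_prod M N).
Proof.
move=> [nM lM] [nN lN]; have [sM MJ] := nM; have [sN NJ] := nN.
have sMN : subgroup (set_prod M N).
  apply/subgroupP; split=> [|_ _ [a [b [Ma Nb ->]]] [c [d [Mc Nd ->]]]|_ [a [b [Ma Nb ->]]]].
  - by exists 1, 1; rewrite mulg1; split=> //; exact: subgroup1.
  - exists (a * c), (b ^ c * d); split.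
    + exact: (subgroupM sM).
    + by apply: (subgroupM sN) => //; exact: NJ.
    + by rewrite /conjg !gnorm.
  - exists a^-1, (b^-1 ^ a^-1); split.
    + exact: (subgroupV sM).
    + by apply: NJ; exact: (subgroupV sN).
    + by rewrite /conjg !gnorm.
split.
  split=> // g _ [a [b [Ma Nb ->]]]; exists (a ^ g), (b ^ g).
  by split; [exact: MJ|exact: NJ|rewrite conjMg].
apply/locally_nilpotentE; split=> // A /finite_seqP[u ->] uMN.
have [f [g fg]] : exists f g : G -> G, forall x, x \in u -> [/\ M (f x), N (g x) & x = f x * g x].
  have /choice[fg fgP] : forall x, exists p : G * G, x \in u -> [/\ M p.1, N p.2 & x = p.1 * p.2].
    move=> x; have [xu|_] := boolP (x \in u); last by exists (1, 1).
    by have [a [b [Ma Nb ->]]] := uMN x xu; exists (a, b).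
  by exists (fun x => (fg x).1), (fun x => (fg x).2).
have : nilpotent (generated ([set` map f u] `|` [set` map g u])).
  apply: (@Hirsch_Plotkin_seq _ M N) => // _ /mapP[x xu ->].
    by have [] := fg x xu.
  by have [] := fg x xu.
apply: nilpotentS; first exact: generated_subgroup.
apply: generated_sub => x xu; have [_ _ ->] := fg x xu.
by apply: (subgroupM (generated_subgroup _)); apply: sub_generated;
  [left|right]; exact: map_f.
Qed.

Definition HP_union : set G := [set g | exists2 K, normal_locally_nilpotent K & K g].

Lemma set_prodl M N : subgroup N -> M `<=` set_prod M N.
Proof. by move=> sN a Ma; exists a, 1; rewrite mulg1; split=> //; exact: subgroup1. Qed.
Lemma set_prodr M N : subgroup M -> N `<=` set_prod M N.
Proof. by move=> sM b Nb; exists 1, b; rewrite mul1g; split=> //; exact: subgroup1. Qed.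

(** Products make the family directed, so a finite subset of the union already lies in one
    member. *)
Lemma HP_union_radical : is_hirsch_plotkin_radical HP_union.
Proof.
have dir M N : normal_locally_nilpotent M -> normal_locally_nilpotent N ->
    exists K, [/\ normal_locally_nilpotent K, M `<=` K & N `<=` K].
  move=> nM nN; exists (set_prod M N); split; first exact: normal_locally_nilpotentM.
    by apply: set_prodl; have [[]] := nN.
  by apply: set_prodr; have [[]] := nM.
have sR : subgroup HP_union.
  apply/subgroupP; split=> [|x y [M nM Mx] [N nN Ny]|x [M nM Mx]].
  - by exists [set 1] => //; exact: normal_locally_nilpotent1.
  - have [K [nK MK NK]] := dir M N nM nN; exists K => //.
    by apply: (subgroupM nK.1.1); [exact: MK|exact: NK].
  - by exists M => //; exact: (subgroupV nM.1.1).
split.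
- by split=> // g h [K nK Kh]; exists K => //; exact: nK.1.2.
- apply/locally_nilpotentE; split=> // A /finite_seqP[u ->].
  suff H : [set` u] `<=` HP_union -> exists2 K, normal_locally_nilpotent K & [set` u] `<=` K.
    move=> /H[K [_ /locally_nilpotentE[_ lK]] uK]; apply: lK => //; exact: finite_seq.
  elim: u => [_|a u IH auR]; first by exists [set 1] => //; exact: normal_locally_nilpotent1.
  have [|M nM uM] := IH; first by move=> x xu; apply: auR; rewrite /= inE xu orbT.
  have [|N nN Na] := auR a; first by rewrite /= mem_head.
  have [K [nK MK NK]] := dir M N nM nN; exists K => // x /=.
  by rewrite inE => /predU1P[->|xu]; [exact: NK|exact/MK/uM].
- by move=> K nK lK x Kx; exists K.
Qed.

Lemma hirsch_plotkin_radicalP : is_hirsch_plotkin_radical (hirsch_plotkin_radical G).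
Proof. exact: xgetPex (ex_intro _ _ HP_union_radical). Qed.

Lemma mem_hirsch_plotkin K x :
  normal_locally_nilpotent K -> K x -> hirsch_plotkin_radical G x.
Proof. by case=> nK lK; have [_ _ max] := hirsch_plotkin_radicalP; exact: max. Qed.

Lemma hirsch_plotkin_subgroup : subgroup (hirsch_plotkin_radical G).
Proof. by have [[]] := hirsch_plotkin_radicalP. Qed.
End Radical.

(** * Normal closures and local nilpotency *)

Section NormalClosure.
Variable G : groupType.
Implicit Types (A H K N : set G) (x y z g h : G) (s : seq G).

Definition conj_class x : set G := [set y | exists g, y = x ^ g].

Lemma normal_closure_min A N : normal_subgroup N -> A `<=` N -> normal_closure A `<=` N.
Proof. by move=> nN AN x; apply. Qed.

Lemma sub_normal_closure A : A `<=` normal_closure A.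
Proof. by move=> x Ax M [_ AM]; exact: AM. Qed.

Lemma normal_closure_normal A : normal_subgroup (normal_closure A).
Proof.
split; last by move=> g h Ah M [nM AM]; apply: nM.2; exact: Ah.
apply/subgroupP; split=> [M [[sM _] _]|x y Ax Ay M MA|x Ax M MA].
- exact: subgroup1.
- by apply: (subgroupM MA.1.1); [exact: Ax|exact: Ay].
- by apply: (subgroupV MA.1.1); exact: Ax.
Qed.

Lemma generated_normal A : (forall a g, A a -> A (a ^ g)) -> normal_subgroup (generated A).
Proof.
move=> AJ; split; first exact: generated_subgroup.
move=> g h Ah; suff: normalized_by (generated A) setT by apply.
by apply/normalized_generator => a b Aa _; apply: sub_generated; exact: AJ.
Qed.

Lemma normal_closure_conj x : normal_closure (generated [set x]) = generated (conj_class x).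
Proof.
apply/seteqP; split.
  apply: normal_closure_min.
    by apply: generated_normal => _ g [h ->]; exists (h * g); rewrite conjgM.
  apply: generated_sub => _ ->; apply: sub_generated.
  by exists 1; rewrite conjg1.
have [sN NJ] := normal_closure_normal (generated [set x]).
apply: generated_min => // _ [g ->]; apply: NJ; apply: sub_normal_closure.
exact: sub_generated.
Qed.

Lemma generated_finite A x : generated A x ->
  exists2 s : seq G, [set` s] `<=` A & generated [set` s] x.
Proof.
move=> Ax; suff: generated A `<=` [set x | exists2 s : seq G, [set` s] `<=` A & generated [set` s] x] by apply.
apply: generated_min => [|a Aa]; last first.
  exists [:: a] => [b|]; first by rewrite /= inE => /eqP ->.
  by apply: sub_generated; rewrite /= inE.
apply/subgroupP; split=> [|u v [s sA su] [t tA tv]|u [s sA su]].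
- by exists [::] => //; exact: (subgroup1 (generated_subgroup _)).
- exists (s ++ t) => [b|]; first by rewrite /= mem_cat => /orP[/sA|/tA].
  apply: (subgroupM (generated_subgroup _)).
    by apply: generatedS su => b; rewrite /= mem_cat => ->.
  by apply: generatedS tv => b; rewrite /= mem_cat orbC => ->.
- by exists s => //; exact: (subgroupV (generated_subgroup _)).
Qed.

(** A finite subset of [generated A] involves only finitely many elements of [A]. *)
Lemma conj_class_locally_nilpotent A : (forall a g, A a -> A (a ^ g)) ->
  (forall s : seq G, [set` s] `<=` A -> nilpotent (generated [set` s])) ->
  normal_locally_nilpotent (generated A).
Proof.
move=> AJ nA; split; first exact: generated_normal.
apply/locally_nilpotentE; split=> [|B /finite_seqP[t ->] tA]; first exact: generated_subgroup.
suff [s sA st] : exists2 s : seq G, [set` s] `<=` A & [set` t] `<=` generated [set` s].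
  apply: nilpotentS (nA s sA); first exact: generated_subgroup.
  exact: generated_sub.
elim: t tA => [_|a t IH atA]; first by exists [::].
have [|s sA st] := IH; first by move=> x xt; apply: atA; rewrite /= inE xt orbT.
have [|u uA ua] := @generated_finite A a; first by apply: atA; rewrite /= mem_head.
exists (s ++ u) => x /=; first by rewrite mem_cat => /orP[/sA|/uA].
rewrite inE => /predU1P[->|/st].
  by apply: generatedS ua => b /=; rewrite mem_cat orbC => ->.
by apply: generatedS => b /=; rewrite mem_cat => ->.
Qed.
End NormalClosure.

(** * Subgroups and quotients as types *)

Section Morphism.
Variables (G H : groupType) (f : G -> H).
Hypothesis fM : {morph f : x y / x * y}.
Lemma morph1 : f 1 = 1.
Proof. by apply: (@mulgI _ (f 1)); rewrite -fM !mulg1. Qed.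
Lemma morphV x : f x^-1 = (f x)^-1.
Proof. by apply: (@mulgI _ (f x)); rewrite -fM !mulgV morph1. Qed.
Lemma morphJ x y : f (x ^ y) = f x ^ f y.
Proof. by rewrite !conjgE !fM morphV. Qed.
Lemma morphR x y : f [~ x, y] = [~ f x, f y].
Proof. by rewrite !commgEl fM morphV morphJ. Qed.
Lemma morphX x n : f (x ^+ n) = f x ^+ n.
Proof. by elim: n => [|n IH]; rewrite ?morph1// !expgS fM IH. Qed.

Lemma preimage_subgroup (K : set H) : subgroup K -> subgroup (f @^-1` K).
Proof.
move=> sK; apply/subgroupP; split=> [|x y Kx Ky|x Kx]; rewrite /preimage /=.
- by rewrite morph1; exact: (subgroup1 sK).
- by rewrite fM; exact: (subgroupM sK).
- by rewrite morphV; exact: (subgroupV sK).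
Qed.

Lemma image_subgroup (K : set G) : subgroup K -> subgroup (f @` K).
Proof.
move=> sK; apply/subgroupP; split=> [|_ _ [x Kx <-] [y Ky <-]|_ [x Kx <-]].
- by exists 1; rewrite ?morph1//; exact: (subgroup1 sK).
- by exists (x * y); rewrite ?fM//; exact: (subgroupM sK).
- by exists x^-1; rewrite ?morphV//; exact: (subgroupV sK).
Qed.

Lemma image_generated (A : set G) : f @` generated A = generated (f @` A).
Proof.
apply/seteqP; split.
  move=> _ [x Ax <-].
  suff: generated A `<=` f @^-1` generated (f @` A) by apply.
  apply: generated_min => [|a Aa]; first exact/preimage_subgroup/generated_subgroup.
  by apply: sub_generated; exists a.
apply: generated_min; first exact/image_subgroup/generated_subgroup.
by move=> _ [a Aa <-]; exists a => //; exact: sub_generated.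
Qed.
End Morphism.

Section SubType.
Variables (G : groupType) (H : set G).
(** The proof of [subgroup H] is a parameter of the type, so that the group structure can be
    inferred from the type alone. *)
Definition sub_type of subgroup H := {x : G | x \in H}.
Variable sH : subgroup H.
HB.instance Definition _ := SubChoice.on (sub_type sH).
HB.instance Definition _ := SubChoice_isSubGroup.Build G (mem H) (sub_type sH) sH.
End SubType.

Lemma subgroup_type (G : groupType) (H : set G) : subgroup H ->
  exists (K : groupType) (f : K -> G),
    [/\ {morph f : x y / x * y}, injective f & forall x, H x <-> exists k, x = f k].
Proof.
move=> sH; exists (sub_type sH), val; split=> [x y||x]; first exact: valM.
  exact: val_inj.
split=> [Hx|[k ->]]; last by have := valP k; rewrite inE.
have xH : x \in H by rewrite inE.
by exists (Sub x xH); rewrite SubK.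
Qed.

Section Quotient.
Local Open Scope quotient_scope.
Variables (G : groupType) (N : set G).
Definition coset_rel of normal_subgroup N := fun x y : G => `[< N (x^-1 * y) >].
Variable nN : normal_subgroup N.
Let sN : subgroup N := nN.1.

Lemma coset_rel_refl : reflexive (coset_rel nN).
Proof. by move=> x; apply/asboolP; rewrite mulVg; exact: subgroup1. Qed.
Lemma coset_rel_sym : symmetric (coset_rel nN).
Proof.
move=> x y; apply/asboolP/asboolP => /(subgroupV sN); by rewrite invgM invgK.
Qed.
Lemma coset_rel_trans : transitive (coset_rel nN).
Proof.
move=> y x z /asboolP xy /asboolP yz; apply/asboolP.
by have := subgroupM sN xy yz; rewrite -mulgA mulVKg.
Qed.
Canonical coset_equiv := EquivRel (coset_rel nN) coset_rel_refl coset_rel_sym coset_rel_trans.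

Definition quot := {eq_quot coset_equiv}.
HB.instance Definition _ := Choice.on quot.
HB.instance Definition _ := EqQuotient.on quot.

Lemma pi_eqP (x y : G) : (\pi_quot x = \pi_quot y) <-> N (x^-1 * y).
Proof.
split=> [/eqP|xy].
  by rewrite eqmodE => /asboolP.
by apply/eqP; rewrite eqmodE; apply/asboolP.
Qed.

Definition quot_mul (a b : quot) : quot := \pi_quot (repr a * repr b).
Definition quot_inv (a : quot) : quot := \pi_quot (repr a)^-1.
Definition quot_one : quot := \pi_quot 1.

Lemma pi_repr x : N (x^-1 * repr (\pi_quot x)).
Proof. by apply/pi_eqP; rewrite reprK. Qed.

Lemma pi_mul x y : \pi_quot (x * y) = quot_mul (\pi_quot x) (\pi_quot y).
Proof.
apply/pi_eqP; have Nx := pi_repr x; have Ny := pi_repr y.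
set a := repr _ in Nx *; set b := repr _ in Ny *.
have -> : (x * y)^-1 * (a * b) = (x^-1 * a) ^ y * (y^-1 * b) by rewrite /conjg !gnorm.
by apply: (subgroupM sN) => //; exact: nN.2.
Qed.

Lemma pi_inv x : \pi_quot x^-1 = quot_inv (\pi_quot x).
Proof.
apply/pi_eqP; have /(subgroupV sN) Nx := pi_repr x; set a := repr _ in Nx *.
have -> : x^-1^-1 * a^-1 = ((x^-1 * a)^-1) ^ x^-1 by rewrite /conjg !gnorm.
exact: nN.2.
Qed.

Lemma quot_ind (P : quot -> Prop) : (forall x, P (\pi_quot x)) -> forall a, P a.
Proof. by move=> Px a; rewrite -[a]reprK. Qed.

Lemma quot_mulA : associative quot_mul.
Proof.
elim/quot_ind => x; elim/quot_ind => y; elim/quot_ind => z.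
by rewrite -!pi_mul mulgA.
Qed.
Lemma quot_mul1g : left_id quot_one quot_mul.
Proof. by elim/quot_ind => x; rewrite -pi_mul mul1g. Qed.
Lemma quot_mulg1 : right_id quot_one quot_mul.
Proof. by elim/quot_ind => x; rewrite -pi_mul mulg1. Qed.
Lemma quot_mulVg : left_inverse quot_one quot_inv quot_mul.
Proof. by elim/quot_ind => x; rewrite -pi_inv -pi_mul mulVg. Qed.
Lemma quot_mulgV : right_inverse quot_one quot_inv quot_mul.
Proof. by elim/quot_ind => x; rewrite -pi_inv -pi_mul mulgV. Qed.

HB.instance Definition _ :=
  isGroup.Build quot quot_mulA quot_mul1g quot_mulg1 quot_mulVg quot_mulgV.
End Quotient.

Lemma quotient_type (G : groupType) (N : set G) : normal_subgroup N ->
  exists (Q : groupType) (f : G -> Q),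
    [/\ {morph f : x y / x * y}, forall q, exists x, q = f x & forall x, f x = 1 <-> N x].
Proof.
move=> nN; exists (quot nN), (\pi_(quot nN)%qT); split=> [x y|q|x].
- exact: pi_mul.
- by exists (repr q); rewrite reprK.
- split=> [e|Nx].
    have /pi_eqP : (\pi_(quot nN) 1 = \pi_(quot nN) x)%qT by rewrite e.
    by rewrite invg1 mul1g.
  by apply/esym/pi_eqP; rewrite invg1 mul1g.
Qed.

(** * Reduction to groups without central p-elements *)

Section Reduction.
Variable p : nat.

Definition centerless (G : groupType) :=
  forall z : G, (forall g, commute z g) -> ptorsion p z -> z = 1.

Lemma image_upper_central (G H : groupType) (f : G -> H) (K : set G) n :
  {morph f : x y / x * y} -> f @` upper_central K n `<=` upper_central (f @` K) n.
Proof.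
move=> fM; elim: n => [_ [_ -> <-]|n IH _ [x [Kx xK] <-]]; first exact: (morph1 fM).
split; first by exists x.
by move=> _ [k Kk <-]; apply: IH; exists [~ x, k]; [exact: xK|exact: (morphR fM)].
Qed.

Lemma image_nilpotent (G H : groupType) (f : G -> H) (K : set G) :
  {morph f : x y / x * y} -> nilpotent K -> nilpotent (f @` K).
Proof.
move=> fM [n Kn]; exists n => _ [k Kk <-]; apply: image_upper_central => //.
by exists k => //; exact: Kn.
Qed.

Lemma seq_bound (T : eqType) (s : seq T) (P : T -> nat -> Prop) :
  (forall x m n, (m <= n)%N -> P x m -> P x n) ->
  (forall x, x \in s -> exists n, P x n) -> exists n, forall x, x \in s -> P x n.
Proof.
move=> Pmon; elim: s => [|a s IH] Ps; first by exists 0%N.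
have [|n nP] := IH; first by move=> x xs; apply: Ps; rewrite inE xs orbT.
have [m mP] := Ps a (mem_head _ _).
exists (maxn m n) => x; rewrite inE => /predU1P[->|xs].
  by apply: Pmon mP; exact: leq_maxl.
by apply: Pmon (nP x xs); exact: leq_maxr.
Qed.

Lemma seq_choice (A B : eqType) (s : seq A) (R : A -> B -> Prop) :
  (forall x, x \in s -> exists y, R x y) ->
  exists t : seq B, size t = size s /\ forall i x y, (i < size s)%N -> R (nth x s i) (nth y t i).
Proof.
elim: s => [|a s IH] sR; first by exists [::].
have [|t [st tR]] := IH; first by move=> x xs; apply: sR; rewrite inE xs orbT.
have [b ab] := sR a (mem_head _ _).
by exists (b :: t); split=> [|[|i] x y ilt] //=; [rewrite /= st|exact: tR].
Qed.

Section HyperTorsion.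
Variable K : groupType.
Let KT : subgroup [set: K]. Proof. by apply/subgroupP; split. Qed.

Definition hypertorsion : set K :=
  [set g | (exists n, upper_central setT n g) /\ ptorsion p g].

(** For products: two elements of a common upper central term generate a nilpotent group, and a
    nilpotent group generated by p-torsion elements [x], [y] consists of p-torsion elements. *)
Lemma hypertorsion_normal : normal_subgroup hypertorsion.
Proof.
split; last first.
  move=> g h [[n nh] [k hk]]; split; first by exists n; exact: (upper_centralJ KT).
  by exists k; rewrite -conjXg hk conj1g.
apply/subgroupP; split=> [|x y [[m mx] [i xi]] [[n ny] [j yj]]|x [[n nx] [k xk]]].
- by split; exists 0%N => //; rewrite expg1n.
- have mnx : upper_central setT (maxn m n) x by apply: (upper_central_leq KT) mx; exact: leq_maxl.
  have mny : upper_central setT (maxn m n) y by apply: (upper_central_leq KT) ny; exact: leq_maxr.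
  have sZ := upper_central_subgroup (maxn m n) KT.
  split; first by exists (maxn m n); exact: (subgroupM sZ).
  apply: (@nilpotent_ptorsion _ [set` [:: x; y]] p (maxn i j)).
  + apply: (nilpotent_upper (K := setT) (n := maxn m n)) => //; first exact: generated_subgroup.
    by apply: generated_min => // z; rewrite /= !inE => /orP[]/eqP ->.
  + move=> z; rewrite /= !inE => /orP[]/eqP ->.
      by apply: ptorsionX xi; exact: leq_maxl.
    by apply: ptorsionX yj; exact: leq_maxr.
  + by apply: (subgroupM (generated_subgroup _)); apply: sub_generated; rewrite /= !inE eqxx ?orbT.
- split; first by exists n; exact: (subgroupV (upper_central_subgroup n KT)).
  by exists k; rewrite expVgn xk invg1.
Qed.
End HyperTorsion.

(* Q is the quotient of the subgroup generated by s by the p-torsion part of its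
   omega-hypercenter. A central p-element of Q lifts into this part because
   finitely many generators have a common bound on the central height. *)
Lemma centerless_reduction (G : groupType) (s : seq G) :
  (forall x, x \in s -> ptorsion p x) ->
  exists (K Q : groupType) (i : K -> G) (f : K -> Q) (t : seq K),
    [/\ {morph i : x y / x * y}, injective i, {morph f : x y / x * y},
        forall q, exists x, q = f x & [/\ map i t = s, generated [set` t] = setT,
        centerless Q, forall k, f k = 1 -> ptorsion p k &
        (forall x, x \in t -> f x = 1) -> nilpotent (generated [set` s])]].
Proof.
move=> ps; have [K [i [iM i_inj iH]]] := subgroup_type (generated_subgroup [set` s]).
have [|t [st ts]] := @seq_choice G K s (fun x k => x = i k).
  by move=> x xs; apply/iH; exact: sub_generated.
have {ts st}ts : map i t = s.
  apply: (@eq_from_nth _ 1); rewrite size_map // => j jt.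
  by rewrite (nth_map 1)// -(ts j 1 1)// -st.
have [Q [f [fM f_surj fN]]] := quotient_type (hypertorsion_normal K).
have KT : subgroup [set: K] by apply/subgroupP.
have gen : generated [set` t] = setT.
  apply/seteqP; split=> // k _.
  have : (i @` generated [set` t]) (i k).
    rewrite (image_generated iM).
    have -> : i @` [set` t] = [set` s].
      rewrite -ts; apply/seteqP; split=> [_ [x xt <-]|_ /mapP[x xt ->]]; last by exists x.
      exact: map_f.
    by apply/iH; exists k.
  by case=> l tl /i_inj <-.
exists K, Q, i, f, t; split=> //; split=> //.
- move=> q qZ [m qm]; have [z ez] := f_surj q.
  rewrite ez; apply/fN.
  have zT g : hypertorsion [~ z, g].
    by apply/fN; rewrite (morphR fM) -ez; apply/eqP/commgP; exact: qZ.
  have [n nP] : exists n, forall x, x \in t -> upper_central setT n [~ z, x].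
    apply: seq_bound => [x k n kn|x _]; first exact: (upper_central_leq KT).
    by have [] := zT x.
  split; last first.
    have [_ [k zk]] : hypertorsion (z ^+ (p ^ m)) by apply/fN; rewrite (morphX fM) -ez.
    by exists (m + k)%N; rewrite expnD expgnA.
  exists n.+1; rewrite -gen; apply: upper_central_generated => [|a ta]; first by rewrite gen.
  by rewrite gen; exact: nP.
- by move=> k /fN[].
- move=> t1; have [n nP] : exists n, forall x, x \in t -> upper_central setT n x.
    apply: seq_bound => [x k n kn|x xt]; first exact: (upper_central_leq KT).
    by have /fN[] := t1 x xt.
  have nt : nilpotent (generated [set` t]).
    by apply: (@nilpotent_generated _ _ n) => a ta; rewrite gen; exact: nP.
  have -> : generated [set` s] = i @` generated [set` t]; last exact: image_nilpotent.
  rewrite gen; apply/seteqP; split=> [x /iH[k ->]|_ [k _ <-]]; first by exists k.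
  by apply/iH; exists k.
Qed.

End Reduction.

(** * Commutator identities *)

Section Commute.
Variable G : groupType.
Implicit Types (x y z a b c : G).

Lemma commuteJ a x y : commute a x -> commute a y -> commute a (x ^ y).
Proof. by move=> ax ay; rewrite conjgE; apply: commuteM; [exact: commuteV|exact: commuteM]. Qed.
Lemma commuteR a x y : commute a x -> commute a y -> commute a [~ x, y].
Proof. by move=> ax ay; rewrite commgEl; apply: commuteM; [exact: commuteV|exact: commuteJ]. Qed.
Lemma commute_conj a x y : commute (a ^ y) (x ^ y) <-> commute a x.
Proof.
split=> [e|ax]; last by rewrite /commute -!conjMg ax.
by apply: (@conjg_inj _ y); rewrite !conjMg.
Qed.
Lemma commuteJE x y : commute x y <-> x ^ y = x.
Proof. by split=> [/commgP/conjg_fixP//|/conjg_fixP/commgP]. Qed.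
Lemma commuteRE x y : commute x y <-> [~ x, y] = 1.
Proof. by split=> [/commgP/eqP//|/eqP/commgP]. Qed.
Lemma commute_Ml a x y : commute a x -> commute a (x * y) -> commute a y.
Proof. by move=> ax axy; rewrite -[y](mulKg x); apply: commuteM => //; exact: commuteV. Qed.
Lemma commute_Vr a x : commute a x^-1 -> commute a x.
Proof. by move=> /commuteV; rewrite invgK. Qed.

Lemma commgX x y n : commute [~ x, y] x -> [~ x ^+ n, y] = [~ x, y] ^+ n.
Proof.
move=> cx; elim: n => [|n IH]; first by rewrite !expg0 comm1g.
rewrite !expgSr commgM IH; congr (_ * _).
by rewrite (commuteJE _ _).1//; exact/commute_sym/commuteX/commute_sym.
Qed.

Lemma odd_exp_eq1 z p : odd p -> z ^+ p = 1 -> z ^+ 2 = 1 -> z = 1.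
Proof.
move=> op zp z2; rewrite -zp -(odd_double_half p) op expgnDr expg1.
by rewrite -mul2n expgnA z2 expg1n mulg1.
Qed.

Lemma odd_exp4_eq1 z p : odd p -> z ^+ p = 1 -> z ^+ 4 = 1 -> z = 1.
Proof.
move=> op zp z4; apply: (odd_exp_eq1 op zp).
by apply: (odd_exp_eq1 op); rewrite -expgnA // mulnC expgnA zp expg1n.
Qed.
End Commute.

Ltac cm := match goal with
 | |- commute _ _ => first [ assumption | by apply: commute_sym; assumption | exact: commute_refl
   | exact: commute1
   | by apply: commuteM; cm | by apply: commuteV; cm | by apply: commuteR; cm
   | by apply: commuteJ; cm | by apply: commuteX; cm
   | by apply: commute_sym; first [exact: commute1 | apply: commuteM; cm | apply: commuteV; cm | apply: commuteR; cm
      | apply: commuteJ; cm | apply: commuteX; cm] ] end.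

Section OddCalculus.
Variables (G : groupType) (p : nat).
Hypothesis op : odd p.
Implicit Types (x y z b c d : G).

(** Expanding the commutation of [x1 ^ b = x1 * d1] with [x2 ^ b = x2 * d2] gives the last identity;
    its conjugate under [x1], which turns [d2] into [d2 * s^-1], shows that [s] and [d1] commute. As
    [x1] and [x2] commute, [s] is also [[~ x1, x2 ^ b]], whence the form of the hypotheses. *)
Lemma commuting_pair_half x1 x2 b (d1 := [~ x1, b]) (d2 := [~ x2, b])
    (s := [~ x1, d2]) (s' := [~ x2, d1]) :
  commute x1 x2 -> commute d1 x1 -> commute d2 x2 ->
  commute [~ x1, x2 ^ b] x1 -> commute [~ x1, x2 ^ b] (x2 ^ b) ->
  commute [~ x2, x1 ^ b] x2 -> commute [~ x2, x1 ^ b] (x1 ^ b) ->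
  [/\ commute s x1, commute s x2, commute s d1, commute s d2 &
      d1 * s'^-1 * d2 = d2 * s^-1 * d1].
Proof.
have [d1E d2E sE s'E] : [/\ d1 = [~ x1, b], d2 = [~ x2, b], s = [~ x1, d2] & s' = [~ x2, d1]] by [].
clearbody s s' d1 d2 => c12 d1x1 d2x2.
have -> : [~ x1, x2 ^ b] = s.
  by rewrite conjgR commgMr -d2E (commuteRE x1 x2).1// conj1g mulg1 sE.
have -> : [~ x2, x1 ^ b] = s'.
  by rewrite conjgR commgMr -d1E (commuteRE x2 x1).1 ?conj1g ?mulg1 ?s'E//; cm.
move=> sx1 sxb s'x2 s'xb.
have sx2 : commute s x2 by rewrite sE; cm.
have s'x1 : commute s' x1 by rewrite s'E; cm.
have sd2 : commute s d2 by apply: (commute_Ml sx2); rewrite d2E -conjgR.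
have s'd1 : commute s' d1 by apply: (commute_Ml s'x1); rewrite d1E -conjgR.
have d1x2 : d1 * x2 = x2 * d1 * s'^-1 by rewrite (commgC d1) s'E invgR.
have d2x1 : d2 * x1 = x1 * d2 * s^-1 by rewrite (commgC d2) sE invgR.
have E1 : d1 * s'^-1 * d2 = d2 * s^-1 * d1.
  have : commute (x1 ^ b) (x2 ^ b) by apply/commute_conj.
  rewrite !conjgR -d1E -d2E /commute => e.
  apply: (@mulgI _ (x1 * x2)).
  have -> : x1 * x2 * (d1 * s'^-1 * d2) = x1 * d1 * (x2 * d2).
    by rewrite -[RHS]mulgA [d1 * (_ * _)]mulgA d1x2 !mulgA.
  by rewrite e -[LHS]mulgA [d2 * (_ * _)]mulgA d2x1 c12 !mulgA.
split=> //.
have : (d1 * s'^-1 * d2) ^ x1 = (d2 * s^-1 * d1) ^ x1 by rewrite E1.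
have d1J : d1 ^ x1 = d1 by apply/commuteJE.
have d2J : d2 ^ x1 = d2 * s^-1 by rewrite conjgR sE invgR.
have sJ : s ^ x1 = s by apply/commuteJE.
have s'J : s' ^ x1 = s' by apply/commuteJE.
rewrite !conjMg !conjVg d1J d2J sJ s'J mulgA E1 -!mulgA => /mulgI/mulgI.
by move=> e; apply: commute_sym; apply: commute_Vr; exact: e.
Qed.

(** The preceding identity, taken for [b] and for [b^-1], shows with [s' = [~ x2, d1]] that
    [s^-1 * s'] equals its inverse; its exponent [p] being odd, it is trivial. *)
Lemma commuting_pair x1 x2 b (d1 := [~ x1, b]) (d2 := [~ x2, b])
    (s := [~ x1, d2]) :
  commute x1 x2 -> x1 ^+ p = 1 -> x2 ^+ p = 1 ->
  commute d1 x1 -> commute d2 x2 -> commute d1 b -> commute d2 b ->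
  commute [~ x1, x2 ^ b] x1 -> commute [~ x1, x2 ^ b] (x2 ^ b) ->
  commute [~ x2, x1 ^ b] x2 -> commute [~ x2, x1 ^ b] (x1 ^ b) ->
  [/\ s = [~ x2, d1], commute d1 d2 & [/\ commute s x1, commute s x2 & commute s b]].
Proof.
move=> c12 x1p x2p d1x1 d2x2 d1b d2b H1 H2 H3 H4.
have [sx1 sx2 sd1 sd2 E1] := commuting_pair_half c12 d1x1 d2x2 H1 H2 H3 H4.
have [s'x2 s'x1 s'd2 s'd1 _] := commuting_pair_half (commute_sym c12) d2x2 d1x1 H3 H4 H1 H2.
rewrite -/d1 -/d2 -/s in sx1 sx2 sd1 sd2 s'x2 s'x1 s'd2 s'd1 E1.
set s' := [~ x2, d1] in s'x2 s'x1 s'd2 s'd1 E1 *.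
have [d1E d2E sE s'E] : [/\ d1 = [~ x1, b], d2 = [~ x2, b], s = [~ x1, d2] & s' = [~ x2, d1]] by [].
clearbody s s' d1 d2.
have ss' : commute s s' by rewrite s'E; cm.
have F1 : d1 * d2 = d2 * d1 * (s^-1 * s').
  rewrite mulgA -[LHS](mulgK s'^-1) invgK; congr (_ * _).
  have -> : d1 * d2 * s'^-1 = d1 * s'^-1 * d2.
    by rewrite -!mulgA; congr (_ * _); rewrite -/(commute d2 s'^-1); cm.
  by rewrite E1 -!mulgA; congr (_ * _); rewrite -/(commute s^-1 d1); cm.
have d1V : [~ x1, b^-1] = d1^-1 by rewrite commgV -d1E; apply/commuteJE; cm.
have d2V : [~ x2, b^-1] = d2^-1 by rewrite commgV -d2E; apply/commuteJE; cm.
have x1V : x1 ^ b^-1 = x1 * d1^-1 by rewrite conjgR d1V.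
have x2V : x2 ^ b^-1 = x2 * d2^-1 by rewrite conjgR d2V.
have sV : [~ x1, d2^-1] = s^-1 by rewrite commgV -sE; apply/commuteJE; cm.
have s'V : [~ x2, d1^-1] = s'^-1 by rewrite commgV -s'E; apply/commuteJE; cm.
have [||||||_ _ _ _] := @commuting_pair_half x1 x2 b^-1 c12.
- by rewrite d1V; cm.
- by rewrite d2V; cm.
- by rewrite x2V commgMr sV (commuteRE x1 x2).1// conj1g mulg1; cm.
- by rewrite x2V commgMr sV (commuteRE x1 x2).1// conj1g mulg1; cm.
- by rewrite x1V commgMr s'V (commuteRE x2 x1).1 ?conj1g ?mulg1; cm.
- by rewrite x1V commgMr s'V (commuteRE x2 x1).1 ?conj1g ?mulg1; cm.
rewrite d1V d2V sV s'V !invgK => E2.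
have F2 : d1 * d2 = d2 * d1 * (s'^-1 * s).
  have : (d1^-1 * s' * d2^-1)^-1 = (d2^-1 * s * d1^-1)^-1 by rewrite E2.
  rewrite !invgM !invgK !mulgA => E3.
  rewrite -[LHS](mulgK s^-1) invgK; congr (_ * _).
  have -> : d1 * d2 * s^-1 = d1 * s^-1 * d2.
    by rewrite -!mulgA; congr (_ * _); rewrite -/(commute d2 s^-1); cm.
  by rewrite -E3 -!mulgA; congr (_ * _); rewrite -/(commute s'^-1 d1); cm.
have sp : s ^+ p = 1 by rewrite sE -commgX -?sE ?x1p ?comm1g.
have s'p : s' ^+ p = 1 by rewrite s'E -commgX -?s'E ?x2p ?comm1g.
have k1 : s^-1 * s' = 1.
  apply: (odd_exp_eq1 op).
    by rewrite expgMn; [rewrite expVgn sp s'p invg1 mulg1|cm].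
  have e : s^-1 * s' = s'^-1 * s by apply: (@mulgI _ (d2 * d1)); rewrite -F1 -F2.
  by rewrite expg2 {2}e mulgA mulgK mulVg.
have ss : s = s' by rewrite -[s]invgK; apply: mulg1_eq.
have d12 : commute d1 d2 by rewrite /commute F1 k1 mulg1.
split=> //; split=> //; apply/commuteJE.
rewrite [in LHS]sE conjRg (commuteJE d2 b).1// conjgR -d1E commgM -sE.
by rewrite (commuteRE d1 d2).1// mulg1; apply/commuteJE.
Qed.

(** In use [c] is a commutator of [x], and [x * c], [x / c] are conjugates of [x]. The pair [x],
    [x * c] leaves the obstruction [s = [~ x, [~ x * c, b]]]. The third conjugate provides an
    element [y] with [y ^ x = y ^ c]; these are [y * s] and [y * s^-1 ^+ 3], so [s ^+ 4 = 1]. *)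
Lemma twisted_commutator x c b :
  commute x c -> x ^+ p = 1 -> (x * c) ^+ p = 1 ->
  commute [~ x, b] x -> commute [~ x, b] b ->
  commute [~ x * c, b] (x * c) -> commute [~ x * c, b] b ->
  commute [~ x / c, b] (x / c) ->
  commute [~ x, (x * c) ^ b] x -> commute [~ x, (x * c) ^ b] ((x * c) ^ b) ->
  commute [~ x * c, x ^ b] (x * c) -> commute [~ x * c, x ^ b] (x ^ b) ->
  [/\ commute [~ c, b] b, commute [~ c, b] c & commute [~ c, b] x].
Proof.
move=> xc xp x2p d1x d1b d2x2 d2b d3x3 H1 H2 H3 H4.
set x2 := x * c in x2p d2x2 d2b H1 H2 H3 H4.
have c12 : commute x x2 by rewrite /x2; cm.
have [e1 d12 [sx sx2 sb]] := commuting_pair c12 xp x2p d1x d2x2 d1b d2b H1 H2 H3 H4.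
have [_ _ sd1 sd2 _] := commuting_pair_half c12 d1x d2x2 H1 H2 H3 H4.
set d1 := [~ x, b] in d1x d1b d12 e1 sd1 sd2; set d2 := [~ x2, b] in d2x2 d2b d12 e1 sx sx2 sb sd1 sd2.
set s := [~ x, d2] in sx sx2 sb e1 sd1 sd2.
have [d1E d2E sE] : [/\ d1 = [~ x, b], d2 = [~ x2, b] & s = [~ x, d2]] by [].
have x2E : x2 = x * c by [].
clearbody s d1 d2 x2.
have ec : c = x^-1 * x2 by rewrite x2E mulKg.
have d1x2 : d1 ^ x2 = d1 * s^-1 by rewrite conjgR -invgR -e1.
have ee : [~ c, b] = s * d1^-1 * d2.
  rewrite ec commgM commVg -d1E -d2E -conjgM -ec; congr (_ * _).
  rewrite ec conjgM (commuteJE d1^-1 x^-1).1; last by cm.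
  by rewrite conjVg d1x2 invgM invgK.
have eb : commute [~ c, b] b by rewrite ee; cm.
(* This is [[~ x / c, b]] conjugated by [c], whence it commutes with [x / c]. *)
set y := d1 / [~ c, b].
have ey : y = d1 * d1 * d2^-1 * s^-1.
  rewrite /y ee !invgM invgK !mulgA; congr (_ * _).
  by rewrite -!mulgA; congr (_ * _); rewrite -/(commute d2^-1 d1); cm.
have yc : commute (x / c) y.
  apply/(commute_conj _ _ c^-1).
  have -> : (x / c) ^ c^-1 = x / c by apply/commuteJE; cm.
  have -> : y ^ c^-1 = [~ x / c, b] by rewrite commgM commVg -d1E /y conjMg conjVg.
  exact: commute_sym.
have yx : y ^ x = y * s.
  have d1J : d1 ^ x = d1 by apply/commuteJE.
  have sJ : s ^ x = s by apply/commuteJE.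
  have d2J : d2 ^ x = d2 * s^-1 by rewrite conjgR sE invgR.
  rewrite ey !conjMg !conjVg d1J sJ d2J invgM invgK mulgVK -!mulgA; congr (_ * (_ * _)).
  have e : s * d2^-1 = d2^-1 * s by rewrite -/(commute s d2^-1); cm.
  by rewrite mulgA e mulgK.
have yc' : y ^ c = y * (s^-1 ^+ 3).
  have d1J : d1 ^ c = d1 * s^-1.
    by rewrite ec conjgM (commuteJE d1 x^-1).1//; cm.
  have sJ : s ^ c = s by apply/commuteJE; rewrite ec; cm.
  have d2J : d2 ^ c = d2 * s.
    have e : d2 ^ x^-1 = d2 * s.
      apply: (@conjg_inj _ x); rewrite conjgKV conjMg (commuteJE s x).1// conjgR.
      by rewrite -(invgR x) -sE mulgVK.
    rewrite ec conjgM e conjMg.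
    by congr (_ * _); apply/commuteJE.
  rewrite ey !conjMg !conjVg d1J sJ d2J invgM.
  have e1' : s^-1 * d1 = d1 * s^-1 by rewrite -/(commute s^-1 d1); cm.
  have e2' : s^-1 * d2^-1 = d2^-1 * s^-1 by rewrite -/(commute s^-1 d2^-1); cm.
  rewrite !expgS expg0 mulg1 -!mulgA !(mulgA s^-1 d1) !e1' -!mulgA.
  by do 3 rewrite !(mulgA s^-1 d2^-1) !e2' -!mulgA.
have sp : s ^+ p = 1 by rewrite sE -commgX -?sE ?xp ?comm1g.
have s1 : s = 1.
  apply: (odd_exp4_eq1 op sp).
  have : y ^ x = y ^ c.
    by have := conjgM y (x / c) c; rewrite divgK => ->; rewrite (commuteJE y (x / c)).1//; cm.
  rewrite yx yc' => /mulgI e.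
  by rewrite expgS {1}e expVgn mulVg.
have xd2 : commute x d2 by apply/commuteRE; rewrite -sE.
have d1x2' : commute d1 x2 by apply/commuteJE; rewrite d1x2 s1 invg1 mulg1.
by rewrite ee s1 mul1g; split; [cm|rewrite ec; cm|cm].
Qed.
End OddCalculus.

(** * Sandwich sets *)

(* [X] plays the role of the conjugates of a left 3-Engel element of order [p];
   [q] bounds the exponent of the [p]-elements of the group generated by [X]. *)
Record sandwich (p q : nat) (G : groupType) (X : set G) : Prop := Sandwich {
  sandwichJ : forall x g, X x -> X (x ^ g);
  sandwich_exp : forall x, X x -> x ^+ p = 1;
  sandwich_comm : forall x y, X x -> X y -> commute [~ x, y] x;
  sandwich_order : forall g, generated X g -> g ^+ (q * p) = 1 -> g ^+ q = 1 }.

Section Sandwich.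
Variables (p q : nat) (G : groupType) (X : set G).
Hypothesis sX : sandwich p q X.

Lemma sandwich_commr x y : X x -> X y -> commute [~ x, y] y.
Proof.
move=> Xx Xy; rewrite -invgR; apply: commute_sym; apply: commuteV.
by apply: commute_sym; exact: (sandwich_comm sX).
Qed.

Lemma sandwich_torsion g : (exists k, q = p ^ k)%N -> generated X g -> ptorsion p g -> g ^+ q = 1.
Proof.
move=> [k qE] Xg [m gm].
suff: forall j, g ^+ (q * p ^ j) = 1 -> g ^+ q = 1.
  by move=> /(_ m); apply; rewrite mulnC expgnA gm expg1n.
elim=> [|j IH]; first by rewrite muln1.
rewrite expnSr mulnA mulnAC => e; apply: IH.
rewrite mulnC expgnA; apply: (sandwich_order sX); first exact: (subgroupX _ (generated_subgroup X)).
by rewrite -expgnA mulnC.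
Qed.

Lemma sandwich_ptorsion x : X x -> ptorsion p x.
Proof. by move=> Xx; exists 1%N; rewrite expn1; exact: (sandwich_exp sX). Qed.
End Sandwich.

(** * Odd exponent: adjoining commutators to a sandwich set *)

Section OddSandwich.
Variables (p q : nat) (G : groupType) (X : set G).
Hypotheses (op : odd p) (sX : sandwich p q X).

(** Only the action of [b] on [X] is restricted, not membership, so that [b] may later be a
    commutator. *)
Lemma sandwich_twist x y b : X x -> X y ->
  (forall z, X z -> commute [~ z, b] z /\ commute [~ z, b] b) ->
  [/\ commute [~ [~ x, y], b] b, commute [~ [~ x, y], b] [~ x, y] &
      commute [~ [~ x, y], b] x].
Proof.
move=> Xx Xy Xb.
have Xxc : X (x * [~ x, y]) by rewrite -conjgR; exact: (sandwichJ sX).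
have Xxc' : X (x / [~ x, y]).
  have -> : x / [~ x, y] = x ^ y^-1; last exact: (sandwichJ sX).
  rewrite conjgR commgV; congr (_ * _); apply/esym/commuteJE.
  by have := sandwich_commr sX Xx Xy => ?; cm.
have [h1 h2] := Xb _ Xx; have [h3 h4] := Xb _ Xxc; have [h5 h6] := Xb _ Xxc'.
apply: (twisted_commutator op) => //; try exact: (sandwich_exp sX).
- by apply: commute_sym; exact: (sandwich_comm sX).
- by apply: (sandwich_comm sX) => //; exact: (sandwichJ sX).
- by apply: (sandwich_commr sX) => //; exact: (sandwichJ sX).
- by apply: (sandwich_comm sX) => //; exact: (sandwichJ sX).
- by apply: (sandwich_commr sX) => //; exact: (sandwichJ sX).
Qed.

(** [sandwich_twist] settles [x], [b] and [[~ x, y]]; exchanging [x] and [y] settles [y], as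
    [[~ y, x, b]] is the inverse of [[~ x, y, b]]. *)
Lemma sandwich_class3 x y b : X x -> X y -> X b ->
  [/\ commute [~ x, y, b] x, commute [~ x, y, b] y, commute [~ x, y, b] b &
      commute [~ x, y, b] [~ x, y]].
Proof.
move=> Xx Xy Xb.
have H z : X z -> commute [~ z, b] z /\ commute [~ z, b] b.
  by move=> Xz; split; [exact: (sandwich_comm sX)|exact: (sandwich_commr sX)].
have [h1 h2 h3] := sandwich_twist Xx Xy H; have [h4 h5 h6] := sandwich_twist Xy Xx H.
split=> //; suff -> : [~ x, y, b] = [~ y, x, b]^-1 by cm.
by rewrite -(invgR y x) commVg; apply/commuteJE; cm.
Qed.

Definition comm_step : set G := X `|` [set [~ x, y] | x in X & y in X].

(** The case of two commutators rests on the mixed one, which shows that a commutator acts on [X] as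
    [sandwich_twist] requires of [b]. *)
Lemma comm_step_sandwich : sandwich p q comm_step.
Proof.
split.
- move=> x g [Xx|[u Xu [v Xv <-]]]; first by left; exact: (sandwichJ sX).
  by right; exists (u ^ g); [exact: (sandwichJ sX)|exists (v ^ g); [exact: (sandwichJ sX)|rewrite conjRg]].
- move=> x [Xx|[u Xu [v Xv <-]]]; first exact: (sandwich_exp sX).
  by rewrite -commgX ?(sandwich_exp sX) ?comm1g//; exact: (sandwich_comm sX).
- have H2 x u v : X x -> X u -> X v -> commute [~ x, [~ u, v]] x /\ commute [~ x, [~ u, v]] [~ u, v].
    move=> Xx Xu Xv; have [? ? ? ?] := sandwich_class3 Xu Xv Xx.
    by rewrite -invgR; split; cm.
  move=> x y [Xx|[u Xu [v Xv <-]]] [Xy|[u' Xu' [v' Xv' <-]]].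
  + exact: (sandwich_comm sX).
  + by have [] := H2 x _ _ Xx Xu' Xv'.
  + by have [] := sandwich_class3 Xu Xv Xy.
  + by have [|] := @sandwich_twist u v [~ u', v'] Xu Xv; first by move=> z Xz; exact: H2.
- move=> g Xg; apply: (sandwich_order sX).
  apply: generated_sub Xg => x [Xx|[u Xu [v Xv <-]]]; first exact: sub_generated.
  by apply: (subgroupR (generated_subgroup X)); exact: sub_generated.
Qed.
End OddSandwich.

Lemma odd_comm_closure p q (G : groupType) (X : set G) : odd p -> sandwich p q X ->
  exists Y : set G, [/\ X `<=` Y, sandwich p q Y & forall x y, Y x -> Y y -> Y [~ x, y]].
Proof.
move=> op sX; pose S n := iter n (@comm_step G) X.
have SS n : sandwich p q (S n) by elim: n => [//|n IH]; exact: comm_step_sandwich.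
have Smon m n : (m <= n)%N -> S m `<=` S n.
  by move=> /subnK <-; elim: (n - m)%N => [//|k IH] x /IH; left.
exists [set x | exists n, S n x]; split=> [x Xx|| x y [m Sx] [n Sy]]; first by exists 0%N.
- split.
  + by move=> x g [n Sx]; exists n; exact: (sandwichJ (SS n)).
  + by move=> x [n Sx]; exact: (sandwich_exp (SS n)).
  + move=> x y [m Sx] [n Sy]; apply: (sandwich_comm (SS (maxn m n))).
      by apply: Smon Sx; exact: leq_maxl.
    by apply: Smon Sy; exact: leq_maxr.
  + move=> g Sg; apply: (sandwich_order sX); apply: generated_sub Sg => x [n].
    elim: n x => [|n IH] x; first exact: sub_generated.
    case=> [/IH//|[u /IH Xu [v /IH Xv <-]]].
    exact: (subgroupR (generated_subgroup X)).
- exists (maxn m n).+1; right; exists x.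
    by apply: Smon Sx; exact: leq_maxl.
  by exists y => //; apply: Smon Sy; exact: leq_maxr.
Qed.

Section OddClosed.
Variables (p q : nat) (G : groupType) (X : set G).
Hypotheses (op : odd p) (sX : sandwich p q X).
Hypothesis XR : forall x y, X x -> X y -> X [~ x, y].
Implicit Types c t u v x y b : G.

(** With [k = [~ x, y]] and [z = [~ k, t]], both centralized by [x], conjugation by [t] and by
    [t ^ x] sends [k] to [k * z], and [[~ t, x]] is [t^-1 * t ^ x]. *)
Lemma sandwich_comm2 t x y : X t -> X x -> X y -> commute [~ t, x] [~ x, y].
Proof.
move=> Xt Xx Xy; have [h1 h2 h3 h4] := sandwich_class3 op sX Xx Xy Xt.
have xx : commute [~ x, y] x := sandwich_comm sX Xx Xy.
move: h1 h2 h3 h4 xx (conjgR [~ x, y] t).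
set k := [~ x, y]; set z := [~ k, t]; clearbody z k => h1 h2 h3 h4 xx e.
apply: commute_sym; apply/commuteJE; rewrite commgEl conjgM.
have -> : k ^ t^-1 = k * z^-1.
  apply: (@conjg_inj _ t); rewrite conjgKV conjMg e conjVg (commuteJE z t).1// mulgK //.
have kx : k ^ t ^ x = k * z.
  by rewrite -{1}((commuteJE k x).1 xx) -conjJg e conjMg (commuteJE k x).1 ?(commuteJE z x).1.
have zx : z ^ t ^ x = z by apply/commuteJE; cm.
by rewrite conjMg conjVg kx zx mulgK.
Qed.

(* The Hall-Witt identity in the group <t, x, y>, whose class is at most 3. *)
Lemma sandwich_Jacobi t x y : X t -> X x -> X y ->
  [~ t, x, y] = [~ t, y, x] * [~ t, [~ x, y]].
Proof.
move=> Xt Xx Xy.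
have [a1 a2 a3 a4] := sandwich_class3 op sX Xt Xx Xy.
have [b1 b2 b3 b4] := sandwich_class3 op sX Xt Xy Xx.
have [c1 c2 c3 c4] := sandwich_class3 op sX Xx Xy Xt.
have tx := sandwich_comm2 Xt Xx Xy.
have ty : commute [~ t, y] [~ x, y].
  by rewrite -(invgR y x); apply: commuteV; exact: sandwich_comm2.
have e1 : t ^ (x * y) = t * [~ t, y] * ([~ t, x] * [~ t, x, y]).
  by rewrite conjgM (conjgR t x) conjMg !conjgR.
have e2 : t ^ (y * x) = t * [~ t, x] * ([~ t, y] * [~ t, y, x]).
  by rewrite conjgM (conjgR t y) conjMg !conjgR.
have e3 : t ^ (x * y) = (t ^ (y * x)) ^ [~ x, y] by rewrite -conjgM -commgC.
have xyJ : [~ t, [~ x, y]] = [~ x, y, t]^-1 by rewrite invgR.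
have k : commute [~ t, [~ x, y]] [~ t, x] by rewrite xyJ; cm.
have k' : commute [~ t, [~ x, y]] [~ t, y] by rewrite xyJ; cm.
have k'' : commute [~ t, [~ x, y]] [~ t, y, x] by rewrite xyJ; cm.
have dd : commute [~ t, x] [~ t, y].
  by rewrite -(invgR x t); apply: commute_sym; apply: commuteV; apply: commute_sym; exact: sandwich_comm2.
have tw : t ^ [~ x, y] = t * [~ t, [~ x, y]] by rewrite conjgR.
have bw : commute [~ t, y, x] [~ x, y] by cm.
move: e3; rewrite e1 e2; move: k k' k'' dd tx ty tw bw.
move: [~ x, y] [~ t, x] [~ t, y] [~ t, x, y] [~ t, y, x] [~ t, [~ x, y]].
move=> w d d' a b z zd zd' zb dd' dw d'w tw bw.
rewrite !conjMg tw ((commuteJE _ _).1 dw) ((commuteJE _ _).1 d'w) ((commuteJE _ _).1 bw).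
rewrite -!mulgA => /mulgI.
have -> : z * (d * (d' * b)) = d' * (d * (b * z)).
  by rewrite [RHS]mulgA -dd' -zb -!mulgA (mulgA d' z) -zd' -!mulgA (mulgA d z) -zd !mulgA.
by move=> /mulgI/mulgI.
Qed.

(** Extending [[~ c, u]] by letters that commute with [c] thus always gives elements [[~ c, w]], and
    by [sandwich_comm2] all of these commute with each other. *)
Lemma sandwich_comm_killed c u v : X c -> X u -> X v -> commute c v ->
  [~ c, u, v] = [~ c, [~ u, v]].
Proof.
by move=> Xc Xu Xv /commuteRE cv; rewrite sandwich_Jacobi// cv comm1g mul1g.
Qed.

End OddClosed.

(** If the image of [k] has exponent [q * p], then [k ^+ (q * p)] lies in the p-torsion kernel; so
    [k] is p-torsion and has exponent [q] already before passing to the quotient. *)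
Lemma sandwich_transfer p q (G K Q : groupType) (X : set G) (i : K -> G) (f : K -> Q) :
  (exists k, q = p ^ k)%N -> sandwich p q X ->
  {morph i : x y / x * y} -> injective i -> {morph f : x y / x * y} ->
  (forall a, exists x, a = f x) -> (forall k, f k = 1 -> ptorsion p k) ->
  sandwich p q (f @` (i @^-1` X)).
Proof.
move=> qp sX iM i_inj fM f_surj f1; split.
- move=> _ a [x Xx <-]; have [g ->] := f_surj a; exists (x ^ g); last exact: (morphJ fM).
  by rewrite /preimage /= (morphJ iM); exact: (sandwichJ sX).
- move=> _ [x Xx <-]; rewrite -(morphX fM); have -> : x ^+ p = 1; last exact: (morph1 fM).
  by apply: i_inj; rewrite (morphX iM) (morph1 iM); exact: (sandwich_exp sX).
- move=> _ _ [x Xx <-] [y Xy <-].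
  rewrite /commute -(morphR fM) -!fM; congr f; apply: i_inj; rewrite [LHS]iM [RHS]iM (morphR iM).
  exact: (sandwich_comm sX).
- move=> a; rewrite -(image_generated fM) => -[k Xk <-]; rewrite -!(morphX fM).
  have Xik : generated X (i k).
    apply: generatedS (_ : generated (i @` (i @^-1` X)) (i k)) => [_ [x Xx <-]//|].
    by rewrite -(image_generated iM); exists k.
  move=> /f1[m km]; have -> : k ^+ q = 1; last exact: (morph1 fM).
  apply: i_inj; rewrite (morphX iM) (morph1 iM); apply: (sandwich_torsion sX) => //.
  have [j qE] := qp; exists (j + 1 + m)%N.
  by rewrite !expnD expn1 -qE expgnA -(morphX iM) -(morphX iM) km (morph1 iM).
Qed.

(** * Induction on the number of generators *)

Section Induction.
Variables (p q : nat).
Hypothesis qp : (exists k, q = p ^ k)%N.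

(** All groups are quantified, because the induction step replaces the group by a quotient of a
    subgroup. *)
Definition nilpotent_rank r := forall (G : groupType) (X : set G) (s : seq G),
  sandwich p q X -> [set` s] `<=` X -> size s = r -> nilpotent (generated [set` s]).

Definition core r := forall (G : groupType) (X : set G) (s : seq G),
  sandwich p q X -> [set` s] `<=` X -> size s = r ->
  generated [set` s] = setT -> centerless p G -> forall x, x \in s -> x = 1.

Lemma core_nilpotent r : core r -> nilpotent_rank r.
Proof.
move=> cr G X s sX sub ss.
have ps x : x \in s -> ptorsion p x by move=> /sub; exact: (sandwich_ptorsion sX).
have [K [Q [i [f [t [iM i_inj fM f_surj [ts gen ZQ f1]]]]]]] := centerless_reduction ps.
apply=> x xt; apply: (cr Q (f @` (i @^-1` X)) (map f t)) => //; last exact: map_f.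
- exact: (sandwich_transfer qp sX).
- move=> _ /mapP[k kt ->]; exists k => //; apply: sub; rewrite /= -ts; exact: map_f.
- by rewrite size_map -ss -ts size_map.
- apply/seteqP; split=> // a _; have [k ->] := f_surj a.
  have : (f @` generated [set` t]) (f k) by exists k => //; rewrite gen.
  rewrite (image_generated fM); apply: generatedS => _ [b bt <-].
  exact: map_f.
Qed.

(** Starting from [x], commutators with letters are taken as long as they are nontrivial; they stay
    in [Y], and nilpotency bounds the number of steps. *)
Lemma nilpotent_central (G : groupType) (Y : set G) (s : seq G) :
  (forall x y, Y x -> Y y -> Y [~ x, y]) -> [set` s] `<=` Y ->
  nilpotent (generated [set` s]) -> forall x, x \in s -> x <> 1 ->
  exists c, [/\ Y c, c <> 1 & forall y, y \in s -> commute c y].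
Proof.
move=> YR sY [n sn] x xs.
have : upper_central (generated [set` s]) n x by apply: sn; exact: sub_generated.
have := sY x xs; elim: n x {xs sn} => [x _ -> //|n IH] x Yx [_ xZ] x1.
have [[y ys xy]|H] := pselect (exists2 y, y \in s & [~ x, y] <> 1).
  by apply: (IH [~ x, y]) => //; [apply: YR => //; exact: sY|apply: xZ; exact: sub_generated].
exists x; split=> // y ys; apply/commuteRE; apply: contrapT => xy; apply: H; by exists y.
Qed.
End Induction.

Lemma nilpotent_rank0 p q : nilpotent_rank p q 0.
Proof.
move=> G X s _ _ /size0nil ->; exists 0%N; apply: generated_min => //.
by apply/subgroupP; split=> [//|x y -> ->|x ->] /=; rewrite ?mulg1 ?invg1.
Qed.

Lemma central_cons (G : groupType) (u : G) (h : seq G) c : generated [set` u :: h] = setT ->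
  commute c u -> (forall y, y \in h -> commute c y) -> forall g, commute c g.
Proof.
move=> gen cu ch g; have : generated [set` u :: h] g by rewrite gen.
by apply: commute_generated => a; rewrite /= inE => /predU1P[->//|/ch].
Qed.

(** An element of [Y] centralizing [h] is then central, hence trivial. Through [nilpotent_central]
    this trivializes the letters of [h], and after them [u], which commutes with trivial letters. *)
Lemma centralizing_core p q r : nilpotent_rank p q r ->
  (forall (G : groupType) (X : set G) u h, sandwich p q X -> X u -> [set` h] `<=` X ->
    size h = r -> generated [set` u :: h] = setT -> centerless p G ->
    exists Y : set G, [/\ X `<=` Y, forall x y, Y x -> Y y -> Y [~ x, y],
       forall y, Y y -> ptorsion p y &
       forall c, Y c -> (forall y, y \in h -> commute c y) -> commute c u]) ->
  core p q r.+1.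
Proof.
move=> IH H G X [//|u h] sX sub [sh] gen ZG.
have Xu : X u by apply: sub; rewrite /= mem_head.
have Xh : [set` h] `<=` X by move=> x xh; apply: sub; rewrite /= inE xh orbT.
have [Y [XY YR Yp Yc]] := H G X u h sX Xu Xh sh gen ZG.
have Zc c : Y c -> (forall y, y \in h -> commute c y) -> c = 1.
  move=> YYc ch; apply: ZG; last exact: Yp.
  by apply: (central_cons gen) => //; exact: Yc.
have h1 x : x \in h -> x = 1.
  move=> xh; apply: contrapT => x1.
  have [||c [Ycc c1 ch]] := @nilpotent_central G Y h YR _ _ x xh x1.
  - by move=> y /Xh/XY.
  - exact: IH sX Xh sh.
  by apply: c1; exact: Zc.
move=> x; rewrite inE => /predU1P[->|]; last exact: h1.
by apply: Zc => [|y /h1 ->]; [exact: XY|exact: commute1].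
Qed.

(** * Norm relations *)

Section Words.
Variables (G : groupType) (m : G) (a : seq G).
Implicit Types (w : seq nat) (P Q L : seq (seq nat)).

(* A list of words stands for the product of their values, so that conjugation
   by a letter becomes the operation [conj_letter] on lists of words. *)
Definition act w := foldl (fun g i => [~ g, nth 1 a i]) m w.
Definition eval P := \prod_(w <- P) act w.

Lemma act_rcons w i : act (rcons w i) = [~ act w, nth 1 a i].
Proof. by rewrite /act -cats1 foldl_cat. Qed.

Variable bad : pred (seq nat).
Hypothesis bad1 : forall w, bad w -> act w = 1.
Hypothesis goodC : forall v w, ~~ bad v -> ~~ bad w -> commute (act v) (act w).

Lemma actC v w : commute (act v) (act w).
Proof.
have [/bad1 ->|gv] := boolP (bad v); first exact/commute_sym/commute1.
have [/bad1 ->|gw] := boolP (bad w); first exact: commute1.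
exact: goodC.
Qed.

Lemma act_evalC v P : commute (act v) (eval P).
Proof. by apply: commute_prod => w _; exact: actC. Qed.

Lemma eval_cat P Q : eval (P ++ Q) = eval P * eval Q.
Proof. by rewrite /eval big_cat. Qed.

Lemma eval_cons w P : eval (w :: P) = act w * eval P.
Proof. by rewrite /eval big_cons. Qed.

Definition conj_letter i P := P ++ [seq w <- [seq rcons w i | w <- P] | ~~ bad w].

Lemma eval_conj_letter i P : eval P ^ nth 1 a i = eval (conj_letter i P).
Proof.
rewrite /conj_letter eval_cat; elim: P => [|w P IH] /=.
  by rewrite /eval !big_nil conj1g mulg1.
rewrite !eval_cons conjMg IH conjgR -act_rcons.
have -> : eval (if ~~ bad (rcons w i) then rcons w i :: [seq w0 <- [seq rcons w0 i | w0 <- P] | ~~ bad w0]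
   else [seq w0 <- [seq rcons w0 i | w0 <- P] | ~~ bad w0]) =
   act (rcons w i) * eval [seq w0 <- [seq rcons w0 i | w0 <- P] | ~~ bad w0].
  by case: ifPn; rewrite ?negbK ?eval_cons// => /bad1 ->; rewrite mul1g.
rewrite -!mulgA; congr (_ * _); rewrite !mulgA; congr (_ * _).
exact: act_evalC.
Qed.

Definition conj_letters js P := foldl (fun P i => conj_letter i P) P js.
Definition prod_letters js := \prod_(i <- js) nth 1 a i.

Lemma eval_conj_letters js P : eval P ^ prod_letters js = eval (conj_letters js P).
Proof.
rewrite /prod_letters /conj_letters; elim: js P => [|i js IH] P /=.
  by rewrite big_nil conjg1.
by rewrite big_cons conjgM eval_conj_letter IH.
Qed.

(** The conjugates of [m] under j^0, ..., j^(n-1), expanded symbolically with the bad words dropped,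
    so that multiplicities can be computed. *)
Fixpoint norm_words js n : seq (seq nat) :=
  if n is n'.+1 then [::] :: conj_letters js (norm_words js n') else [::].

Lemma norm_wordsE js n : (prod_letters js * m) ^+ n = prod_letters js ^+ n * eval (norm_words js n).
Proof.
elim: n => [|n IH]; first by rewrite !expg0 /eval big_nil mulg1.
rewrite expgSr IH /= eval_cons -eval_conj_letters /= expgSr.
set j := prod_letters js.
have := act_evalC [::] (conj_letters js (norm_words js n)).
rewrite -eval_conj_letters -/j /commute => ->.
by rewrite /conjg /act /= !mulgA mulgK.
Qed.

Lemma eval_count P L : uniq L -> {subset P <= L} ->
  eval P = \prod_(w <- L) act w ^+ count_mem w P.
Proof.
move=> uL; elim: P => [_|v P IH sub].
  by rewrite /eval big_nil big1.
have vL : v \in L by apply: sub; rewrite mem_head.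
rewrite eval_cons IH => [|w wP]; last by apply: sub; rewrite inE wP orbT.
have -> : act v = \prod_(w <- L) act w ^+ (v == w).
  elim: L uL vL {sub IH} => [//|u L IH] /= /andP[uL' uL]; rewrite inE big_cons => /predU1P[->|vL].
    rewrite eqxx expg1 big_seq big1 ?mulg1// => w wL.
    by rewrite (_ : (u == w) = false)//; apply: contraNF uL' => /eqP ->.
  rewrite (_ : (v == u) = false) ?expg0 ?mul1g -?IH//.
  by apply: contraNF uL' => /eqP <-.
rewrite -prodgM_commute; last first.
  by move=> v' w' *; apply/commuteX2/actC.
by apply: eq_bigr => w _; rewrite /= expgnDr.
Qed.

(** Values commute and have exponent [p], so a product depends only on multiplicities modulo [p]: a
    relation becomes a boolean check. *)
Lemma eval_modn p P Q L : (forall w, act w ^+ p = 1) -> uniq L ->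
  all [in L] P -> all [in L] Q ->
  all (fun w => count_mem w P == count_mem w Q %[mod p]) L -> eval P = eval Q.
Proof.
move=> ap uL /allP PL /allP QL /allP PQ.
rewrite (eval_count uL PL) (eval_count uL QL); apply: eq_big_seq => w /PQ/eqP e.
have modE k : act w ^+ k = act w ^+ (k %% p).
  by rewrite {1}(divn_eq k p) expgnDr mulnC expgnA ap expg1n mul1g.
by rewrite modE e -modE.
Qed.

Lemma eval_exp p P : (forall w, act w ^+ p = 1) -> eval P ^+ p = 1.
Proof.
move=> ap; elim: P => [|w P IH]; first by rewrite /eval big_nil expg1n.
by rewrite eval_cons expgMn ?ap ?IH ?mulg1//; exact: act_evalC.
Qed.

(* If j ^+ n = 1 then (j * m) ^+ n is the product of the conjugates of m under
   the powers of j. It is trivial because it has exponent p. *)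
Lemma norm_relation p n js L Q : (forall w, act w ^+ p = 1) ->
  prod_letters js ^+ n = 1 ->
  ((prod_letters js * m) ^+ (n * p) = 1 -> (prod_letters js * m) ^+ n = 1) ->
  (let P := norm_words js n in [&& uniq L, all [in L] P, all [in L] Q &
    all (fun w => count_mem w P == count_mem w Q %[mod p]) L]) ->
  eval Q = 1.
Proof.
move=> ap jn jmn /and4P[uL PL QL PQ].
have e : (prod_letters js * m) ^+ n = eval (norm_words js n).
  by rewrite norm_wordsE jn mul1g.
by rewrite -(eval_modn ap uL PL QL PQ) -e; apply: jmn; rewrite expgnA e eval_exp.
Qed.
End Words.

Section FiniteWords.
Variables (G : groupType) (m : G) (a : seq G) (L : seq (seq nat)).

(** A word outside [L] has a shortest prefix outside [L], which extends a word of [L] by one letter.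
    Indices beyond [a] denote the default letter 1 and give trivial commutators. *)
Lemma act_notin : [::] \in L ->
  (forall w i, w \in L -> (i < size a)%N -> rcons w i \notin L -> act m a (rcons w i) = 1) ->
  forall w, w \notin L -> act m a w = 1.
Proof.
move=> L0 Lext; elim/last_ind => [|w i IH] wL; first by rewrite L0 in wL.
have [wL'|/IH e] := boolP (w \in L); last by rewrite act_rcons e comm1g.
have [ia|ai] := ltnP i (size a); first exact: Lext.
by rewrite act_rcons nth_default// commg1.
Qed.

Lemma finite_norm_relation p n js Q : [::] \in L ->
  (forall w i, w \in L -> (i < size a)%N -> rcons w i \notin L -> act m a (rcons w i) = 1) ->
  (forall v w, v \in L -> w \in L -> commute (act m a v) (act m a w)) ->
  (forall w, w \in L -> act m a w ^+ p = 1) ->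
  prod_letters a js ^+ n = 1 ->
  ((prod_letters a js * m) ^+ (n * p) = 1 -> (prod_letters a js * m) ^+ n = 1) ->
  (let P := norm_words (predC [in L]) js n in [&& uniq L, all [in L] P, all [in L] Q &
    all (fun w => count_mem w P == count_mem w Q %[mod p]) L]) ->
  eval m a Q = 1.
Proof.
move=> L0 Lext LC Lp jn jmn chk; have bad1 := act_notin L0 Lext.
apply: (@norm_relation _ m a (predC [in L]) _ _ p n js L) => //.
- by move=> v w; rewrite /= !negbK; exact: LC.
- by move=> w; have [/Lp//|/bad1 ->] := boolP (w \in L); rewrite expg1n.
Qed.
End FiniteWords.

(** * Exponent 3 *)

(** A commutator of three of the letters is trivial if a letter recurs, and otherwise is centralized
    by all three by [sandwich_class3]. *)
Lemma sandwich_nilpotent3 (G : groupType) p q (Y : set G) : odd p -> sandwich p q Y ->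
  forall x y z, Y x -> Y y -> Y z ->
  nilpotent (generated [set` [:: x; y; z]]).
Proof.
move=> op sY x y z Yx Yy Yz; set A := [set` _]; apply: (@nilpotent_generated _ _ 3).
have AY a : A a -> Y a by rewrite /A /= !inE => /or3P[]/eqP ->.
have gA a : A a -> generated A a by exact: sub_generated.
have gR a b : generated A a -> generated A b -> generated A [~ a, b].
  exact: (subgroupR (generated_subgroup A)).
have e2 a b c d : A a -> A b -> A c -> A d -> [~ a, b, c, d] = 1.
  move=> Aa Ab Ac Ad; apply/commuteRE.
  have H a' b' c' : A a' -> A b' -> A c' -> 
    [/\ commute [~ a', b', c'] a', commute [~ a', b', c'] b' & commute [~ a', b', c'] c'].
    by move=> /AY Ya /AY Yb /AY Yc; have [] := sandwich_class3 op sY Ya Yb Yc.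
  have [Ha Hb Hc] := H a b c Aa Ab Ac.
  have Haa e : e = a \/ e = b \/ e = c -> commute [~ a, b, c] e by move=> [->|[->|->]].
  have tr a' b' : A a' -> A b' -> commute [~ a', b', b'] d.
    by move=> /AY Ya /AY Yb; rewrite (commuteRE _ _).1; [exact/commute_sym/commute1|exact: (sandwich_commr sY)].
  have tr' a' b' : A a' -> A b' -> commute [~ a', b', a'] d.
    by move=> /AY Ya /AY Yb; rewrite (commuteRE _ _).1; [exact/commute_sym/commute1|exact: (sandwich_comm sY)].
  have tr2 a' c' : A a' -> A c' -> commute [~ a', a', c'] d.
    by move=> _ _; rewrite commgg comm1g; exact/commute_sym/commute1.
  have [->|/eqP ab] := eqVneq a b; first exact: tr2.
  have [->|/eqP cb] := eqVneq c b; first exact: tr.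
  have [->|/eqP ca] := eqVneq c a; first exact: tr'.
  apply: Haa; move: Aa Ab Ac Ad ab cb ca; rewrite /A /= !inE.
  by do 4 ![move=> /or3P[]/eqP ->]; intuition congruence.
move=> a Aa; apply: upper_central_generated => [|b Ab]; first exact: gA.
apply: upper_central_generated => [|c Ac]; first exact: gR (gA _ Aa) (gA _ Ab).
apply: upper_central_generated => [|d Ad]; first exact: gR (gR _ _ (gA _ Aa) (gA _ Ab)) (gA _ Ac).
by rewrite e2.
Qed.

(** Supplies [j ^+ q = 1] for norm relations in at most three letters. *)
Lemma sandwich_torsion3 (G : groupType) p q (Y : set G) :
  odd p -> (exists k, q = p ^ k)%N -> sandwich p q Y -> forall x y z, Y x -> Y y -> Y z ->
  forall g, generated [set` [:: x; y; z]] g -> g ^+ q = 1.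
Proof.
move=> op qp sY x y z Yx Yy Yz g Ag.
have AY : [set` [:: x; y; z]] `<=` Y by move=> a; rewrite /= !inE => /or3P[]/eqP ->.
apply: (sandwich_torsion sY) => //; first exact: (generatedS AY).
apply: (nilpotent_ptorsion (k := 1) (sandwich_nilpotent3 op sY Yx Yy Yz)) => // a /AY Ya.
by rewrite expn1; exact: (sandwich_exp sY).
Qed.

Lemma prod_letters_generated (G : groupType) (a : seq G) js :
  generated [set` a] (prod_letters a js).
Proof.
have sA := generated_subgroup [set` a].
rewrite /prod_letters; elim: js => [|i js IH]; rewrite ?big_nil ?big_cons; first exact: (subgroup1 sA).
apply: (subgroupM sA) => //; have [ia|ai] := ltnP i (size a).
  by apply: sub_generated; exact: mem_nth.
by rewrite nth_default//; exact: (subgroup1 sA).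
Qed.

Section Core3.
Variables (G : groupType) (X : set G).
Hypotheses (sX : sandwich 3 3 X) (XR : forall x y, X x -> X y -> X [~ x, y]).

(** With j = u v the norm is (j - 1)^2. As [v] commutes with [c], and [[~ c, u, v]] with both
    letters, this word is all that remains of it. *)
Lemma comm_killed3 c u v : X c -> X u -> X v -> commute c v -> [~ c, u, v] = 1.
Proof.
move=> Xc Xu Xv cv.
have X1 : X [~ c, u] := XR Xc Xu.
have [n1 n2 n3 n4] := sandwich_class3 (isT : odd 3) sX Xc Xu Xv.
have c1c : commute [~ c, u] c := sandwich_comm sX Xc Xu.
have c1u : commute [~ c, u] u := sandwich_commr sX Xc Xu.
suff: eval c [:: u; v] [:: [:: 0; 1]]%N = 1 by rewrite /eval big_seq1.
apply: (@finite_norm_relation _ c [:: u; v] [:: [::]; [:: 0]; [:: 0; 1]]%N 3 3 [:: 0; 1]%N) => //.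
- move=> w i; rewrite !inE => /or3P[]/eqP->; case: i => [|[|//]] _ //= _; exact/commuteRE.
- by move=> w w'; rewrite !inE => /or3P[]/eqP-> /or3P[]/eqP->; rewrite /act /=; cm.
- by move=> w; rewrite !inE => /or3P[]/eqP->; apply: (sandwich_exp sX) => //; exact: XR.
- apply: (sandwich_torsion3 (isT : odd 3) (ex_intro _ 1%N erefl) sX Xc Xu Xv).
  apply: (@generatedS _ [set` [:: u; v]]); last exact: prod_letters_generated.
  by move=> z; rewrite /= !inE => ->; rewrite orbT.
- apply: (sandwich_order sX); apply: (subgroupM (generated_subgroup X)); last exact: sub_generated.
  apply: (@generatedS _ [set` [:: u; v]]); last exact: prod_letters_generated.
  by move=> z; rewrite /= !inE => /orP[]/eqP->.
Qed.
End Core3.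

Theorem nilpotent_rank3 r : nilpotent_rank 3 3 r.
Proof.
elim: r => [|r IH]; first exact: nilpotent_rank0.
apply: core_nilpotent; first by exists 1%N.
apply: centralizing_core IH _ => G X u h sX Xu Xh _ gen ZG.
have [Y [XY sY YR]] := odd_comm_closure (isT : odd 3) sX.
exists Y; split=> // [y|c Yc ch]; first exact: (sandwich_ptorsion sY).
have Yu : Y u := XY u Xu.
apply/commuteRE; apply: ZG; last exact/(sandwich_ptorsion sY)/YR.
apply: (central_cons gen) => [|y yh]; first exact: (sandwich_commr sY).
by apply/commuteRE; apply: (comm_killed3 sY YR) => //; [exact/XY/Xh|exact: ch].
Qed.

(** * Exponent 2 *)

Lemma upper_central_letters (G : groupType) (A : set G) n g : generated A g ->
  (forall w : seq G, size w = n -> [set` w] `<=` A -> foldl (@commg G) g w = 1) ->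
  upper_central (generated A) n g.
Proof.
elim: n g => [g Ag /(_ [::])|n IH g Ag H]; first by apply.
apply: upper_central_generated => // a Aa; apply: IH.
  by apply: (subgroupR (generated_subgroup A)) => //; exact: sub_generated.
move=> w sw wA; apply: (H (a :: w)) => [|x]; first by rewrite /= sw.
by rewrite /= inE => /predU1P[->//|]; exact: wA.
Qed.

Section Involutions.
Variables (G : groupType) (X : set G).
Hypothesis sX : sandwich 2 4 X.
Let N := generated X.
Let sN : subgroup N := generated_subgroup X.
Implicit Types (s t x y z b c u v : G).

Lemma invol_inv t : t ^+ 2 = 1 -> t^-1 = t.
Proof. by rewrite expg2; exact: mulg1_eq. Qed.

Lemma invol_comm t s : t ^+ 2 = 1 -> s ^+ 2 = 1 -> [~ t, s] = (t * s) ^+ 2.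
Proof. by move=> /invol_inv t2 /invol_inv s2; rewrite /commg /conjg t2 s2 expg2 !mulgA. Qed.

Lemma invol_prod_commute t s : t ^+ 2 = 1 -> s ^+ 2 = 1 -> (t * s) ^+ 2 = 1 -> commute t s.
Proof. by move=> t2 s2 ts; apply/commuteRE; rewrite invol_comm. Qed.

Lemma invol_order4 t s : t ^+ 2 = 1 -> s ^+ 2 = 1 -> (t * s) ^+ 4 = 1 ->
  [/\ [~ t, s] ^+ 2 = 1, commute [~ t, s] t & commute [~ t, s] s].
Proof.
move=> t2 s2 ts4; have R2 : [~ t, s] ^+ 2 = 1 by rewrite invol_comm// -expgnA.
have tV := invol_inv t2; have sV := invol_inv s2; have RV := invol_inv R2.
have e1 : [~ t, s] = t * s * t * s by rewrite /commg /conjg tV sV !mulgA.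
have e2 : [~ t, s] = s * t * s * t by rewrite -RV invgR /commg /conjg tV sV !mulgA.
have tK z : t * (t * z) = z by rewrite -{1}tV mulKg.
have sK z : s * (s * z) = z by rewrite -{1}sV mulKg.
have Kt z : z * t * t = z by rewrite -{2}tV mulgK.
have Ks z : z * s * s = z by rewrite -{2}sV mulgK.
split=> //; rewrite /commute.
  by rewrite {1}e2 e1 Kt -!mulgA tK.
by rewrite {1}e1 e2 Ks -!mulgA sK.
Qed.

(** Thus [t] and any involution [s] of [N] generate a quotient of the dihedral group of order 8. The
    set is closed under products of commuting members, hence under commutators with involutions,
    [[~ t, s]] being [t * t ^ s]. *)
Definition strong_invol : set G :=
  [set t | [/\ N t, t ^+ 2 = 1 & forall s, N s -> s ^+ 2 = 1 -> (t * s) ^+ 4 = 1]].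
Local Notation Y := strong_invol.

Lemma order8 g : N g -> g ^+ 8 = 1 -> g ^+ 4 = 1.
Proof. exact: (sandwich_order sX). Qed.

(** [(x * s) ^+ 2] is [x * x ^ s], whose square [[~ x, x ^ s]] has square 1. So [(x * s) ^+ 8 = 1],
    which the absence of order 8 improves to exponent 4. *)
Lemma sub_strong_invol : X `<=` Y.
Proof.
move=> x Xx; have Nx : N x by exact: sub_generated.
split=> // [|s Ns s2]; first exact: (sandwich_exp sX).
apply: order8; first exact: (subgroupM sN).
rewrite (expgnA _ 2 4).
have -> : (x * s) ^+ 2 = x * x ^ s by rewrite expg2 /conjg (invol_inv s2) !mulgA.
have Xxs : X (x ^ s) by exact: (sandwichJ sX).
rewrite (expgnA _ 2 2) -(invol_comm (sandwich_exp sX Xx) (sandwich_exp sX Xxs)).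
by rewrite -commgX ?(sandwich_exp sX Xx) ?comm1g//; exact: (sandwich_comm sX).
Qed.

Lemma strong_involJ t g : N g -> Y t -> Y (t ^ g).
Proof.
move=> Ng [Nt t2 tP]; split=> [||s Ns s2]; first exact: (subgroupJ sN).
  by rewrite -conjXg t2 conj1g.
have -> : t ^ g * s = (t * s ^ g^-1) ^ g by rewrite conjMg conjgKV.
rewrite -conjXg tP ?conj1g//; last by rewrite -conjXg s2 conj1g.
by apply: (subgroupJ sN) => //; exact: (subgroupV sN).
Qed.

Lemma strong_invol_commJ t s : Y t -> N s -> s ^+ 2 = 1 -> commute t (t ^ s).
Proof.
move=> [Nt t2 tP] Ns s2; have [_ h _] := invol_order4 t2 s2 (tP s Ns s2).
by apply: (commute_Ml (x := t^-1)); [cm|rewrite -commgEl; exact: commute_sym].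
Qed.

Lemma strong_involM t t' : Y t -> Y t' -> commute t t' -> Y (t * t').
Proof.
move=> Yt Yt' tt'; have [Nt t2 tP] := Yt; have [Nt' t'2 t'P] := Yt'.
split=> [||s Ns s2]; first exact: (subgroupM sN).
  by rewrite expgMn// t2 t'2 mulg1.
have [_ ts2 _] := strong_involJ Ns Yt; have [_ t's2 _] := strong_involJ Ns Yt'.
have c1 := strong_invol_commJ Yt Ns s2; have c2 := strong_invol_commJ Yt' Ns s2.
have c3 : commute (t ^ s) (t' ^ s) by apply/commute_conj.
have NJ g : N g -> N (g ^ s) by move=> Ng; exact: (subgroupJ sN).
apply: order8; first by apply: (subgroupM sN) => //; exact: (subgroupM sN).
rewrite (expgnA _ 2 4).
have -> : (t * t' * s) ^+ 2 = (t * t' ^ s) * (t' * t ^ s).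
  have -> : (t * t' * s) ^+ 2 = t * t' * (t ^ s * t' ^ s).
    by rewrite -conjMg expg2 /conjg (invol_inv s2) !mulgA.
  move: (t ^ s) (t' ^ s) c1 c2 c3 => a a' _ c2 c3.
  by rewrite -!mulgA c3 (mulgA t') c2 -mulgA.
rewrite expgMn; last by cm.
rewrite tP; [|exact: NJ|exact: t's2]; rewrite t'P ?mulg1//; exact: NJ.
Qed.

Lemma strong_involR t s : Y t -> N s -> s ^+ 2 = 1 -> Y [~ t, s].
Proof.
move=> Yt Ns s2; have [_ /invol_inv tV _] := Yt.
rewrite commgEl tV; apply: strong_involM => //; first exact: strong_involJ.
exact: strong_invol_commJ.
Qed.

Lemma strong_invol_comm t s : Y t -> Y s ->
  [/\ Y [~ t, s], commute [~ t, s] t, commute [~ t, s] s & [~ t, s] = [~ s, t]].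
Proof.
move=> Yt [Ns s2 _]; have YR := strong_involR Yt Ns s2.
have [Nt t2 tP] := Yt; have [_ h1 h2] := invol_order4 t2 s2 (tP s Ns s2).
by split=> //; have [_ /invol_inv e _] := YR; rewrite -e invgR.
Qed.

(** As [y1 * y2] is in [Y], its commutator [[~ y1, c] ^ y2 * [~ y2, c]] has square 1, and so have
    both factors, which therefore commute. Comparing the expansions of [[~ x1 * x2, b]] and
    [[~ x2 * x1, b]] then gives the symmetry that takes the place of the Jacobi identity. *)
Lemma strong_invol_pair x1 x2 b : Y x1 -> Y x2 -> Y b -> commute x1 x2 ->
  [/\ [~ x1, b, x2] = [~ x2, b, x1], commute [~ x1, b] [~ x2, b] &
      [/\ commute [~ x1, b, x2] x1, commute [~ x1, b, x2] x2 & commute [~ x1, b, x2] b]].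
Proof.
have H y1 y2 c : Y y1 -> Y y2 -> Y c -> commute y1 y2 ->
    commute ([~ y1, c] ^ y2) [~ y2, c] /\ commute [~ y1, c] [~ y2, c].
  move=> Y1 Y2 Yc c12.
  have [YR1 _ _ _] := strong_invol_comm Y1 Yc; have [YR2 h2 _ _] := strong_invol_comm Y2 Yc.
  have [N2 _ _] := Y2.
  have h : commute ([~ y1, c] ^ y2) [~ y2, c].
    have [_ e1 _] := strong_involJ N2 YR1; have [_ e2 _] := YR2.
    have [[_ e3 _] _ _ _] := strong_invol_comm (strong_involM Y1 Y2 c12) Yc.
    by apply: invol_prod_commute; rewrite -?commgM.
  split=> //; apply/(commute_conj _ _ y2).
  by rewrite (commuteJE [~ y2, c] y2).1.
move=> Y1 Y2 Yb c12; have c21 := commute_sym c12.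
have [h1 h3] := H _ _ _ Y1 Y2 Yb c12; have [h2 _] := H _ _ _ Y2 Y1 Yb c21.
have [YR1 a1 a2 _] := strong_invol_comm Y1 Yb; have [YR2 b1 b2 _] := strong_invol_comm Y2 Yb.
have [_ s1 s2 _] := strong_invol_comm YR1 Y2; have [_ s3 s4 _] := strong_invol_comm YR2 Y1.
have e : [~ x1, b, x2] = [~ x2, b, x1].
  have : [~ x1, b] ^ x2 * [~ x2, b] = [~ x2, b] ^ x1 * [~ x1, b] by rewrite -!commgM c12.
  have k1 : commute [~ x1, b, x2] [~ x2, b].
    by rewrite (commgEl [~ x1, b]); apply: commute_sym; apply: commuteM; cm.
  have k2 : commute [~ x2, b, x1] [~ x1, b].
    by rewrite (commgEl [~ x2, b]); apply: commute_sym; apply: commuteM; cm.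
  rewrite (conjgR [~ x1, b]) (conjgR [~ x2, b]); move: h3 k1 k2.
  move: [~ x1, b] [~ x2, b] [~ x1, b, x2] [~ x2, b, x1] => d1 d2 z1 z2 h3' k1 k2.
  by rewrite -!mulgA k1 k2 !mulgA h3' => /mulgI.
split=> //; split=> //; first by rewrite e.
apply/commuteJE; rewrite conjRg (commuteJE [~ x1, b] b).1// (conjgR x2) commgMr.
by rewrite (commuteRE _ _).1 // mul1g; apply/commuteJE; cm.
Qed.

Lemma strong_invol_killed c u v : Y c -> Y u -> Y v -> commute c v ->
  [/\ [~ c, u, v] = [~ c, [~ u, v]], commute [~ c, u, v] c, commute [~ c, u, v] u &
      commute [~ c, u, v] v].
Proof.
move=> Yc Yu Yv cv; have [e _ [h1 h2 h3]] := strong_invol_pair Yc Yv Yu cv.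
split=> //; have [YR _ _ e'] := strong_invol_comm Yv Yu.
by rewrite e; have [_ _ _ ->] := strong_invol_comm YR Yc; rewrite e'.
Qed.

(** The word [[~ a, b, c, a]] equals [[~ a, c, [~ a, b]]], which commutes with [a] and [c], and is
    the inverse of [[~ a, b, [~ a, c]]], which commutes with [b]. Hence class at most 4. *)
Lemma strong_invol_nilpotent3 x y z : Y x -> Y y -> Y z ->
  nilpotent (generated [set` [:: x; y; z]]).
Proof.
move=> Yx Yy Yz; set A := [set` _]; apply: (@nilpotent_generated _ _ 4).
have AY a : A a -> Y a by rewrite /A /= !inE => /or3P[]/eqP ->.
have W4 a b c : Y a -> Y b -> Y c -> [/\ commute [~ a, b, c, a] a,
    commute [~ a, b, c, a] b & commute [~ a, b, c, a] c].
  move=> Ya Yb Yc; have [YR1 h1 _ _] := strong_invol_comm Ya Yb.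
  have [YR2 h2 _ _] := strong_invol_comm Ya Yc.
  have [e1 _ [k1 k2 k3]] := strong_invol_pair Ya YR1 Yc (commute_sym h1).
  have [e2 _ [k4 k5 k6]] := strong_invol_pair Ya YR2 Yb (commute_sym h2).
  rewrite -e1; split=> //; rewrite -(invgR [~ a, b]).
  by apply: commute_sym; apply: commuteV; exact: commute_sym.
have W a b c d e : A a -> A b -> A c -> A d -> A e -> commute [~ a, b, c, d] e.
  move=> Aa Ab Ac Ad Ae; have [Ya Yb Yc] := And3 (AY a Aa) (AY b Ab) (AY c Ac).
  have [YR h1 h2 eR] := strong_invol_comm Ya Yb; have [_ h3 h4 _] := strong_invol_comm YR Yc.
  have triv g : g = 1 -> commute g e by move=> ->; exact/commute_sym/commute1.
  have [eab|/eqP ab] := eqVneq a b; first by apply: triv; rewrite eab commgg !comm1g.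
  have [eca|/eqP ca] := eqVneq c a; first by apply: triv; rewrite eca ((commuteRE _ _).1 h1) comm1g.
  have [ecb|/eqP cb] := eqVneq c b; first by apply: triv; rewrite ecb ((commuteRE _ _).1 h2) comm1g.
  have abc f : A f -> [\/ f = a, f = b | f = c].
    move: Aa Ab Ac ab ca cb; rewrite /A /= !inE.
    move=> /or3P[]/eqP Ea /or3P[]/eqP Eb /or3P[]/eqP Ec ab ca cb /or3P[]/eqP Ef.
    all: try first [by case: ab; rewrite Ea Eb | by case: ca; rewrite Ec Ea | by case: cb; rewrite Ec Eb
      | by constructor 1; rewrite Ef Ea | by constructor 2; rewrite Ef Eb
      | by constructor 3; rewrite Ef Ec].
  have [w1 w2 w3] := W4 a b c Ya Yb Yc; have [w4 w5 w6] := W4 b a c Yb Ya Yc.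
  have [->|->|->] := abc d Ad; last by apply: triv; exact/commuteRE.
    by have [->|->|->] := abc e Ae.
  by rewrite eR; have [->|->|->] := abc e Ae.
move=> a Aa; apply: upper_central_letters; first exact: sub_generated.
move=> [|b [|c [|d [|e [|//]]]]] // _ wA /=.
have [Ab Ac Ad Ae] : [/\ A b, A c, A d & A e].
  by split; apply: wA; rewrite /= !inE eqxx ?orbT.
by apply/commuteRE; exact: W.
Qed.

Lemma strong_invol_torsion3 x y z : Y x -> Y y -> Y z ->
  forall g, generated [set` [:: x; y; z]] g -> g ^+ 4 = 1.
Proof.
move=> Yx Yy Yz g Ag.
have AY : [set` [:: x; y; z]] `<=` Y by move=> a; rewrite /= !inE => /or3P[]/eqP ->.
apply: (sandwich_torsion sX); first by exists 2%N.
  by apply: generated_sub Ag => a /AY[].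
apply: (nilpotent_ptorsion (k := 1) (strong_invol_nilpotent3 Yx Yy Yz)) => // a /AY[_].
by rewrite expn1.
Qed.

(** For [q = 4] the norm is (j - 1)^3, taken at j = u1 u2 u3. The commutation hypotheses and
    [strong_invol_killed] leave only the prefixes of the word in question, and of these only the
    full word has odd multiplicity. *)
Lemma strong_invol_killed3 c u1 u2 u3 : Y c -> Y u1 -> Y u2 -> Y u3 ->
  commute c u2 -> commute c u3 -> commute [~ c, u1] u3 -> [~ c, u1, u2, u3] = 1.
Proof.
move=> Yc Y1 Y2 Y3 c2 c3 c13.
have [Yc1 a1 a2 _] := strong_invol_comm Yc Y1.
have [Yc2 b1 b2 _] := strong_invol_comm Yc1 Y2.
have [Yn d1 d2 _] := strong_invol_comm Yc2 Y3.
have [Yw _ _ _] := strong_invol_comm Y2 Y3.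
have [_ e1 e2 e3] := strong_invol_killed Yc Y1 Y2 c2.
have [en f1 f2 f3] := strong_invol_killed Yc1 Y2 Y3 c13.
have cw : commute c [~ u2, u3] by cm.
have [_ g1 g2 g3] := strong_invol_killed Yc Y1 Yw cw.
rewrite -en in g1 g2 g3.
suff: eval c [:: u1; u2; u3] [:: [:: 0; 1; 2]]%N = 1 by rewrite /eval big_seq1.
apply: (@finite_norm_relation _ c [:: u1; u2; u3] [:: [::]; [:: 0]; [:: 0; 1]; [:: 0; 1; 2]]%N 2 4 [:: 0; 1; 2]%N) => //.
- move=> w i; rewrite !inE => /or4P[]/eqP->; case: i => [|[|[|//]]] _ //= _; exact/commuteRE.
- by move=> w w'; rewrite !inE => /or4P[]/eqP-> /or4P[]/eqP->; rewrite /act /=; cm.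
- have Y2' y : Y y -> y ^+ 2 = 1 by case.
  by move=> w; rewrite !inE => /or4P[]/eqP->; apply: Y2'.
- by apply: (strong_invol_torsion3 Y1 Y2 Y3); exact: prod_letters_generated.
- apply: order8; apply: (subgroupM sN); last by case: Yc.
  apply: (@generated_sub _ [set` [:: u1; u2; u3]]); last exact: prod_letters_generated.
  by move=> z; rewrite /= !inE => /or3P[]/eqP->; [case: Y1|case: Y2|case: Y3].
Qed.
End Involutions.

(** * Subsets of the letters in lexicographic order *)

Section BinaryValue.
Implicit Types b g t : bitseq.

(** The most significant bit comes first, so for equal lengths the numerical order is the
    lexicographic one. *)
Fixpoint bval b := if b is x :: b' then (x * 2 ^ size b' + bval b')%N else 0%N.

Lemma bval_lt b : (bval b < 2 ^ size b)%N.
Proof. by elim: b => [//|[] b IH] /=; rewrite expnS; lia. Qed.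

Lemma bval_cat b t : bval (b ++ t) = (bval b * 2 ^ size t + bval t)%N.
Proof. by elim: b => [//|x b IH] /=; rewrite IH size_cat expnD; lia. Qed.

Lemma bval_nseq k : bval (nseq k false) = 0%N.
Proof. by elim: k. Qed.

Lemma bval_inj b t : size b = size t -> bval b = bval t -> b = t.
Proof.
elim: b t => [[]//|x b IH] [//|y t] /= [st].
have := bval_lt b; have := bval_lt t; rewrite st.
by case: x; case: y => lb lt e; try lia; congr (_ :: _); apply: IH => //; lia.
Qed.

Lemma bval_last_true b : bval b <> 0%N -> exists g k, b = g ++ true :: nseq k false.
Proof.
elim/last_ind: b => [//|b x IH] h; case: x h => h; first by exists b, 0%N; rewrite cats1.
have [|g [k ->]] := IH; first by move=> b0; apply: h; rewrite -cats1 bval_cat b0.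
exists g, k.+1; rewrite rcons_cat /=; congr (g ++ true :: _).
by elim: k {IH h} => //= k ->.
Qed.

Lemma bval_prefix g k b : size b = (size g + k.+1)%N ->
  (bval g * 2 ^ k.+1 <= bval b < bval g * 2 ^ k.+1 + 2 ^ k)%N ->
  exists t, b = g ++ false :: t.
Proof.
move=> sb; have sd : size (drop (size g) b) = k.+1 by rewrite size_drop sb addKn.
have st : size (take (size g) b) = size g by rewrite size_takel// sb leq_addr.
have := cat_take_drop (size g) b; move: (take _ b) st (drop _ b) sd => a sa.
case=> [//|x t] [sk] <- {sb}; rewrite bval_cat /= sk expnS.
have := bval_lt t; rewrite sk; set K := (2 ^ k)%N => tK H.
have e : bval a = bval g by case: x H => H; nia.
exists t; congr (_ ++ _); first exact: bval_inj.
by case: x H => // H; nia.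
Qed.
End BinaryValue.

Section Scan.
Variable G : groupType.
Implicit Types (n v c y : G) (l : seq G) (b : bitseq).
Local Notation word := (foldl (@commg G)).

(** Greedily takes each letter whose commutator is nontrivial. By [word_scan_neq1] and
    [word_scan_gt] this is the lexicographically greatest mask with a nontrivial word. *)
Fixpoint scan n l : bitseq :=
  if l is v :: l' then
    if [~ n, v] == 1 then false :: scan n l' else true :: scan [~ n, v] l'
  else [::].

Lemma size_scan n l : size (scan n l) = size l.
Proof. by elim: l n => [//|v l IH] n /=; case: eqP => _ /=; rewrite IH. Qed.

Lemma word1 l : word 1 l = 1.
Proof. by elim: l => [//|v l IH]; rewrite /= comm1g. Qed.

Lemma word_scan_neq1 n l : n <> 1 -> word n (mask (scan n l) l) <> 1.
Proof. by elim: l n => [//|v l IH] n n1 /=; case: eqP => nv; exact: IH. Qed.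

Lemma word_scan_gt n l b : size b = size l -> (bval (scan n l) < bval b)%N ->
  word n (mask b l) = 1.
Proof.
elim: l n b => [|v l IH] n [|x b] //= [sb].
have lt := bval_lt b; case: eqP => nv /=.
  by case: x => /= h; [rewrite nv word1|apply: IH => //; lia].
by rewrite size_scan -sb; case: x => h; [apply: IH => //; lia|lia].
Qed.
End Scan.

Section Core2.
Variables (G : groupType) (X : set G).
Hypothesis sX : sandwich 2 4 X.
Local Notation Y := (strong_invol X).
Local Notation word := (foldl (@commg G)).
Implicit Types (c y v w : G) (l : seq G).

Lemma strong_invol_word c y l : Y c -> Y y -> (forall v, v \in l -> Y v /\ commute c v) ->
  Y (word y l) /\ word [~ c, y] l = [~ c, word y l].
Proof.
move=> Yc; elim: l y => [//|v l IH] y Yy lP /=.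
have [Yv cv] := lP v (mem_head _ _); have [YR _ _ _] := strong_invol_comm sX Yy Yv.
have [-> _ _ _] := strong_invol_killed sX Yc Yy Yv cv.
by apply: IH => // w wl; apply: lP; rewrite inE wl orbT.
Qed.

(** A rejected letter commutes with the current word, an accepted one with the extended word. The
    first conjunct carries this through the remaining letters: by [strong_invol_killed3] a
    commutation with the current word survives its extension. *)
Lemma scan_kills c y l : Y c -> Y y -> (forall v, v \in l -> Y v /\ commute c v) ->
  let n := word [~ c, y] (mask (scan [~ c, y] l) l) in
  (forall w, Y w -> commute c w -> commute [~ c, y] w -> commute n w) /\
  forall v, v \in l -> commute n v.
Proof.
move=> Yc; elim: l y => [|v l IH] y Yy lP /=; first by split.
have [Yv cv] := lP v (mem_head _ _); have [YR _ h _] := strong_invol_comm sX Yy Yv.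
have lP' w : w \in l -> Y w /\ commute c w by move=> wl; apply: lP; rewrite inE wl orbT.
case: eqP => [/commuteRE nv|nv] /=.
  have [H1 H2] := IH y Yy lP'; split=> // w; rewrite inE => /predU1P[->|]; last exact: H2.
  exact: H1.
have [e _ _ _] := strong_invol_killed sX Yc Yy Yv cv.
have [Yn _ _ _] := strong_invol_comm sX Yc Yy; have [_ _ nvv _] := strong_invol_comm sX Yn Yv.
rewrite e; have [H1 H2] := IH [~ y, v] YR lP'; split=> [w Yw cw nw|w].
  apply: H1 => //; rewrite -e; apply/commuteRE.
  exact: (strong_invol_killed3 sX Yc Yy Yv Yw).
rewrite inE => /predU1P[->|]; last exact: H2.
by apply: H1 => //; rewrite -e.
Qed.

Variables (u : G) (h : seq G).
Hypotheses (Yu : Y u) (Yh : forall v, v \in h -> Y v).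
Hypothesis central1 : forall c, Y c -> commute c u -> (forall v, v \in h -> commute c v) -> c = 1.

(* Among the elements of Y centralizing h choose c with lexicographically minimal
   bits, and compare its bits with those of its two successors under next. *)
Lemma strong_invol_core c : Y c -> (forall v, v \in h -> commute c v) -> commute c u.
Proof.
pose node c := [/\ Y c, c <> 1 & forall v, v \in h -> commute c v].
pose bits c := scan [~ c, u] h; pose next c := word [~ c, u] (mask (bits c) h).
pose y b := word u (mask b h).
have sbits c' : size (bits c') = size h by rewrite size_scan.
have Ymask b v : v \in mask b h -> v \in h by exact: mem_mask.
have nodeE c' b : node c' -> Y (y b) /\ word [~ c', u] (mask b h) = [~ c', y b].
  move=> [Yc' _ hc']; apply: strong_invol_word => // v /Ymask vh.
  by split; [exact: Yh|exact: hc'].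
have nextE c' : node c' -> next c' = [~ c', y (bits c')] by move=> nc'; have [_] := nodeE c' (bits c') nc'.
have next_node c' : node c' -> node (next c').
  move=> nc'; have [Yc' c'1 hc'] := nc'; split.
  - by rewrite nextE//; have [Yy _] := nodeE c' (bits c') nc'; have [] := strong_invol_comm sX Yc' Yy.
  - by apply: word_scan_neq1 => /commuteRE c'u; apply: c'1; exact: central1.
  - have [|_] := @scan_kills c' u h Yc' Yu; last exact.
    by move=> v vh; split; [exact: Yh|exact: hc'].
have gt1 c' b : node c' -> size b = size h -> (bval (bits c') < bval b)%N -> [~ c', y b] = 1.
  by move=> nc' sb lt; have [_ <-] := nodeE c' b nc'; exact: word_scan_gt.
move=> Yc hc; apply: contrapT => cu.
have c1 : c <> 1 by move=> c1; apply: cu; rewrite c1; exact/commute_sym/commute1.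
have exP : exists n, `[< exists2 c', node c' & bval (bits c') = n >].
  by exists (bval (bits c)); apply/asboolP; exists c.
case: (ex_minnP exP) => _ /asboolP[{Yc hc cu c1 exP}c nc <-] cmin.
have {}cmin c' : node c' -> (bval (bits c) <= bval (bits c'))%N.
  by move=> nc'; apply: cmin; apply/asboolP; exists c'.
set c' := next c; have nc' : node c' := next_node c nc.
set c'' := next c'; have nc'' : node c'' := next_node c' nc'.
have [Yc _ hc] := nc; have [Yc' _ hc'] := nc'; have [Yc'' c''1 hc''] := nc''.
have n''1 : next c'' <> 1 by have [] := next_node c'' nc''.
have ec' : c' = [~ c, y (bits c)] by exact: nextE.
have ec'' : c'' = [~ c', y (bits c')] by exact: nextE.
have en : next c'' = [~ c'', y (bits c'')] by exact: nextE.
set b := bits c in ec' cmin; set b' := bits c' in ec''; set b'' := bits c'' in en.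
have Yy d : Y (y d) by have [] := nodeE c d nc.
(* Hence a node and its successor never have the same bits. *)
have uu d : node d -> [~ d, y (bits d), y (bits d)] = 1.
  by move=> [Yd _ _]; have [_ _ /commuteRE k _] := strong_invol_comm sX Yd (Yy (bits d)).
have bb' : b <> b' by move=> e; apply: c''1; rewrite ec'' -e ec' uu.
have b'b'' : b' <> b'' by move=> e; apply: n''1; rewrite en -e ec'' uu.
have lt : (bval b < bval b')%N.
  rewrite ltn_neqAle cmin ?andbT//; apply/eqP => e; apply: bb'; apply: bval_inj e.
  by rewrite !sbits.
have [|g [k eb']] := @bval_last_true b'; first by move=> e; rewrite e in lt.
have sh : size h = (size g + k.+1)%N by rewrite -(sbits c') -/b' eb' size_cat /= size_nseq.
(* Clearing the last set bit of [b'] splits off the last letter [v] of its word, so that [y b'] is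
   [[~ y g', v]]. *)
set g' := g ++ false :: nseq k false; have sg' : size g' = size h.
  by rewrite sh size_cat /= size_nseq.
have bg' : bval b' = (bval g' + 2 ^ k)%N.
  by rewrite eb' !bval_cat /= bval_nseq size_nseq; lia.
have [h1 [v [h2 [eh sh1 sh2]]]] : exists h1 v h2, [/\ h = h1 ++ v :: h2, size h1 = size g & size h2 = k].
  have := cat_take_drop (size g) h; have : size (drop (size g) h) = k.+1 by rewrite size_drop sh addKn.
  case: (drop _ h) => [//|v h2] [sh2] eh; exists (take (size g) h), v, h2; split=> //.
  by rewrite size_take sh -{1}(addn0 (size g)) ltn_add2l.
have vh : v \in h by rewrite eh mem_cat mem_head orbT.
have mg' : mask g' h = mask g h1 by rewrite eh mask_cat//= mask_false cats0.
have yb' : y b' = [~ y g', v].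
  by rewrite /y mg' eb' eh mask_cat//= mask_false foldl_cat.
have [ec v1 v2 _] := strong_invol_killed sX Yc' (Yy g') (Yh vh) (hc' v vh).
have {}ec'' : c'' = [~ c', y g', v] by rewrite ec'' yb' ec.
have g'1 : [~ c', y g'] <> 1 by move=> e; apply: c''1; rewrite ec'' e comm1g.
(* By maximality of [b], every [y d] with [b < d] commutes with [c]. This makes
   [strong_invol_killed3] applicable if [b < g'], and again below if [b' < b'']. *)
have [lg|lg|lg] := ltngtP (bval b) (bval g').
- apply: c''1; rewrite ec'' ec'; apply: (strong_invol_killed3 sX) => //.
  + exact: Yh.
  + by apply/commuteRE; exact: gt1.
  + exact: hc.
  + by rewrite -ec'; exact: hc'.
- have [lb|lb|lb] := ltngtP (bval b') (bval b'').
  + apply: n''1; rewrite en ec'' ec -yb' ec'; apply: (strong_invol_killed3 sX) => //.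
    * by apply/commuteRE; apply: gt1; rewrite ?sbits.
    * by apply/commuteRE; apply: gt1; rewrite ?sbits//; exact: ltn_trans lb.
    * by rewrite -ec'; apply/commuteRE; apply: gt1; rewrite ?sbits.
  (* Now [g' < b <= b'' < b'], and [b'] exceeds [g'] by [2 ^ k], so [b''] begins with [g] followed
     by 0. Its word then passes through [[~ c'', y g']], which is trivial because [c''] is
     [[~ c', y g', v]]. *)
  + have lb2 := cmin _ nc''.
    have [||t et] := @bval_prefix g k b''; first by rewrite sbits.
      move: lg lb lb2; rewrite bg' /g' bval_cat /= bval_nseq size_nseq -/b''.
      by rewrite mul0n !addn0; lia.
    have k1 : [~ c'', y g'] = 1 by apply/commuteRE; rewrite ec''.
    apply: n''1; rewrite /next -/b'' et eh mask_cat//= foldl_cat -mg'.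
    by have [_ ->] := nodeE c'' g' nc''; rewrite k1 word1.
  + by apply: b'b''; apply: bval_inj lb; rewrite !sbits.
- have e : b = g' by apply: bval_inj lg; rewrite sbits sg'.
  by apply: g'1; rewrite -e ec' uu.
Qed.
End Core2.

Lemma nilpotent_rank2 r : nilpotent_rank 2 4 r.
Proof.
elim: r => [|r IH]; first exact: nilpotent_rank0.
apply: core_nilpotent; first by exists 2%N.
apply: centralizing_core IH _ => G X u h sX Xu Xh _ gen ZG.
have XY := @sub_strong_invol _ _ sX.
exists (strong_invol X); split=> //.
- by move=> x y Yx Yy; have [] := strong_invol_comm sX Yx Yy.
- by move=> y [_ y2 _]; exists 1%N; rewrite expn1.
- apply: (strong_invol_core sX) => [|v /Xh|c [_ c2 _] cu ch]; try exact: XY.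
  by apply: ZG; [exact: (central_cons gen)|exists 1%N; rewrite expn1].
Qed.

(** * Exponent 5 *)

Section Symmetry.
Variables (T : eqType) (R : Type) (P : pred T) (Phi : seq T -> R).
Hypothesis swap : forall l1 a b l2, all P (l1 ++ a :: b :: l2) ->
  Phi (l1 ++ a :: b :: l2) = Phi (l1 ++ b :: a :: l2).

Lemma perm_eq_swap l l' : all P l -> perm_eq l l' -> Phi l = Phi l'.
Proof.
have bubble x s1 s2 pre : all P (pre ++ s1 ++ x :: s2) ->
    Phi (pre ++ s1 ++ x :: s2) = Phi (pre ++ x :: s1 ++ s2).
  elim: s1 pre => [//|y s1 IH] pre Pl.
  rewrite -(cat_rcons y pre) IH; last by rewrite cat_rcons.
  rewrite cat_rcons swap//; move: Pl; rewrite /= !all_cat /= !all_cat /=.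
  by case: (P x); case: (P y); rewrite ?andbF ?andbT.
suff H pre : all P (pre ++ l) -> perm_eq l l' -> Phi (pre ++ l) = Phi (pre ++ l').
  by move=> Pl; exact: (H [::]).
elim: l l' pre => [|x l IH] l' pre Pl e.
  by have := perm_size e => /esym/size0nil ->.
have xl' : x \in l' by rewrite -(perm_mem e) mem_head.
have [s1 [s2 el']] : exists s1 s2, l' = s1 ++ x :: s2 by case/splitPr: xl' => s1 s2; exists s1, s2.
rewrite el' in e *; have Pl' : all P (pre ++ s1 ++ x :: s2).
  by move: Pl; rewrite !(all_cat _ pre) (perm_all _ e).
rewrite bubble// -!(cat_rcons x pre) (IH (s1 ++ s2)) ?cat_rcons//.
by rewrite -(perm_cons x) (perm_trans e)// -[x :: s2]cat1s perm_catCA.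
Qed.
End Symmetry.

Section Core5.
Variables (G : groupType) (X : set G).
Hypotheses (sX : sandwich 5 5 X) (XR : forall x y, X x -> X y -> X [~ x, y]).
Local Notation word := (foldl (@commg G)).
Let o5 : odd 5 := isT.
Variables (c : G) (Xc : X c).
Implicit Types (f g u v : G) (l : seq G).

(* The vectors form an F_5-space on which a killer [v] acts through the
   operator [f |-> [~ f, v]]; the lemmas on words below are identities between
   such operators. *)
Definition killer v : Prop := X v /\ commute c v.
Definition vector f : Prop := exists2 w, X w & f = [~ c, w].

Lemma vector_sub f : vector f -> X f. Proof. by case=> w Xw ->; exact: XR. Qed.

Lemma vector_exp f : vector f -> f ^+ 5 = 1.
Proof. by move=> /vector_sub; exact: (sandwich_exp sX). Qed.

Lemma vectorC f g : vector f -> vector g -> commute f g.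
Proof.
move=> [w Xw ->] [w' Xw' ->]; rewrite -(invgR w c); apply: commute_sym; apply: commuteV.
by apply: commute_sym; exact: (sandwich_comm2 o5 sX).
Qed.

Lemma vectorR f v : vector f -> killer v -> vector [~ f, v].
Proof.
move=> [w Xw ->] [Xv cv]; exists [~ w, v]; first exact: XR.
exact: (sandwich_comm_killed o5 sX).
Qed.

Lemma killer1 : killer 1.
Proof. by split; [rewrite -(commgg c); exact: XR|exact: commute1]. Qed.

Lemma killerR v w : killer v -> killer w -> killer [~ v, w].
Proof. by move=> [Xv cv] [Xw cw]; split; [exact: XR|exact: commuteR]. Qed.

Lemma vector_word f l : vector f -> {in l, forall v, killer v} -> vector (word f l).
Proof.
elim: l f => [//|v l IH] f Vf kl /=; apply: IH => [|w wl].
  by apply: vectorR => //; apply: kl; rewrite mem_head.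
by apply: kl; rewrite inE wl orbT.
Qed.

Lemma word_prod (s : seq G) l : {in s, forall f, vector f} -> {in l, forall v, killer v} ->
  word (\prod_(f <- s) f) l = \prod_(f <- s) word f l.
Proof.
elim: l s => [//|v l IH] s Vs kl.
have kv : killer v by apply: kl; rewrite mem_head.
have -> : word (\prod_(f <- s) f) (v :: l) = word (\prod_(f <- map (fun f => [~ f, v]) s) f) l.
  congr (word _ l); rewrite big_map; elim: s Vs {IH} => [|f s IH] Vs.
    by rewrite !big_nil comm1g.
  have Vf : vector f by apply: Vs; rewrite mem_head.
  have {}Vs : {in s, forall f, vector f} by move=> g gs; apply: Vs; rewrite inE gs orbT.
  rewrite !big_cons commgM IH//; congr (_ * _); apply/commuteJE.
  rewrite big_seq; apply: commute_prod => g gs.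
  by apply: vectorC; [exact: vectorR|exact: Vs].
rewrite IH ?big_map// => [_ /mapP[f /Vs Vf ->]|w wl]; first exact: vectorR.
by apply: kl; rewrite inE wl orbT.
Qed.

(** The operator form of [sandwich_Jacobi]. The correction term has one letter less, which is what
    the symmetry arguments by induction on the length exploit. *)
Lemma word_swap f l1 v w l2 : vector f -> {in l1 ++ v :: w :: l2, forall v, killer v} ->
  word f (l1 ++ v :: w :: l2) = word f (l1 ++ w :: v :: l2) * word f (l1 ++ [~ v, w] :: l2).
Proof.
move=> Vf kl; have kl1 : {in l1, forall v, killer v} by move=> x xl; apply: kl; rewrite mem_cat xl.
have [kv kw] : killer v /\ killer w by split; apply: kl; rewrite mem_cat !inE eqxx ?orbT.
have kl2 : {in l2, forall v, killer v} by move=> x xl; apply: kl; rewrite mem_cat !inE xl !orbT.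
rewrite !foldl_cat /=; have := vector_word Vf kl1; move: (word f l1) => g Vg.
have := @word_prod [:: [~ g, w, v]; [~ g, [~ v, w]]] l2.
rewrite !big_cons !big_nil !mulg1 => <-//; last first.
  move=> x; rewrite !inE => /orP[]/eqP->; first by do 2 apply: vectorR => //.
  by apply: vectorR => //; exact: killerR.
by rewrite (sandwich_Jacobi o5 sX)//; [exact: vector_sub|case: kv|case: kw].
Qed.

Lemma killed1 f v : vector f -> killer v -> [~ f, v, v] = 1.
Proof.
by move=> Vf [Xv _]; apply/commuteRE; apply: (sandwich_commr sX) => //; exact: vector_sub.
Qed.

Lemma killed2 f v w : vector f -> killer v -> killer w -> [~ f, v, w, v] = 1.
Proof.
move=> Vf [Xv _] [Xw _]; apply/commuteRE.
by have [] := sandwich_class3 o5 sX (vector_sub Vf) Xv Xw.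
Qed.

Lemma swap4 f v w1 w2 : vector f -> killer v -> killer w1 -> killer w2 ->
  [~ f, v, w1, w2, v] = [~ f, v, w2, w1, v].
Proof.
move=> Vf kv k1 k2; have := @word_swap f [:: v] w1 w2 [:: v] Vf.
rewrite /= killed2 ?mulg1//; first apply; last exact: killerR.
by move=> x; rewrite !inE => /or4P[]/eqP->.
Qed.

Lemma killer_nth (a : seq G) i : {in a, forall v, killer v} -> killer (nth 1 a i).
Proof.
by move=> ka; have [ia|ai] := ltnP i (size a); [apply/ka/mem_nth|rewrite nth_default//; exact: killer1].
Qed.

Lemma vector_act f (a : seq G) (w : seq nat) : vector f -> {in a, forall v, killer v} -> vector (act f a w).
Proof.
move=> Vf ka; elim/last_ind: w => [//|w i IH]; rewrite act_rcons.
by apply: vectorR => //; exact: killer_nth.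
Qed.

Lemma act_near2 f (a : seq G) (w : seq nat) i : vector f -> {in a, forall v, killer v} ->
  i \in take 2 (rev w) -> act f a (rcons w i) = 1.
Proof.
move=> Vf ka; case/lastP: w => [//|w j]; rewrite rev_rcons /= inE => /predU1P[->|].
  by rewrite !act_rcons killed1//; [exact: vector_act|exact: killer_nth].
case/lastP: w => [//|w k]; rewrite rev_rcons /= take0 inE => /eqP->.
rewrite !act_rcons killed2//; first exact: vector_act.
all: exact: killer_nth.
Qed.

(** The words in three letters without a repetition at distance 1 or 2, up to length 4. A word x y z
    x could only continue with y; but it equals x z y x by [swap4], and y x y vanishes. *)
Definition words3 : seq (seq nat) :=
  [:: [::]; [:: 0]; [:: 1]; [:: 2]; [:: 0; 1]; [:: 0; 2]; [:: 1; 0]; [:: 1; 2]; [:: 2; 0]; [:: 2; 1];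
   [:: 0; 1; 2]; [:: 0; 2; 1]; [:: 1; 0; 2]; [:: 1; 2; 0]; [:: 2; 0; 1]; [:: 2; 1; 0];
   [:: 0; 1; 2; 0]; [:: 0; 2; 1; 0]; [:: 1; 0; 2; 1]; [:: 1; 2; 0; 1]; [:: 2; 0; 1; 2];
   [:: 2; 1; 0; 2]]%N.

Lemma killed3_relation f v w1 w2 js Q : vector f -> killer v -> killer w1 -> killer w2 ->
  (let P := norm_words (predC [in words3]) js 5 in [&& uniq words3, all [in words3] P, all [in words3] Q &
    all (fun k => count_mem k P == count_mem k Q %[mod 5]) words3]) ->
  eval f [:: v; w1; w2] Q = 1.
Proof.
move=> Vf kv k1 k2; set a := [:: v; w1; w2].
have ka : {in a, forall x, killer x} by move=> x; rewrite !inE => /or3P[]/eqP->.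
have aX : [set` a] `<=` X by move=> x /ka[].
apply: finite_norm_relation => //.
- move=> w i wL ia iL; have [near|far] := boolP (i \in take 2 (rev w)); first exact: act_near2.
  have : all (fun w => all (fun i => [|| i \in take 2 (rev w), rcons w i \in words3 |
      (size w == 4) && (i == nth 0 w 1)%N]) (iota 0 3)) words3 by [].
  move=> /allP/(_ _ wL)/allP/(_ i); rewrite mem_iota ia (negbTE far) (negbTE iL) => /(_ isT) /=.
  move=> /andP[+ /eqP->]; have : all (fun w => (size w == 4) ==> (nth 0 w 0 == nth 0 w 3)%N) words3 by [].
  move=> /allP/(_ _ wL); case: w {wL far iL} => [|x [|y [|z [|x' [|]]]]] //= /eqP <- _.
  rewrite /act /= swap4 ?killed2 ?comm1g//; do ?[exact: killer_nth].
  by apply: vectorR => //; exact: killer_nth.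
- by move=> w w' _ _; apply: vectorC; exact: vector_act.
- by move=> w _; apply: vector_exp; exact: vector_act.
- case: kv k1 k2 => [Xv _] [X1 _] [X2 _].
  apply: (sandwich_torsion3 o5 (ex_intro _ 1%N erefl) sX Xv X1 X2).
  exact: prod_letters_generated.
- apply: (sandwich_order sX); apply: (subgroupM (generated_subgroup X)).
    by apply: (@generatedS _ [set` a]); last exact: prod_letters_generated.
  by apply: sub_generated; exact: vector_sub.
Qed.

(* Writing a, b, d for the operators of v, w1, w2, the norm relations for
   v * w1 * w2 and for v ^+ 2 * w1 * w2 read 2(abda + bdab + dabd) = 0 and
   8 abda + 4 bdab + 4 dabd = 0. *)
Lemma killed3 f v w1 w2 : vector f -> killer v -> killer w1 -> killer w2 ->
  [~ f, v, w1, w2, v] = 1.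
Proof.
move=> Vf kv k1 k2.
have := @killed3_relation f v w1 w2 [:: 0; 1; 2]%N [:: [:: 0; 1; 2; 0]; [:: 0; 2; 1; 0]; [:: 1; 0; 2; 1];
  [:: 1; 2; 0; 1]; [:: 2; 0; 1; 2]; [:: 2; 1; 0; 2]]%N Vf kv k1 k2 isT.
have := @killed3_relation f v w1 w2 [:: 0; 0; 1; 2]%N
  (flatten [:: nseq 4 [:: 0; 1; 2; 0]; nseq 4 [:: 0; 2; 1; 0]; nseq 2 [:: 1; 0; 2; 1];
  nseq 2 [:: 1; 2; 0; 1]; nseq 2 [:: 2; 0; 1; 2]; nseq 2 [:: 2; 1; 0; 2]])%N Vf kv k1 k2 isT.
rewrite /eval !big_cons !big_nil /act /= !mulg1.
rewrite (swap4 Vf kv k2 k1) (swap4 Vf k1 k2 kv) (swap4 Vf k2 k1 kv).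
have Vw x y z t : killer x -> killer y -> killer z -> killer t -> vector [~ f, x, y, z, t].
  by move=> kx ky kz kt; do 4 apply: vectorR => //.
have := vectorC (Vw v w1 w2 v kv k1 k2 kv) (Vw w1 v w2 w1 k1 kv k2 k1).
have := vectorC (Vw v w1 w2 v kv k1 k2 kv) (Vw w2 v w1 w2 k2 kv k1 k2).
have := vectorC (Vw w1 v w2 w1 k1 kv k2 k1) (Vw w2 v w1 w2 k2 kv k1 k2).
have := vector_exp (Vw v w1 w2 v kv k1 k2 kv).
move: [~ f, v, w1, w2, v] [~ f, w1, v, w2, w1] [~ f, w2, v, w1, w2] => x y z x5 yz xz xy R2 R1.
apply: (odd_exp4_eq1 o5 x5).
have cXY n : commute (x ^+ n) (y ^+ 2 * z ^+ 2).
  by apply: commute_sym; apply: commuteX; apply: commute_sym; apply: commuteM; apply: commuteX.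
have {}R1 : x ^+ 2 * (y ^+ 2 * z ^+ 2) = 1 by rewrite -R1 !expg2 !mulgA.
(* The second relation is [x ^+ 4] times the square of the first. *)
have {R2} : x ^+ 4 * (x ^+ 2 * (y ^+ 2 * z ^+ 2)) ^+ 2 = 1.
  rewrite (expgMn 2 (cXY 2)) (expgMn 2 (commuteX2 2 2 yz)) -!expgnA mulgA -expgnDr -R2.
  by rewrite !expgS expg0 !mulg1 !mulgA.
by rewrite R1 expg1n mulg1.
Qed.

Lemma act_near3 f (a : seq G) (w : seq nat) i : vector f -> {in a, forall v, killer v} ->
  i \in take 3 (rev w) -> act f a (rcons w i) = 1.
Proof.
move=> Vf ka; case/lastP: w => [//|w j]; rewrite rev_rcons /= inE => /predU1P[->|].
  by rewrite !act_rcons killed1//; [exact: vector_act|exact: killer_nth].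
case/lastP: w => [//|w k]; rewrite rev_rcons /= inE => /predU1P[->|].
  by rewrite !act_rcons killed2//; [exact: vector_act|exact: killer_nth|exact: killer_nth].
case/lastP: w => [//|w l]; rewrite rev_rcons /= take0 inE => /eqP->.
by rewrite !act_rcons killed3//; [exact: vector_act|..]; exact: killer_nth.
Qed.

Lemma act_map f (a : seq G) (s : seq nat) : act f a s = word f (map (nth 1 a) s).
Proof. by rewrite /act; elim: s f => [//|i s IH] f /=. Qed.

Lemma commute_word e f l : commute e f -> {in l, forall v, commute e v} -> commute e (word f l).
Proof.
elim: l f => [//|v l IH] f ef el /=; apply: IH => [|w wl].
  by apply: commuteR => //; apply: el; rewrite mem_head.
by apply: el; rewrite inE wl orbT.
Qed.

Section Terminal.
Variables (u : G) (Xu : X u).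
Let c1 := [~ c, u].

Lemma vector1 : vector c1. Proof. by exists u. Qed.

(* The obstructions [~ word c1 l, u] to terminality are symmetric in [l] as soon
   as the shorter ones vanish: exchanging two adjacent letters changes the word
   by one in which both are replaced by their commutator. *)
Definition terminal n := forall l, size l = n -> {in l, forall v, killer v} ->
  commute (word c1 l) u.

Lemma terminal0 : terminal 0.
Proof. by move=> l /size0nil -> _; exact: (sandwich_commr sX). Qed.

Lemma terminal1 : terminal 1.
Proof.
move=> [|v [|//]] // _ kl; have [Xv _] : killer v by apply: kl; rewrite mem_head.
by have [] := sandwich_class3 o5 sX Xc Xu Xv.
Qed.

Lemma word1_sub l : {in l, forall v, killer v} -> X (word c1 l).
Proof. by move=> kl; apply: vector_sub; exact: vector_word vector1 kl. Qed.

Lemma terminal_perm n l l' : terminal n -> size l = n.+1 -> {in l, forall v, killer v} ->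
  perm_eq l l' -> [~ word c1 l, u] = [~ word c1 l', u].
Proof.
move=> tn sl kl ll'; have sl' := perm_size ll'.
pose Phi l := if size l == n.+1 then [~ word c1 l, u] else 1.
have -> : [~ word c1 l, u] = Phi l by rewrite /Phi sl eqxx.
have -> : [~ word c1 l', u] = Phi l' by rewrite /Phi -sl' sl eqxx.
apply: (@perm_eq_swap _ _ (fun v => `[< killer v >])) ll'; last first.
  by apply/allP => v /kl kv; exact/asboolP.
move=> l1 v w l2 /allP k; have {}k : {in l1 ++ v :: w :: l2, forall v, killer v}.
  by move=> x /k/asboolP.
rewrite /Phi !size_cat /=; case: eqP => // /eqP; rewrite !addnS eqSS => /eqP sn.
rewrite (word_swap vector1 k); set x := word c1 (l1 ++ w :: v :: l2); set y := word _ _.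
have kx : {in l1 ++ w :: v :: l2, forall v, killer v}.
  by move=> z zl; apply: k; move: zl; rewrite !mem_cat !inE (orbCA (z == w)).
have ky : {in l1 ++ [~ v, w] :: l2, forall v, killer v}.
  move=> z; rewrite mem_cat inE => /or3P[zl|/eqP->|zl]; first by apply: k; rewrite mem_cat zl.
    by apply: killerR; apply: k; rewrite mem_cat !inE eqxx ?orbT.
  by apply: k; rewrite mem_cat !inE zl !orbT.
have uy : commute y u by apply: tn => //; rewrite size_cat /= addnS.
have xy : commute x y by apply: vectorC; exact: vector_word vector1 _.
(* It remains that [y] fixes [[~ x, u]]. The conjugate [[~ x, u] ^ y] is [[~ x * y, u]]; it commutes
   with [x * y] and with [x], hence with [y]. *)
have h : commute [~ x, u] x by apply: (sandwich_comm sX) => //; exact: word1_sub.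
have h' : commute [~ x * y, u] (x * y).
  by rewrite -(word_swap vector1 k); apply: (sandwich_comm sX) => //; exact: word1_sub.
move: h'; rewrite commgM (commuteRE y u).1// mulg1 => h'.
have : commute ([~ x, u] ^ y) (x ^ y) by apply/commute_conj.
rewrite (commuteJE x y).1// => h2.
apply/commuteJE/(commute_conj _ _ y); rewrite (commuteJE y y).1; last exact: commute_refl.
exact: commute_Ml h2 h'.
Qed.

(** Written as [[~ c, w, u]], the obstruction commutes with [c] and [u]. By symmetry any letter [v]
    of [l] may be put last, and [sandwich_class3] applies to the shortened word, [v] and [u]. *)
Lemma terminal_central n l : terminal n -> size l = n.+1 -> {in l, forall v, killer v} ->
  let e := [~ word c1 l, u] in
  [/\ X e, commute e c, commute e u & {in l, forall v, commute e v}].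
Proof.
move=> tn sl kl e; have [w Xw ew] := vector_word vector1 kl.
split.
- by apply: XR => //; exact: word1_sub.
- by rewrite /e ew; have [] := sandwich_class3 o5 sX Xc Xw Xu.
- by rewrite /e ew; have [] := sandwich_class3 o5 sX Xc Xw Xu.
- move=> v vl; have kv := kl v vl; have p : perm_eq l (rcons (rem v l) v).
    by rewrite perm_sym perm_rcons perm_sym perm_to_rem.
  rewrite /e (terminal_perm tn sl kl p) foldl_rcons.
  have kr : {in rem v l, forall v, killer v} by move=> x /mem_rem; exact: kl.
  by have [] := sandwich_class3 o5 sX (word1_sub kr) kv.1 Xu.
Qed.

Lemma commg_prod_const (s : seq G) e : {in s, forall x, [~ x, u] = e /\ commute e x} ->
  [~ \prod_(x <- s) x, u] = e ^+ size s.
Proof.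
elim: s => [|x s IH] h; first by rewrite big_nil comm1g.
have [ex cx] := h x (mem_head _ _).
have {}h : {in s, forall x, [~ x, u] = e /\ commute e x}.
  by move=> y ys; apply: h; rewrite inE ys orbT.
rewrite big_cons commgM IH// ex /= expgS; congr (_ * _); apply/commuteJE.
by rewrite big_seq; apply: commute_prod => y /h[].
Qed.

(** For j = u v w acting on [c], the norm (j - 1)^4 leaves modulo 5 only the words u v w u and u w v
    u. They are equal by [terminal_perm], so the obstruction has square 1. *)
Lemma terminal2 : terminal 2.
Proof.
move=> [|v [|w [|//]]] // _ kl; set a := [:: u; v; w].
have [kv kw] : killer v /\ killer w by split; apply: kl; rewrite !inE eqxx ?orbT.
have [Xe ec eu el] := @terminal_central 1 [:: v; w] terminal1 erefl kl.
have [ev ew] : commute [~ c1, v, w, u] v /\ commute [~ c1, v, w, u] w.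
  by split; apply: el; rewrite !inE eqxx ?orbT.
have esym : [~ c1, w, v, u] = [~ c1, v, w, u].
  symmetry; apply: (@terminal_perm 1 [:: v; w] [:: w; v] terminal1 erefl kl).
  by apply/permP => P /=; rewrite !addn0 addnC.
have [t1v t1w] : commute [~ c1, v] u /\ commute [~ c1, w] u.
  by split; [apply: (terminal1 (l := [:: v]))|apply: (terminal1 (l := [:: w]))] => //;
    move=> x; rewrite inE => /eqP->.
have c1u : commute c1 u by exact: (sandwich_commr sX).
pose L := [:: [::]; [:: 0]; [:: 0; 1]; [:: 0; 2]; [:: 0; 1; 2]; [:: 0; 2; 1]; [:: 0; 1; 2; 0]; [:: 0; 2; 1; 0]]%N.
suff : eval c a [:: [:: 0; 1; 2; 0]; [:: 0; 2; 1; 0]]%N = 1.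
  rewrite /eval !big_cons !big_nil mulg1 /act /= -/c1 esym => e2; apply/commuteRE.
  by apply: odd_exp_eq1 o5 (sandwich_exp sX Xe) _; rewrite expg2.
have V1 := vector1; have V1v := vectorR V1 kv; have V1w := vectorR V1 kw.
have V1vw := vectorR V1v kw; have V1wv := vectorR V1w kv.
have Vc f : vector f -> commute f c by case=> z Xz ->; exact: (sandwich_comm sX).
have cv := kv.2; have cw := kw.2.
apply: (@finite_norm_relation _ c a L 5 5 [:: 0; 1; 2]%N) => //.
- move=> z i zL; move: z zL i => z; rewrite {1}/L !inE; do ![case/predU1P => [->|]]; last (move=> /eqP->);
    move=> [|[|[|//]]] //= _ _; rewrite /act /= -/c1 ?esym;
    first [by rewrite killed1 | by rewrite killed2 | by apply/commuteRE; assumption].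
- move=> z z' zL z'L.
  have H x : x \in L -> [\/ act c a x = c, vector (act c a x) | act c a x = [~ c1, v, w, u]].
    rewrite {1}/L !inE; do ![case/predU1P => [->|]]; last (move=> /eqP->);
      rewrite /act /= -/c1 ?esym; first [by apply: Or31 | by apply: Or33 | by apply: Or32].
  have eV x : x \in L -> commute [~ c1, v, w, u] (act c a x).
    rewrite {1}/L !inE; do ![case/predU1P => [->|]]; last (move=> /eqP->);
      rewrite /act /= -/c1 ?esym; rewrite ?/c1; cm.
  have [->|Vz|->] := H z zL; have [->|Vz'|->] := H z' z'L; try exact: commute_refl.
  + by apply: commute_sym; exact: Vc.
  + exact: commute_sym.
  + exact: Vc.
  + exact: vectorC.
  + by apply: commute_sym; exact: eV.
  + exact: ec.
  + exact: eV.
- move=> z zL; apply: (sandwich_exp sX); move: zL; rewrite {1}/L !inE.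
  do ![case/predU1P => [->|]]; last (move=> /eqP->);
    rewrite /act /= -/c1 ?esym//; exact: vector_sub.
- apply: (sandwich_torsion3 o5 (ex_intro _ 1%N erefl) sX Xu kv.1 kw.1).
  exact: prod_letters_generated.
- apply: (sandwich_order sX); apply: (subgroupM (generated_subgroup X)).
    apply: (@generatedS _ [set` a]); last exact: prod_letters_generated.
    by move=> x; rewrite /= !inE => /or3P[]/eqP-> //; [exact: kv.1|exact: kw.1].
  exact: sub_generated.
Qed.

Lemma terminal_lt3 n : (n < 3)%N -> terminal n.
Proof.
by case: n => [|[|[|//]]] _; [exact: terminal0|exact: terminal1|exact: terminal2].
Qed.

Hypothesis torsion4 : forall x y z t, X x -> X y -> X z -> X t ->
  forall g, generated [set` [:: x; y; z; t]] g -> g ^+ 5 = 1.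

Definition extend_word (w : seq nat) : seq (seq nat) :=
  [seq rcons w i | i <- iota 0 4 & i \notin take 3 (rev w)].

Definition words4 : seq (seq nat) :=
  flatten (traject (fun W => flatten (map extend_word W)) [:: [::]] 6).

(* The norm relation of v1 * v2 * v3 * v4 consists of the 24 products of
   distinct letters and of words of the form x y z t x; the latter disappear
   after one more commutator with a letter. *)
Definition sum_words : seq (seq nat) := permutations (iota 0 4) ++
  [seq w <- norm_words (predC [in words4]) (iota 0 4) 5 | size w == 5%N].

Lemma swap5 f v w1 w2 w3 : vector f -> killer v -> killer w1 -> killer w2 -> killer w3 ->
  [~ f, v, w1, w2, w3, v] = [~ f, v, w2, w1, w3, v].
Proof.
move=> Vf kv k1 k2 k3; have := @word_swap f [:: v] w1 w2 [:: w3; v] Vf.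
rewrite /= killed3 ?mulg1//; first apply; last exact: killerR.
by move=> x; rewrite !inE => /or4P[/eqP->|/eqP->|/eqP->|/orP[]/eqP->].
Qed.

(** A word x y z t x could only continue with y. By [swap5] it equals x z y t x, and then y t x y is
    killed by [killed3]. *)
Lemma words4_ext f (a : seq G) (w : seq nat) i : vector f -> {in a, forall v, killer v} -> (i < 4)%N ->
  w \in words4 -> rcons w i \notin words4 -> act f a (rcons w i) = 1.
Proof.
move=> Vf ka i4 wL iL; have kn := killer_nth _ ka.
have [near|far] := boolP (i \in take 3 (rev w)); first exact: act_near3.
have : all (fun w => all (fun i => [|| i \in take 3 (rev w), rcons w i \in words4 |
    [&& size w == 5, i == nth 0 w 1 & nth 0 w 0 == nth 0 w 4]%N]) (iota 0 4)) words4 by vm_compute.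
move=> /allP/(_ _ wL)/allP/(_ i); rewrite mem_iota i4 (negbTE far) (negbTE iL) => /(_ isT) /=.
case: w {wL far iL} => [|x [|y [|z [|t [|x' [|]]]]]] //= /andP[/eqP-> /eqP <-].
rewrite /act /= (swap5 Vf (kn x) (kn y) (kn z) (kn t)) killed3//.
all: try exact: kn.
all: try (do 2 (apply: vectorR; last exact: kn)); exact: Vf.
Qed.

Lemma sum_relation f v1 v2 v3 v4 : vector f -> killer v1 -> killer v2 -> killer v3 -> killer v4 ->
  eval f [:: v1; v2; v3; v4] sum_words = 1.
Proof.
move=> Vf k1 k2 k3 k4; set a := [:: v1; v2; v3; v4].
have ka : {in a, forall x, killer x} by move=> x; rewrite !inE => /or4P[]/eqP->.
have aX : [set` a] `<=` X by move=> x /ka[].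
apply: (@finite_norm_relation _ f a words4 5 5 (iota 0 4)).
- by vm_compute.
- by move=> w i wL i4; exact: words4_ext.
- by move=> w w' _ _; apply: vectorC; exact: vector_act.
- by move=> w _; apply: vector_exp; exact: vector_act.
- case: k1 k2 k3 k4 => [X1 _] [X2 _] [X3 _] [X4 _].
  apply: (torsion4 X1 X2 X3 X4).
  exact: prod_letters_generated.
- apply: (sandwich_order sX); apply: (subgroupM (generated_subgroup X)).
    by apply: (@generatedS _ [set` a]); last exact: prod_letters_generated.
  by apply: sub_generated; exact: vector_sub.
- by vm_compute.
Qed.

Definition repeated n := forall f v l, size l = n -> vector f -> killer v ->
  {in l, forall w, killer w} -> [~ word f (v :: l), v] = 1.

Lemma repeated_perm n f v l l' : repeated n -> size l = n.+1 -> vector f -> killer v ->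
  {in l, forall w, killer w} -> perm_eq l l' ->
  [~ word f (v :: l), v] = [~ word f (v :: l'), v].
Proof.
move=> rn sl Vf kv kl ll'; have sl' := perm_size ll'.
pose Phi l := if size l == n.+1 then [~ word f (v :: l), v] else 1.
have -> : [~ word f (v :: l), v] = Phi l by rewrite /Phi sl eqxx.
have -> : [~ word f (v :: l'), v] = Phi l' by rewrite /Phi -sl' sl eqxx.
apply: (@perm_eq_swap _ _ (fun v => `[< killer v >])) ll'; last first.
  by apply/allP => w /kl kw; exact/asboolP.
move=> l1 w1 w2 l2 /allP k; have {}k : {in l1 ++ w1 :: w2 :: l2, forall v, killer v}.
  by move=> x /k/asboolP.
rewrite /Phi !size_cat /=; case: eqP => // /eqP; rewrite !addnS eqSS => /eqP sn.
have V1 := vectorR Vf kv; rewrite (word_swap V1 k).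
have kx : {in l1 ++ w2 :: w1 :: l2, forall v, killer v}.
  by move=> z zl; apply: k; move: zl; rewrite !mem_cat !inE (orbCA (z == w1)).
have ky : {in l1 ++ [~ w1, w2] :: l2, forall v, killer v}.
  move=> z; rewrite mem_cat inE => /or3P[zl|/eqP->|zl]; first by apply: k; rewrite mem_cat zl.
    by apply: killerR; apply: k; rewrite mem_cat !inE eqxx ?orbT.
  by apply: k; rewrite mem_cat !inE zl !orbT.
rewrite commgM (_ : [~ word _ (l1 ++ [~ w1, w2] :: l2), v] = 1); last first.
  by apply: (rn f v) => //; rewrite size_cat /= addnS.
rewrite mulg1; apply/commuteJE; apply: vectorC; last exact: vector_word.
by apply: vectorR => //; exact: vector_word.
Qed.

Lemma repeated2 : repeated 2.
Proof.
move=> f v [|w1 [|w2 [|//]]] // _ Vf kv kl; rewrite /= killed3//.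
all: by apply: kl; rewrite !inE eqxx ?orbT.
Qed.

Lemma repeated_lt3 n : (n < 3)%N -> repeated n.
Proof.
case: n => [|[|[|//]]] _; last exact: repeated2.
  by move=> f v l /size0nil -> Vf kv _; exact: killed1.
by move=> f v [|w [|//]] // _ Vf kv kl; apply: killed2 => //; apply: kl; rewrite mem_head.
Qed.

(** Appending [v] to the sum relation leaves only the 3! products that begin with [v], all equal to
    [e] by [repeated_perm]; so [e ^+ 6 = 1], while [e ^+ 5 = 1]. *)
Lemma repeated3 : repeated 3.
Proof.
move=> f v [|w1 [|w2 [|w3 [|//]]]] // _ Vf kv kl.
have k1 : killer w1 by apply: kl; rewrite !inE eqxx ?orbT.
have k2 : killer w2 by apply: kl; rewrite !inE eqxx ?orbT.
have k3 : killer w3 by apply: kl; rewrite !inE eqxx ?orbT.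
set e := [~ _, v]; have Xe : X e.
  by apply: vector_sub; apply: vectorR => //; apply: (vector_word Vf) => x; rewrite inE => /predU1P[->//|]; exact: kl.
set a := [:: v; w1; w2; w3].
have ka : {in a, forall x, killer x} by move=> x; rewrite !inE => /or4P[]/eqP->.
pose P (s : seq nat) := rcons s 0%N \in words4.
have actP s : s \in sum_words -> act f a (rcons s 0%N) = if P s then e else 1.
  move=> sQ; case: ifPn => Ps; last first.
    apply: words4_ext => //; have : all [in words4] sum_words by vm_compute.
    by move=> /allP; apply.
  have : all (fun s => (rcons s 0%N \in words4) ==>
    (rcons s 0%N \in [seq 0%N :: rcons t 0%N | t <- permutations (iota 1 3)])) sum_words by vm_compute.
  move=> /allP/(_ _ sQ); rewrite -/(P s) Ps => /mapP[t]; rewrite mem_permutations => pt ->.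
  rewrite act_map /= map_rcons foldl_rcons /e /=.
  have pt' := perm_map (nth 1 a) pt.
  by symmetry; apply: (@repeated_perm 2 f v [:: w1; w2; w3] (map (nth 1 a) t) repeated2) => //; rewrite perm_sym.
have e6 : e ^+ 6 = 1.
  have := sum_relation Vf kv k1 k2 k3; rewrite -/a /eval => R.
  have := @word_prod [seq act f a s | s <- sum_words] [:: v].
  rewrite !big_map R word1 => R'; rewrite [RHS]R'; last first.
  - by move=> x; rewrite inE => /eqP->.
  - by move=> _ /mapP[s _ ->]; exact: vector_act.
  rewrite (eq_big_seq (fun s => if P s then e else 1)); last first.
    by move=> s sQ; rewrite -actP// act_rcons.
  rewrite -big_mkcond big_const_seq (_ : count P sum_words = 6)%N; last by vm_compute.
  by rewrite /= !expgS expg0.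
by have := sandwich_exp sX Xe; move: e6; rewrite expgS => + e5; rewrite e5 mulg1.
Qed.

(* Together with symmetry this kills words of length at least 4, as 24 is prime
   to 5. *)
Lemma sum4 f v1 v2 v3 v4 : vector f -> killer v1 -> killer v2 -> killer v3 -> killer v4 ->
  \prod_(s <- permutations (iota 0 4)) word f (map (nth 1 [:: v1; v2; v3; v4]) s) = 1.
Proof.
move=> Vf k1 k2 k3 k4; have := sum_relation Vf k1 k2 k3 k4; set a := [:: v1; v2; v3; v4].
have ka : {in a, forall x, killer x} by move=> x; rewrite !inE => /or4P[]/eqP->.
have kn i : killer (nth 1 a i) by exact: killer_nth.
rewrite /sum_words eval_cat [eval f a (filter _ _)]/eval big1_seq ?mulg1; last first.
  move=> s; rewrite mem_filter => /andP[_ /andP[/eqP s5 sQ]].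
  have : all (fun s => (size s == 5)%N ==> (nth 0 s 0 == nth 0 s 4)%N)
    (norm_words (predC [in words4]) (iota 0 4) 5) by vm_compute.
  move=> /allP/(_ _ sQ); rewrite s5 /=.
  case: s s5 {sQ} => [|x [|y [|z [|t [|x' [|]]]]]] //= _ /eqP <-.
  apply: (@repeated3 f _ (map (nth 1 a) [:: y; z; t])) => //.
  by move=> ? /mapP[? _ ->].
move=> R; rewrite -[RHS]R /eval; apply: eq_bigr => s _; by rewrite act_map.
Qed.

Lemma sum4_perm (v1 v2 v3 v4 : G) l (s : seq nat) : s \in permutations (iota 0 4) ->
  perm_eq (v1 :: v2 :: v3 :: v4 :: l) (map (nth 1 [:: v1; v2; v3; v4]) s ++ l).
Proof.
rewrite mem_permutations => /(perm_map (nth 1 [:: v1; v2; v3; v4])) p.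
by rewrite -[_ :: _]/([:: v1; v2; v3; v4] ++ l) perm_cat2r perm_sym.
Qed.

Lemma repeated_all n : repeated n.
Proof.
elim: n => [|[|[|[|n IH]]]]; first exact: repeated_lt3.
- by move=> _; exact: repeated_lt3.
- by move=> _; exact: repeated_lt3.
- by move=> _; exact: repeated3.
move=> f v [|v1 [|v2 [|v3 [|v4 l]]]] // sl Vf kv kl.
have [k1 k2 k3 k4] : [/\ killer v1, killer v2, killer v3 & killer v4].
  by split; apply: kl; rewrite !inE eqxx ?orbT.
have kl' : {in l, forall w, killer w} by move=> w wl; apply: kl; rewrite !inE wl !orbT.
set e := [~ _, v]; have Xe : X e.
  by apply: vector_sub; apply: vectorR => //; apply: (vector_word Vf) => x; rewrite inE => /predU1P[->//|]; exact: kl.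
set a := [:: v1; v2; v3; v4].
have ka : {in a, forall x, killer x} by move=> x; rewrite !inE => /or4P[]/eqP->.
have Vfv := vectorR Vf kv; have := sum4 Vfv k1 k2 k3 k4; rewrite -/a => R.
have := @word_prod [seq word [~ f, v] (map (nth 1 a) s) | s <- permutations (iota 0 4)] (rcons l v).
rewrite !big_map R word1.
rewrite (eq_big_seq (fun=> e)); last first.
  move=> s sP; rewrite foldl_rcons -foldl_cat /e.
  by symmetry; apply: (repeated_perm IH) => //; exact: sum4_perm.
rewrite big_const_seq count_predT size_permutations// => e24.
have e5 : e ^+ 5 = 1 := sandwich_exp sX Xe.
have {e24} : e ^+ (5 * 5) = e.
  rewrite -[RHS]mulg1 (e24 _ _) ?/fact; last 2 first.
  - by move=> _ /mapP[s _ ->]; apply: vector_word => // _ /mapP[? _ ->]; exact: killer_nth.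
  - by move=> x; rewrite mem_rcons inE => /predU1P[->//|]; exact: kl'.
  by rewrite !expgS expg0.
by rewrite expgnA e5 expg1n.
Qed.

Definition short_words : seq (seq nat) := flatten (traject (fun W => flatten (map
  (fun w => [seq rcons w i | i <- iota 1 3 & i \notin w]) W)) [:: [::]] 4).

(** Index 0 is [u]. A nontrivial word starts with [u], the other letters commuting with [c]; it goes
    on with distinct killers, and by [terminal_lt3] a second [u] can only follow all three of
    them. *)
Definition terminal_words : seq (seq nat) := [::] :: [seq 0%N :: w | w <- short_words]
  ++ [seq 0%N :: rcons w 0%N | w <- permutations (iota 1 3)].

(** The norm relation of u v1 v2 v3 acting on [c] consists of the six words with [u] in front of the
    three killers and of words with a further [u] at the end, whose value [e] commutes with [u]. Its
    commutator with [u] is [e ^+ 6 = 1]. *)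
Lemma terminal3 : terminal 3.
Proof.
move=> [|v1 [|v2 [|v3 [|//]]]] // _ kl; set a := [:: u; v1; v2; v3]; set l := [:: v1; v2; v3] in kl.
have [k1 k2 k3] : [/\ killer v1, killer v2 & killer v3] by split; apply: kl; rewrite !inE eqxx ?orbT.
have [Xe ec eu el] := @terminal_central 2 l terminal2 erefl kl; set e := [~ _, u] in Xe ec eu el.
(* Putting 1 for [u] at index 0 keeps the numbering and leaves killers only, so the lemmas on
   killers apply to what follows the leading [u]. *)
set b := 1 :: l; have kb : {in b, forall v, killer v}.
  by move=> v; rewrite inE => /predU1P[->|/kl//]; exact: killer1.
have kn i := killer_nth i kb.
have actE s : 0%N \notin s -> act c a (0%N :: s) = act c1 b s.
  rewrite -[LHS]/(act c1 a s) !act_map => s0; congr (word c1 _); apply/eq_in_map => -[|i] //.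
  by rewrite (negbTE s0).
have actV s : 0%N \notin s -> vector (act c a (0%N :: s)).
  by move=> s0; rewrite actE//; apply: vector_act => //; exact: vector1.
have actP s : s \in permutations (iota 1 3) -> act c a (0%N :: rcons s 0%N) = e.
  move=> ps; rewrite -[0%N :: _]/(rcons (0%N :: s) 0%N) act_rcons.
  rewrite actE ?act_map; last by move: ps; rewrite mem_permutations => /perm_mem ->.
  symmetry; apply: (@terminal_perm 2 l _ terminal2 erefl kl); rewrite perm_sym.
  by move: ps; rewrite mem_permutations => /(perm_map (nth 1 b)).
have ea i : commute e (nth 1 a i).
  case: i => [|[|[|[|i]]]] //=; try by apply: el; rewrite !inE eqxx ?orbT.
  by rewrite nth_nil; exact: commute1.
have eact s : commute e (act c a s).
  by rewrite act_map; apply: commute_word => // _ /mapP[i _ ->].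
have Vc f : vector f -> commute f c by case=> z Xz ->; exact: (sandwich_comm sX).
have classify s : s \in terminal_words ->
    [\/ s = [::], exists2 t, s = 0%N :: t & (0%N \notin t) && (size t <= 3)%N |
        exists2 t, t \in permutations (iota 1 3) & s = 0%N :: rcons t 0%N].
  rewrite inE mem_cat => /or3P[/eqP->|/mapP[t tL ->]|/mapP[t tL ->]]; first exact: Or31.
    apply: Or32; exists t => //.
    have : all (fun t => (0%N \notin t) && (size t <= 3)%N) short_words by vm_compute.
    by move=> /allP/(_ t tL).
  by apply: Or33; exists t.
set L := terminal_words; pose NW := norm_words (predC [in L]) (iota 0 4) 5.
pose Q1 := [seq 0%N :: s | s <- permutations (iota 1 3)].
pose Q2 := [seq s <- NW | size s == 5%N].
have R : eval c a (Q1 ++ Q2) = 1.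
  apply: (@finite_norm_relation _ c a L 5 5 (iota 0 4)).
  - by vm_compute.
  - move=> s i sL i4 iL; rewrite act_rcons.
    have [es|[t es /andP[t0 t3]]|[t tP es]] := classify s sL.
    + rewrite es; case: i i4 iL => [|i] i4 iL; first by rewrite es in iL.
      by apply/commuteRE; exact: (kn i.+1).2.
    + rewrite es actE//; case: i i4 iL => [|i] i4 iL.
        rewrite act_map; apply/commuteRE.
        have [t2|t2] := leqP (size t) 2; last first.
          move: iL; have : all (fun w => (size w == 4)%N ==> (0%N \in behead w) || (rcons w 0%N \in L)) L by vm_compute.
          move=> /allP/(_ _ sL); rewrite es /= (negbTE t0) /= (_ : size t = 3)%N; last by apply/eqP; rewrite eqn_leq t3.
          by move=> /= ->.
        have kt : {in map (nth 1 b) t, forall v, killer v} by move=> _ /mapP[? _ ->].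
        have st : size (map (nth 1 b) t) = size t by rewrite size_map.
        by apply: (terminal_lt3 t2) => //; rewrite st.
      rewrite -[nth 1 a i.+1]/(nth 1 b i.+1) -act_rcons; apply: act_near3 => //; first exact: vector1.
      move: iL; have : all (fun w => all (fun i => [|| w == [::], 0%N \in behead w, i.+1 \in take 3 (rev (behead w)) |
         rcons w i.+1 \in L]) (iota 0 3)) L by vm_compute.
      move=> /allP/(_ _ sL)/allP/(_ i); rewrite mem_iota => /(_ i4).
      by rewrite es /= (negbTE t0) orFb => /orP[|->].
    + by rewrite es actP//; apply/commuteRE.
  - have H s : s \in L -> [\/ act c a s = c, vector (act c a s) | act c a s = e].
      move=> /classify[->|[t -> /andP[t0 _]]|[t tP ->]]; first exact: Or31.
        by apply: Or32; exact: actV.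
      by apply: Or33; exact: actP.
    move=> z z' zL z'L; have [->|Vz|->] := H z zL; have [->|Vz'|->] := H z' z'L; try exact: commute_refl.
    + by apply: commute_sym; exact: Vc.
    + exact: commute_sym.
    + exact: Vc.
    + exact: vectorC.
    + by apply: commute_sym; exact: eact.
    + exact: ec.
    + exact: eact.
  - move=> s /classify[->|[t -> /andP[t0 _]]|[t tP ->]]; first exact: (sandwich_exp sX).
      by apply: vector_exp; exact: actV.
    by rewrite actP//; exact: (sandwich_exp sX).
  - by apply: (torsion4 Xu k1.1 k2.1 k3.1); exact: prod_letters_generated.
  - apply: (sandwich_order sX); apply: (subgroupM (generated_subgroup X)).
      apply: (@generatedS _ [set` a]); last exact: prod_letters_generated.
      by move=> x; rewrite /= !inE => /or4P[]/eqP-> //; [exact: k1.1|exact: k2.1|exact: k3.1].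
    exact: sub_generated.
  - by vm_compute.
have Q2u : commute (eval c a Q2) u.
  apply: commute_sym; rewrite /eval big_seq; apply: commute_prod => s sQ.
  have : all (fun s => s \in [seq 0%N :: rcons w 0%N | w <- permutations (iota 1 3)]) Q2 by vm_compute.
  by move=> /allP/(_ _ sQ)/mapP[t tP ->]; rewrite actP//; exact: commute_sym.
have : [~ eval c a Q1, u] = 1.
  apply/commuteRE; move: R; rewrite eval_cat => /eqP; rewrite mulg_eq1 => /eqP ->.
  by apply: commute_sym; apply: commuteV; exact: commute_sym.
have -> : eval c a Q1 = \prod_(x <- [seq act c a s | s <- Q1]) x by rewrite big_map.
rewrite (@commg_prod_const _ e); last first.
  move=> _ /mapP[_ /mapP[s sP ->] ->]; split=> //.
  by rewrite -(actP s sP) -[0%N :: rcons s _]/(rcons (0%N :: s) 0%N) act_rcons.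
rewrite !size_map size_permutations//= => e6; apply/commuteRE.
by move: e6; rewrite -/(word c1 l) -/e expgS (sandwich_exp sX Xe) mulg1.
Qed.

(** The 24 words obtained by permuting the first four letters have trivial product, while each has
    the same commutator [e] with [u]; so [e ^+ 24 = 1]. *)
Lemma terminal_all n : terminal n.
Proof.
elim: n => [|[|[|[|n IH]]]]; first exact: terminal_lt3.
- by move=> _; exact: terminal_lt3.
- by move=> _; exact: terminal_lt3.
- by move=> _; exact: terminal3.
move=> [|v1 [|v2 [|v3 [|v4 l]]]] // [sl] kl.
have [k1 k2 k3 k4] : [/\ killer v1, killer v2, killer v3 & killer v4].
  by split; apply: kl; rewrite !inE eqxx ?orbT.
have kl' : {in l, forall w, killer w} by move=> w wl; apply: kl; rewrite !inE wl !orbT.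
set a := [:: v1; v2; v3; v4]; have sl' : size (a ++ l) = n.+4 by rewrite /= sl.
have ka : {in a, forall x, killer x} by move=> x; rewrite !inE => /or4P[]/eqP->.
have [Xe ec eu el] := terminal_central IH sl' kl; set e := [~ _, u] in Xe ec eu el.
have e5 : e ^+ 5 = 1 := sandwich_exp sX Xe.
have := sum4 vector1 k1 k2 k3 k4; rewrite -/a => R.
have := @word_prod [seq word c1 (map (nth 1 a) s) | s <- permutations (iota 0 4)] l.
rewrite !big_map R word1.
have -> : \prod_(s <- permutations (iota 0 4)) word (word c1 (map (nth 1 a) s)) l =
   \prod_(x <- [seq word c1 (map (nth 1 a) s ++ l) | s <- permutations (iota 0 4)]) x.
  by rewrite big_map; apply: eq_bigr => s _; rewrite foldl_cat.
move=> e24; have := @commg_prod_const [seq word c1 (map (nth 1 a) s ++ l) | s <- permutations (iota 0 4)] e.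
rewrite -e24 ?comm1g; last 2 first.
- by move=> _ /mapP[s _ ->]; apply: vector_word vector1 _ => _ /mapP[? _ ->]; exact: killer_nth.
- exact: kl'.
rewrite size_map size_permutations// => e24'; apply/commuteRE.
have {e24'} : e ^+ (5 * 5) = e.
  rewrite -[RHS]mulg1 e24'; last first.
    move=> _ /mapP[s sP ->]; have p := sum4_perm v1 v2 v3 v4 l sP; split.
      by symmetry; apply: (terminal_perm IH sl' kl).
    apply: commute_word => [|v vl]; first exact: commuteR.
    by apply: el; rewrite (perm_mem p).
  by rewrite -[e in e * _]expg1 -expgnDr.
by rewrite expgnA e5 expg1n.
Qed.
End Terminal.

Lemma repeated_word f (h l : seq G) : (forall n, (n < size h)%N -> repeated n) -> vector f ->
  {in h, forall v, killer v} -> {subset l <= h} -> ~~ uniq l -> word f l = 1.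
Proof.
move=> rep Vf kh lh; elim: l f Vf lh => [//|v l IH] f Vf lh nu.
have kv : killer v by apply/kh/lh; rewrite mem_head.
have lh' : {subset l <= h} by move=> w wl; apply: lh; rewrite inE wl orbT.
have [ul|nul] := boolP (uniq l); last by apply: IH => //; exact: vectorR.
move: nu; rewrite /= ul andbT negbK => vl; case/splitPr: vl lh lh' ul => q r lh lh'.
rewrite cat_uniq /= => /and3P[uq /norP[vq _] _].
rewrite foldl_cat /= (rep (size q) _ f v q)//; first exact: word1.
  have /uniq_leq_size : uniq (v :: q) by rewrite /= vq.
  by apply=> w; rewrite inE => wq; apply: lh; rewrite inE mem_cat; case/orP: wq => ->; rewrite ?orbT.
by move=> w wq; apply/kh/lh'; rewrite mem_cat wq.
Qed.

Lemma killer_core u (h : seq G) : X u -> {in h, forall v, killer v} ->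
  (forall n, (n < size h)%N -> repeated n) ->
  (forall d, X d -> commute d u -> {in h, forall v, commute d v} -> d = 1) ->
  (forall l, uniq l -> {subset l <= h} -> commute (word [~ c, u] l) u) -> commute c u.
Proof.
move=> Xu kh rep central1 term; have V1 : vector [~ c, u] by exists u.
(* Descending induction on the length of [l]: beyond [size h] a word repeats a letter. *)
suff H n l : (size h < size l + n)%N -> {subset l <= h} -> word [~ c, u] l = 1.
  by apply/commuteRE; exact: (H (size h).+1 [::]).
elim: n l => [|n IH] l; rewrite ?addn0 => sl lh.
  by apply: (repeated_word rep) => //; apply: contraL sl => ul; rewrite -leqNgt; exact: uniq_leq_size.
have [ul|nul] := boolP (uniq l); last exact: (repeated_word rep).
apply: central1 => [||v vh]; last 2 first.
- exact: term.
- apply/commuteRE; rewrite -foldl_rcons; apply: IH; first by rewrite size_rcons addSnnS.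
  by move=> w; rewrite mem_rcons inE => /predU1P[->|/lh].
by apply: vector_sub; apply: vector_word => // w /lh/kh.
Qed.
End Core5.

Lemma nilpotent_rank5_le3 r : (r <= 3)%N -> nilpotent_rank 5 5 r.
Proof.
move=> r3 G X s sX Xs ss.
have H x y z : [set` s] = [set` [:: x; y; z]] -> nilpotent (generated [set` s]).
  move=> e; rewrite e in Xs *; apply: (sandwich_nilpotent3 (isT : odd 5) sX);
    by apply: Xs; rewrite /= !inE eqxx ?orbT.
have E l : s =i l -> [set` s] = [set` l] :> set G by move=> sl; apply/seteqP; split=> x /=; rewrite sl.
case: s ss Xs H E => [|x [|y [|z [|? ?]]]] ss Xs H E; last by rewrite -ss in r3.
- exact: (@nilpotent_rank0 5 5 G X [::] sX).
- by apply: (H x x x); apply: E => w; rewrite !inE !orbb.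
- by apply: (H x y y); apply: E => w; rewrite !inE !orbb.
- exact: H.
Qed.

(** The four-letter relations presuppose that products of four letters have exponent 5, so this rank
    is proved beforehand with three-letter relations. A repetition-free word has at most three
    killers, and [terminal2] covers those with two. *)
Lemma nilpotent_rank5_4 : nilpotent_rank 5 5 4.
Proof.
apply: core_nilpotent; first by exists 1%N.
apply: centralizing_core; first exact: nilpotent_rank5_le3.
move=> G X u h sX Xu Xh sh gen ZG.
have [Y [XY sY YR]] := odd_comm_closure (isT : odd 5) sX.
exists Y; split=> // [y|c Yc ch]; first exact: (sandwich_ptorsion sY).
have Yu : Y u := XY u Xu.
have central1 d : Y d -> commute d u -> {in h, forall v, commute d v} -> d = 1.
  by move=> Yd du dh; apply: ZG; [exact: (central_cons gen)|exact: (sandwich_ptorsion sY)].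
have kh : {in h, forall v, killer Y c v} by move=> v vh; split; [exact/XY/Xh|exact: ch].
apply: (killer_core sY YR Yc Yu kh) => // [n|l ul lh].
  by rewrite sh; exact: repeated_lt3.
have kl : {in l, forall v, killer Y c v} by move=> v /lh/kh.
have sl : (size l <= 3)%N by rewrite -sh; exact: uniq_leq_size.
have [l3|/(conj sl)/andP] := ltnP (size l) 3; first exact: (terminal_lt3 sY YR Yc Yu l3 _ kl).
rewrite -eqn_leq => /eqP {}sl.
have [Ye ec eu el] := terminal_central sY YR Yc Yu (terminal2 sY YR Yc Yu) sl kl.
(* The obstruction is central: a repetition-free [l] inside [h] with as many letters has the same
   members as [h]. *)
apply/commuteRE; apply: central1 => // v vh; apply: el.
by have [_ ->] := uniq_min_size ul lh (eq_leq (etrans sh (esym sl))).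
Qed.

Theorem nilpotent_rank5 r : nilpotent_rank 5 5 r.
Proof.
elim: r => [|r IH]; first exact: nilpotent_rank0.
apply: core_nilpotent; first by exists 1%N.
apply: centralizing_core IH _ => G X u h sX Xu Xh sh gen ZG.
have [Y [XY sY YR]] := odd_comm_closure (isT : odd 5) sX.
exists Y; split=> // [y|c Yc ch]; first exact: (sandwich_ptorsion sY).
have Yu : Y u := XY u Xu.
have torsion4 x y z t : Y x -> Y y -> Y z -> Y t ->
    forall g, generated [set` [:: x; y; z; t]] g -> g ^+ 5 = 1.
  move=> Yx Yy Yz Yt g Ag.
  have AY : [set` [:: x; y; z; t]] `<=` Y by move=> a; rewrite /= !inE => /or4P[]/eqP->.
  apply: (sandwich_torsion sY); [by exists 1%N|exact: (generatedS AY)|].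
  apply: (nilpotent_ptorsion (k := 1) (nilpotent_rank5_4 sY AY erefl)) => // a /AY Ya.
  by rewrite expn1; exact: (sandwich_exp sY).
have kh : {in h, forall v, killer Y c v} by move=> v vh; split; [exact/XY/Xh|exact: ch].
apply: (killer_core sY YR Yc Yu kh) => [n _|d Yd du dh|l _ lh].
- exact: (repeated_all sY YR Yc torsion4).
- by apply: ZG; [exact: (central_cons gen)|exact: (sandwich_ptorsion sY)].
- by apply: (terminal_all sY YR Yc Yu torsion4 erefl) => v /lh/kh.
Qed.

(** * Exponent 4 *)

(** If [t] does not commute with [m], it commutes with [[~ m, t]]. The letters already treated still
    centralize the latter, because they commute with [t] modulo [H] and [H] centralizes [m]. *)
Lemma unipotent_fixed (G : groupType) (M H : set G) (T : seq G) m0 :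
  normal_subgroup M -> normal_subgroup H ->
  (forall m t, M m -> t \in T -> commute [~ m, t] t) ->
  (forall t t', t \in T -> t' \in T -> H [~ t, t']) ->
  M m0 -> m0 <> 1 -> (forall h, H h -> commute m0 h) ->
  exists m, [/\ M m, m <> 1, forall h, H h -> commute m h & forall t, t \in T -> commute m t].
Proof.
move=> nM nH; elim: T => [|t T IH] uT TH Mm0 m01 m0H; first by exists m0.
have [||m [Mm m1 mH mT]] := IH _ _ Mm0 m01 m0H.
- by move=> m u Mm uT'; apply: uT => //; rewrite inE uT' orbT.
- by move=> u u' uT' u'T; apply: TH; rewrite inE ?uT' ?u'T orbT.
have [mt|mt] := pselect (commute m t).
  by exists m; split=> // u; rewrite inE => /predU1P[->|/mT].
have nmt : [~ m, t] <> 1 by move=> /commuteRE.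
have commJ g : commute m (g ^ t^-1) -> commute (m ^ t) g.
  by move=> h; apply/(commute_conj _ _ t^-1); rewrite conjgK.
exists [~ m, t]; split=> //.
- by rewrite commgEl; apply: (subgroupM nM.1); [exact: (subgroupV nM.1)|exact: nM.2].
- move=> h Hh; rewrite commgEl; apply: commute_sym; apply: commuteM.
    by apply: commuteV; apply: commute_sym; exact: mH.
  by apply: commute_sym; apply: commJ; apply: mH; exact: nH.2.
move=> u; rewrite inE => /predU1P[->|uT']; first by apply: uT => //; rewrite mem_head.
rewrite commgEl; apply: commute_sym; apply: commuteM.
  by apply: commuteV; apply: commute_sym; exact: mT.
apply: commute_sym; apply: commJ; rewrite conjgR; apply: commuteM; first exact: mT.
apply: mH; rewrite commgV; apply: nH.2; apply: (subgroupV nH.1); apply: TH; rewrite !inE ?eqxx//.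
by rewrite uT' orbT.
Qed.

Section CommutatorWords.
Variables (G : groupType) (s : seq G).
Hypotheses (sV : forall x, x \in s -> x^-1 \in s) (gen : generated [set` s] = setT).

Local Notation comm_words := (iter_comm s s).

(** Plays the part of a lower central term, with explicit generators: the unipotent action needed in
    [unipotent_fixed] is established for the words, not for arbitrary elements. *)
Definition comm_tail i : set G := generated [set t | exists2 j, (i <= j)%N & t \in comm_words j].

Lemma comm_tail_sub i j t : (i <= j)%N -> t \in comm_words j -> comm_tail i t.
Proof. by move=> ij tj; apply: sub_generated; exists j. Qed.

Lemma comm_wordsS j t x : t \in comm_words j -> x \in s -> [~ t, x] \in comm_words j.+1.
Proof. by move=> tj xs; apply/allpairsP; exists (t, x). Qed.

Lemma comm_tail_normal i : normal_subgroup (comm_tail i).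
Proof.
split; first exact: generated_subgroup.
move=> g h ih; have gs : generated [set` s] g by rewrite gen.
apply: (normalized_generated _ _ _ ih gs); first exact: generated_subgroup.
  apply/normalized_generator => t x [j ij tj] xs; rewrite conjgR.
  apply: (subgroupM (generated_subgroup _)); first exact: comm_tail_sub tj.
  by apply: (@comm_tail_sub i j.+1); [exact: leqW|exact: comm_wordsS].
by move=> x; exact: sV.
Qed.

Lemma comm_tailR i t g : t \in comm_words i -> comm_tail i.+1 [~ t, g].
Proof.
move=> ti; have [sH HJ] := comm_tail_normal i.+1.
have : generated [set` s] g by rewrite gen.
suff: generated [set` s] `<=` [set g | comm_tail i.+1 [~ t, g]] by apply.
apply: generated_min => [|x xs]; last first.
  by apply: (@comm_tail_sub _ i.+1) => //; exact: comm_wordsS.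
apply/subgroupP; split=> [|x y tx ty|x tx] /=.
- by rewrite commg1; exact: (subgroup1 sH).
- by rewrite commgMr; apply: (subgroupM sH) => //; exact: HJ.
- by rewrite commgV; apply: HJ; exact: (subgroupV sH).
Qed.

(** Each application of [unipotent_fixed] adds the words of one lower index to the centralizer, down
    to the generators themselves. *)
Lemma comm_tail_fixed (M : set G) n m : normal_subgroup M ->
  (forall a i t, M a -> t \in comm_words i -> commute [~ a, t] t) ->
  M m -> m <> 1 -> (forall h, comm_tail n h -> commute m h) ->
  exists c, [/\ M c, c <> 1 & forall g, commute c g].
Proof.
move=> nM uni; elim: n m => [|n IH] m Mm m1 mH.
  exists m; split=> // g; have : generated [set` s] g by rewrite gen.
  by apply: commute_generated => x xs; apply: mH; exact: (@comm_tail_sub 0 0).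
have [||c [Mc c1 cH cT]] := unipotent_fixed nM (comm_tail_normal n.+1) (T := comm_words n) _ _ Mm m1 mH.
- by move=> a t; exact: uni.
- by move=> t t' tn _; exact: comm_tailR.
apply: (IH c) => // h; apply: commute_generated => t [j nj tj].
move: nj; rewrite leq_eqVlt => /predU1P[nj|nj]; first by apply: cT; rewrite nj.
by apply: cH; exact: comm_tail_sub tj.
Qed.
End CommutatorWords.

(* The squares of the elements of X generate an elementary abelian normal
   subgroup M, and the quotient by M is covered by the case of involutions. A
   commutator word t satisfies t ^+ 2 \in M, hence acts on M by an operator with
   (t - 1)^2 = 0. *)
Lemma core4 r : core 4 4 r.
Proof.
move=> G X s0 sX s0X _ gen ZG.
pose M := generated [set x ^+ 2 | x in X].
have nM : normal_subgroup M.
  apply: generated_normal => _ g [x Xx <-]; exists (x ^ g); first exact: (sandwichJ sX).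
  by rewrite conjXg.
(* [[~ x ^+ 2, y ^+ 2]] is [[~ x, y] ^+ 4], that is [[~ x ^+ 4, y]], hence trivial. *)
have genC x y : X x -> X y -> commute (x ^+ 2) (y ^+ 2).
  move=> Xx Xy; apply: commute_sym; apply/commuteRE.
  have k2 : [~ x ^+ 2, y] = [~ x, y] ^+ 2 by apply: commgX; exact: (sandwich_comm sX).
  have ky := sandwich_commr sX Xx Xy.
  have e : [~ y, x ^+ 2] = ([~ x, y] ^+ 2)^-1 by rewrite -k2 invgR.
  rewrite commgX ?e; last by cm.
  rewrite expVgn -expgnA (_ : [~ x, y] ^+ (2 * 2) = 1) ?invg1//.
  rewrite -(@commgX _ _ _ 4) ?(sandwich_exp sX Xx) ?comm1g//; exact: (sandwich_comm sX).
have MC a b : M a -> M b -> commute a b.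
  move=> Ma; apply: commute_generated => _ [y Xy <-]; apply: commute_sym; move: a Ma.
  by apply: commute_generated => _ [x Xx <-]; exact: genC.
have M2 a : M a -> a ^+ 2 = 1.
  suff: M `<=` [set a | M a /\ a ^+ 2 = 1] by move=> /[apply] -[].
  apply: generated_min => [|_ [x Xx <-]]; last first.
    split; first by apply: sub_generated; exists x.
    by rewrite -expgnA; exact: (sandwich_exp sX).
  apply/subgroupP; split=> [|x y [Mx x2] [My y2]|x [Mx x2]] /=.
  - by split; [exact: (subgroup1 nM.1)|rewrite expg1n].
  - split; first exact: (subgroupM nM.1).
    by rewrite (expgMn 2 (MC _ _ Mx My)) x2 y2 mulg1.
  - by split; [exact: (subgroupV nM.1)|rewrite expVgn x2 invg1].
have [Q [f [fM f_surj f1]]] := quotient_type nM.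
have sXf : sandwich 2 4 (f @` X).
  split.
  - move=> _ g [x Xx <-]; have [h ->] := f_surj g; exists (x ^ h); last exact: (morphJ fM).
    exact: (sandwichJ sX).
  - by move=> _ [x Xx <-]; rewrite -(morphX fM); apply/f1; apply: sub_generated; exists x.
  - move=> _ _ [x Xx <-] [y Xy <-]; rewrite /commute -(morphR fM) -!fM.
    by congr f; exact: (sandwich_comm sX).
  (* An eighth power in [M] means [k ^+ 16 = 1], which lowers to [k ^+ 4 = 1]: the quotient keeps
     the bound 4. *)
  - move=> g; rewrite -(image_generated fM) => -[k Xk <-]; rewrite -!(morphX fM) => /f1/M2 k16.
    have -> : k ^+ 4 = 1; last exact: (morph1 fM).
    by apply: (sandwich_order sX) => //; rewrite -k16 -expgnA.
have [n nQ] : nilpotent [set: Q].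
  have -> : [set: Q] = generated [set` map f s0].
    apply/seteqP; split=> // q _; have [g ->] := f_surj q.
    have : (f @` generated [set` s0]) (f g) by exists g => //; rewrite gen.
    by rewrite (image_generated fM); apply: generatedS => _ [x xs <-]; exact: map_f.
  apply: (nilpotent_rank2 sXf (r := size s0)); last by rewrite size_map.
  by move=> _ /mapP[x xs ->]; exists x => //; exact: s0X.
set s := inv_closure s0.
have sV x : x \in s -> x^-1 \in s by exact: inv_closureV.
have gens : generated [set` s] = setT.
  apply/seteqP; split=> // g _; have : generated [set` s0] g by rewrite gen.
  by apply: generatedS => x; exact: inv_closure_mem.
have Yw i t : t \in iter_comm s s i -> strong_invol (f @` X) (f t).
  have Ys x : x \in s -> strong_invol (f @` X) (f x).
    rewrite mem_cat => /orP[xs|/mapP[y ys ->]].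
      by apply: (sub_strong_invol sXf); exists x => //; exact: s0X.
    have Xfy : (f @` X) (f y) by exists y => //; exact: s0X.
    rewrite (morphV fM) (invol_inv (sandwich_exp sXf Xfy)).
    exact: (sub_strong_invol sXf).
  elim: i t => [|i IH] t /=; first exact: Ys.
  move=> /allpairsP[[u x] /= [/IH Yu /Ys Yx ->]]; rewrite (morphR fM).
  by have [] := strong_invol_comm sXf Yu Yx.
have uni a i t : M a -> t \in iter_comm s s i -> commute [~ a, t] t.
  move=> Ma /Yw[_ t2 _]; have Mt2 : M (t ^+ 2) by apply/f1; rewrite (morphX fM).
  have aV : a^-1 = a by apply: invol_inv; exact: M2.
  have att : (a ^ t) ^ t = a by rewrite -conjgM -expg2; apply/commuteJE; exact: MC.
  apply/commuteJE; rewrite commgEl aV conjMg att; apply: MC => //; exact: nM.2.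
have wM i t : t \in iter_comm s s i -> upper_central setT (n - i) (f t).
  elim: i t => [|i IH] t /=; first by move=> _; rewrite subn0; exact: nQ.
  move=> /allpairsP[[u x] /= [/IH Yu xs ->]]; rewrite (morphR fM) subnS.
  case: (n - i)%N Yu => [|k] /=; last by case=> _; apply.
  by move=> ->; rewrite comm1g.
have tailM : comm_tail s n `<=` M.
  apply: generated_min => [|t [j nj /wM]]; first exact: nM.1.
  by rewrite (eqP (_ : n - j == 0)%N)// => /f1.
have M1 a : M a -> a = 1.
  move=> Ma; apply: contrapT => a1.
  have [|c [Mc c1 cZ]] := @comm_tail_fixed _ _ sV gens M n a nM uni Ma a1.
    by move=> h /tailM Mh; exact: MC.
  by apply: c1; apply: ZG => //; exists 1%N; rewrite expn1 (expgnA c 2 2) (M2 c Mc) expg1n.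
have sX2 : sandwich 2 4 X.
  split; [exact: (sandwichJ sX)| |exact: (sandwich_comm sX)|].
    by move=> x Xx; apply: M1; apply: sub_generated; exists x.
  move=> g Xg g8; apply: (sandwich_order sX) => //.
  by rewrite (expgnA _ 8 2) g8 expg1n.
have nG : nilpotent (generated [set` s0]) := nilpotent_rank2 sX2 s0X erefl.
move=> x xs; apply: contrapT => x1.
have [||c [_ c1 cs]] := @nilpotent_central G setT s0 _ _ nG x xs x1; [by []|by []|].
apply: c1; apply: ZG => [g|].
  by have : generated [set` s0] g by [rewrite gen]; exact: commute_generated.
have : generated [set` s0] c by rewrite gen.
apply: (nilpotent_ptorsion (k := 1) nG) => y /s0X Xy; rewrite expn1.
exact: (sandwich_exp sX).
Qed.

Theorem nilpotent_rank4 r : nilpotent_rank 4 4 r.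
Proof. by apply: core_nilpotent; [exists 1%N|exact: core4]. Qed.

(** * Left 3-Engel elements *)

Lemma expg_gcdn (G : groupType) (g : G) m n : (0 < m)%N -> g ^+ m = 1 -> g ^+ n = 1 ->
  g ^+ gcdn m n = 1.
Proof.
move=> m0 gm gn; have [a _ /dvdnP[k e]] := Bezoutl n m0.
have : g ^+ (gcdn m n + a * n) = 1 by rewrite e mulnC expgnA gm expg1n.
by rewrite expgnDr mulnC (expgnA _ n) gn expg1n mulg1.
Qed.

Lemma no_order_expg (G : groupType) (g : G) p e : prime p -> ~ has_order g (p ^ e.+1) ->
  g ^+ (p ^ e.+1) = 1 -> g ^+ (p ^ e) = 1.
Proof.
move=> pp no gpe; apply: contrapT => ge; apply: no; split=> //; first by rewrite expn_gt0 prime_gt0.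
move=> m /andP[m0 mpe] gm; apply: ge; have := expg_gcdn m0 gm gpe.
have /(dvdn_pfactor _ _ pp)[i _ ei] := dvdn_gcdr m (p ^ e.+1).
have : (gcdn m (p ^ e.+1) < p ^ e.+1)%N by apply: leq_ltn_trans mpe; exact/dvdn_leq/dvdn_gcdl.
rewrite ei ltn_exp2l ?prime_gt1// ltnS => ie.
exact: ptorsionX.
Qed.

Section Engel.
Variables (G : groupType) (x : G).
Hypothesis x_engel : left_3_engel x.

(** With [y = (x ^ h)^-1] one has [[~ h, x] = y * x], so the Engel identity reduces to [[~ y, x, x]
    = 1]: [x] commutes with its conjugate under [y], hence with that under [x ^ h]. *)
Lemma engel_commute_conj a b : conj_class x a -> conj_class x b -> commute a (a ^ b).
Proof.
have H h : commute x (x ^ (x ^ h)).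
  have := x_engel h; rewrite (commgEr h) conjVg; set y := (x ^ h)^-1; rewrite (commgM y x x) commgg mulg1.
  move=> /commuteRE; rewrite -{3}((commuteJE x x).1 (commute_refl x)) => /commute_conj.
  rewrite commgEr => k; have {}k : commute x (x^-1 ^ y).
    have := commute_sym k; rewrite -{1}[x]invgK => k'.
    by rewrite -[x^-1 ^ y](mulgK x); apply: commuteM; [exact: commute_sym|exact: commuteV].
  apply/commute_sym/(commute_conj _ _ y); rewrite -{1}[x ^ h]invgK -/y conjgKV.
  by apply: commute_Vr; rewrite -conjVg.
move=> [g ->] [h ->]; have := H (h * g^-1) => /(commute_conj _ _ g).
by rewrite (conjJg x _ g) -(conjgM x (h / g) g) mulgVK.
Qed.

Lemma engel_sandwich p q k : x ^+ (k * p) = 1 ->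
  (forall g, generated (conj_class x) g -> g ^+ (q * p) = 1 -> g ^+ q = 1) ->
  sandwich p q (conj_class (x ^+ k)).
Proof.
move=> xkp ord; have H a b : conj_class x a -> conj_class x b -> commute [~ a, b] a.
  move=> xa xb; have := engel_commute_conj xa xb; rewrite commgEl => ?.
  by apply: commute_sym; apply: commuteM; cm.
have H' a b : conj_class x a -> conj_class x b -> commute [~ a, b] b.
  move=> xa xb; rewrite -invgR; apply: commute_sym; apply: commuteV; apply: commute_sym; exact: H.
have E y : conj_class (x ^+ k) y -> exists2 a, conj_class x a & y = a ^+ k.
  by move=> [g ->]; exists (x ^ g); [exists g|rewrite conjXg].
split=> [_ g [h ->]|_ [g ->]|_ _ /E[a xa ->] /E[b xb ->]|g kg].
- by exists (h * g); rewrite conjgM.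
- by rewrite -conjXg -expgnA xkp conj1g.
- have h1 := H a b xa xb; have h2 := H' a b xa xb.
  have e1 : [~ a ^+ k, b] = [~ a, b] ^+ k by exact: commgX.
  have e2 : [~ b, a ^+ k] = ([~ a, b] ^+ k)^-1 by rewrite -e1 invgR.
  rewrite -invgR commgX e2; last by cm.
  by move: [~ a, b] h1 {h2 e1 e2} => d h1; cm.
- apply: ord; apply: generated_sub kg => _ /E[a xa ->].
  by apply: (subgroupX _ (generated_subgroup _)); exact: sub_generated.
Qed.

Lemma engel_power_hirsch_plotkin p q k : (forall r, nilpotent_rank p q r) -> x ^+ (k * p) = 1 ->
  (forall g, generated (conj_class x) g -> g ^+ (q * p) = 1 -> g ^+ q = 1) ->
  hirsch_plotkin_radical G (x ^+ k).
Proof.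
move=> rk xkp /(engel_sandwich xkp) sk.
apply: (@mem_hirsch_plotkin _ (generated (conj_class (x ^+ k)))); last first.
  by apply: sub_generated; exists 1; rewrite conjg1.
apply: conj_class_locally_nilpotent => [a g|s sub]; first exact: (sandwichJ sk).
exact: (rk (size s) G _ s sk).
Qed.
End Engel.

Theorem theorem1p4 (G : groupType) (x : G) (n : nat)
    (x_engel : left_3_engel x)
    (x_order : has_order x n) (n_dvd60 : (n %| 60)%N)
    (no_order_8_9_25 :
       forall y : G, normal_closure (generated [set x]) y ->
         [/\ ~ has_order y 8, ~ has_order y 9 & ~ has_order y 25]) :
  hirsch_plotkin_radical G x.
Proof.
have x60 : x ^+ 60 = 1.
  by have [_ xn _] := x_order; move: n_dvd60 => /dvdnP[k ->]; rewrite mulnC expgnA xn expg1n.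
have x180 : x ^+ 180 = 1 by rewrite (expgnA x 60 3) x60 expg1n.
have no_order g : generated (conj_class x) g ->
    [/\ ~ has_order g 8, ~ has_order g 9 & ~ has_order g 25].
  by rewrite -normal_closure_conj; exact: no_order_8_9_25.
have HP := engel_power_hirsch_plotkin x_engel.
have h4 : hirsch_plotkin_radical G (x ^+ 45).
  (* Exponent 16 is lowered to 8 by excluding order 8 for [g ^+ 2], then to 4 by excluding it for
     [g]. *)
  apply: (HP 4 4 45 nilpotent_rank4) => // g xg g16.
  have no2 y : generated (conj_class x) y -> y ^+ 8 = 1 -> y ^+ 4 = 1.
    by move=> /no_order[no8 _ _]; exact: (@no_order_expg G y 2 2).
  apply: (no2 g xg); rewrite (expgnA g 2 4); apply: (no2 (g ^+ 2)).
    exact: (subgroupX _ (generated_subgroup _)).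
  by rewrite -expgnA.
have h3 : hirsch_plotkin_radical G (x ^+ 40).
  apply: (HP 3 3 40 nilpotent_rank3) => [|g /no_order[_ no9 _]].
    by rewrite (expgnA x 60 2) x60 expg1n.
  exact: (@no_order_expg G g 3 1).
have h5 : hirsch_plotkin_radical G (x ^+ 36).
  apply: (HP 5 5 36 nilpotent_rank5) => // g /no_order[_ _ no25].
  exact: (@no_order_expg G g 5 1).
(* 45, 40 and 36 are the idempotents modulo 60 belonging to 4, 3 and 5; their sum is 121 = 2 * 60 +
   1. *)
have -> : x = x ^+ 45 * (x ^+ 40 * x ^+ 36).
  by rewrite -!expgnDr (expgnDr x 120 1) (expgnA x 60 2) x60 expg1n mul1g.
have sHP := hirsch_plotkin_subgroup G.
by apply: (subgroupM sHP) => //; exact: (subgroupM sHP).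
Qed.
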